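(* Let $K$ be a knot in $S^3$ with exterior $E_K$ and let $\rho\colon \pi_1(E_K)\to \mathrm{SL}_2(\mathbb{C})$ be an irreducible metabelian representation. Let $\psi_2$ be the $2$-dimensional direct summand of $Ad\circ\rho$ and let ${}^a\!\rho$ be the irreducible metabelian $\mathrm{SL}_2(\mathbb{C})$-representation associated with $\rho$. Then $$\Delta_{E_K}^{\alpha\otimes\psi_2}(t)=\Delta_{E_K}^{\alpha\otimes {}^a\!\rho}\big(\sqrt{-1}\,t\big).$$ Moreover, suppose that $\rho$ is longitude-regular. Then the Laurent polynomial $P(t)$ in the factorization $\Delta_{E_K}^{\alpha\otimes Ad\circ\rho}(t)=(t-1)\,\Delta_K(-t)\,P(t)$ is given by $\Delta_{E_K}^{\alpha\otimes {}^a\!\rho}(\sqrt{-1}\,t)/(t^2-1)$, i.e. $$\Delta_{E_K}^{\alpha\otimes Ad\circ\rho}(t)=(t-1)\cdot\Delta_K(-t)\cdot\frac{\Delta_{E_K}^{\alpha\otimes {}^a\!\rho}\big(\sqrt{-1}\,t\big)}{t^2-1},$$ where $\Delta_{E_K}^{\alpha\otimes {}^a\!\rho}(\sqrt{-1}\,t)/(t^2-1)$ is a Laurent polynomial in $t$ which consists of only even degree terms.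
   Context: $E_K$ is the complement in $S^3$ of an open tubular neighbourhood of $K$; $\mu$ denotes a meridian and $\lambda$ the preferred longitude on $\partial E_K$; $\Delta_K(t)$ is the Alexander polynomial of $K$. A representation $\rho\colon\pi_1(E_K)\to\mathrm{SL}_2(\mathbb{C})$ is irreducible if $\rho(\pi_1(E_K))$ has no proper invariant line in $\mathbb{C}^2$, and metabelian if $\rho([\pi_1(E_K),\pi_1(E_K)])$ is abelian. $Ad\colon \mathrm{SL}_2(\mathbb{C})\to\mathrm{Aut}(\mathfrak{sl}_2(\mathbb{C}))$ is $Ad_A(v)=AvA^{-1}$, and $E=\begin{pmatrix}0&1\\0&0\end{pmatrix}$, $H=\begin{pmatrix}1&0\\0&-1\end{pmatrix}$, $F=\begin{pmatrix}0&0\\1&0\end{pmatrix}$ is the standard basis of $\mathfrak{sl}_2(\mathbb{C})$. Twisted Alexander polynomial (Wada): let $\pi_1(E_K)=\langle g_1,\dots,g_k\mid r_1,\dots,r_{k-1}\rangle$, let $\alpha\colon\pi_1(E_K)\to\langle t\rangle\simeq H_1(E_K;\mathbb{Z})$ be the abelianization, and let $\alpha(g_l)\ne1$. For a representation $\varphi\colon \pi_1(E_K)\to \mathrm{GL}_n(\mathbb{C})$ let $\Phi_\varphi\colon\mathbb{Z}[\pi_1(E_K)]\to M_n(\mathbb{C}[t^{\pm1}])$ be the $\mathbb{Z}$-linear extension of $\gamma\mapsto\alpha(\gamma)\varphi(\gamma)$. Then $$\Delta_{E_K}^{\alpha\otimes\varphi}(t)=\frac{\det\big(\Phi_\varphi(\partial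 r_i/\partial g_j)\big)_{1\le i\le k-1,\;1\le j\le k,\;j\ne l}}{\det\Phi_\varphi(g_l-1)},$$ with $\partial r_i/\partial g_j$ the Fox derivatives. Equalities of (twisted) Alexander polynomials are understood up to a factor $\pm t^m$, $m\in\mathbb{Z}$. (For the $2$-dimensional representations considered here the formula depends on the presentation only up to $\pm t^{2m}$, so ''only even degree terms'' is meaningful.) Lin presentation: for a free Seifert surface $S$ of genus $g$ of $K$ (i.e. $S^3\setminus N(S)$ is a handlebody, with $\pi_1$ freely generated by $x_1,\dots,x_{2g}$ corresponding to the cores of its $1$-handles), $\pi_1(E_K)=\langle x_1,\dots,x_{2g},\mu\mid\mu a_i^+\mu^{-1}=a_i^-,\ i=1,\dots,2g\rangle$, where $a_i^{\pm}$ are the words in the $x_j$ obtained by pushing the loops $a_i$ of a spine of $S$ off $S$ in the positive/negative normal direction. Fix a Lin presentation. It is known that every irreducible metabelian $\rho$ is, after conjugation, of the form $\rho(x_i)=\begin{pmatrix}z_i&0\\0&z_i^{-1}\end{pmatrix}$, $\rho(\mu)=\begin{pmatrix}0&1\\-1&0\end{pmatrix}$, each $z_i$ a root of unity whose order divides $|\Delta_K(-1)|$. In this form $Ad\circ\rho=\psi_1\oplus\psi_2$ with $\psi_1$ acting on $V_1=\langle H\rangle$ and $\psi_2$ acting on $V_2=\langle E,F\rangle$, and $\psi_2(x_i)=\begin{pmatrix}z_i^2&0\\0&z_i^{-2}\end{pmatrix}$, $\psi_2(\mu)=\begin{pmatrix}0&-1\\-1&0\end{pmatrix}$. The associated representation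 ${}^a\!\rho$ is the irreducible metabelian $\mathrm{SL}_2(\mathbb{C})$-representation ${}^a\!\rho(x_i)=\begin{pmatrix}z_i^2&0\\0&z_i^{-2}\end{pmatrix}$, ${}^a\!\rho(\mu)=\begin{pmatrix}0&1\\-1&0\end{pmatrix}$; $\psi_2$ is conjugate to $\gamma\mapsto(\sqrt{-1})^{[\gamma]}\,{}^a\!\rho(\gamma)$, where $[\gamma]\in H_1(E_K;\mathbb{Z})\simeq\mathbb{Z}$ is the homology class of $\gamma$ (with $[\mu]=1$). Longitude-regular: let $C_*(E_K;\mathfrak{sl}_2(\mathbb{C})_\rho)=\mathfrak{sl}_2(\mathbb{C})\otimes_{Ad\circ\rho^{-1}}C_*(\widetilde{E_K};\mathbb{Z})$, where $\widetilde{E_K}$ is the universal cover and $\mathfrak{sl}_2(\mathbb{C})$ is a right $\mathbb{Z}[\pi_1(E_K)]$-module via $Ad\circ\rho^{-1}$, with homology $H_*(E_K;\mathfrak{sl}_2(\mathbb{C})_\rho)$; $H_*(\lambda;\mathfrak{sl}_2(\mathbb{C})_\rho)$ is the homology of the circle $\lambda$ with the restricted local system. An $\mathrm{SL}_2(\mathbb{C})$-representation $\rho$ is longitude-regular if it is irreducible and: (1) $\dim_{\mathbb{C}}H_1(E_K;\mathfrak{sl}_2(\mathbb{C})_\rho)=1$; (2) the homomorphism $H_1(\lambda;\mathfrak{sl}_2(\mathbb{C})_\rho)\to H_1(E_K;\mathfrak{sl}_2(\mathbb{C})_\rho)$ induced by inclusion is surjective; (3) if $\rho(\pi_1(\partial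 E_K))$ is conjugate into $\left\{\begin{pmatrix}\pm1&w\\0&\pm1\end{pmatrix}\,\middle|\,w\in\mathbb{C}\right\}$, then $\rho(\lambda)\ne\pm\mathbf{1}$. *)

(* Defs.v *)
From HB Require Import structures.
From mathcomp Require Import all_boot all_order all_algebra.
From mathcomp Require Import generic_quotient fraction.
From mathcomp Require Import all_classical all_reals all_analysis.
From mathcomp.real_closed Require Import complex.
From mathcomp Require Import lra.

Set Implicit Arguments.
Unset Strict Implicit.
Unset Printing Implicit Defensive.

Import Order.TTheory GRing.Theory Num.Theory.
Import numFieldNormedType.Exports.

Local Open Scope classical_set_scope.
Local Open Scope ring_scope.

Local Ltac minmax := rewrite ?/Order.min ?/Order.max /=; repeat match goal with
  | |- context [if ?a < ?b then _ else _] =>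
      lazymatch constr:((a, b)) with
      | context [if _ then _ else _] => fail
      | _ => case: (ltP a b) => ?
      end
  | |- context [if ?a <= ?b then _ else _] =>
      lazymatch constr:((a, b)) with
      | context [if _ then _ else _] => fail
      | _ => case: (leP a b) => ?
      end
  end.

Section Paths.
Variables (R : realType) (T : topologicalType).
Implicit Types (X : set T) (f g : R -> T).

Definition unit_interval : set R := `[0, 1]%classic.
Definition unit_square : set (R * R) := unit_interval `*` unit_interval.

Definition path_in X (x y : T) f : Prop :=
  [/\ {within unit_interval, continuous f},
      forall t, 0 <= t <= 1 -> X (f t), f 0 = x & f 1 = y].

(* homotopy relative to the endpoints *)
Definition homotopic X f g : Prop :=
  exists H : R * R -> T,
  [/\ {within unit_square, continuous H},
      forall p, unit_square p -> X (H p),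
      forall t, 0 <= t <= 1 -> H (0, t) = f t /\ H (1, t) = g t &
      forall s, 0 <= s <= 1 -> H (s, 0) = f 0 /\ H (s, 1) = f 1].

Definition path_cat f g : R -> T :=
  fun t => if t <= 2^-1 then f (2 * t) else g (2 * t - 1).
Definition path_rev f : R -> T := fun t => f (1 - t).

Let cl (t : R) : R := Num.max 0 (Num.min 1 t).

Let cl_in t : 0 <= cl t <= 1.
Proof. by rewrite /cl le_max lexx ge_max ler01 ge_min lexx. Qed.

Let cl_id t : 0 <= t <= 1 -> cl t = t.
Proof.
by case/andP => t0 t1; rewrite /cl min_r // max_r.
Qed.

Let min_cont (f g : R -> R) : continuous f -> continuous g ->
  continuous (fun t => Num.min (f t) (g t)).
Proof. by move=> fc gc t; exact: (continuous_min (fc t) (gc t)). Qed.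

Let max_cont (f g : R -> R) : continuous f -> continuous g ->
  continuous (fun t => Num.max (f t) (g t)).
Proof. by move=> fc gc t; exact: (continuous_max (fc t) (gc t)). Qed.

Let cl_cont : continuous cl.
Proof.
apply: (max_cont (f := cst 0)); first exact: cst_continuous.
apply: (min_cont (f := cst 1) (g := id)); first exact: cst_continuous.
by move=> ?.
Qed.

Let within_retract (U : topologicalType) (A : set U) (r : U -> U) (f : U -> T) :
    continuous r -> (forall u, A (r u)) -> (forall u, A u -> r u = u) ->
  {within A, continuous f} <-> continuous (f \o r).
Proof.
move=> rc rA rid; split => [fc u|fc].
  move/subspace_continuousP : fc => /(_ _ (rA u)) fc W fW.
  have H := fc W fW; rewrite !nbhs_simpl /= in H.
  have {}H := rc u _ H; rewrite !nbhs_simpl /= in H *.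
  by apply: (filterS _ H) => v; apply; exact: rA.
apply: (@subspace_eq_continuous _ _ _ (f \o r)).
  by move=> u /set_mem Au /=; rewrite rid.
exact: continuous_subspaceT.
Qed.

Let within1P f : {within unit_interval, continuous f} <-> continuous (f \o cl).
Proof. by apply: within_retract. Qed.

Let cl2 (p : R * R) : R * R := (cl p.1, cl p.2).

Let pair_cont (U V W : topologicalType) (f : U -> V) (g : U -> W) :
  continuous f -> continuous g -> continuous (fun u => (f u, g u)).
Proof. by move=> fc gc u; have := cvg_pair (fc u) (gc u); apply. Qed.

Let comp_cont (U V W : topologicalType) (f : U -> V) (g : V -> W) :
  continuous f -> continuous g -> continuous (fun u => g (f u)).
Proof. by move=> fc gc u; exact: (continuous_comp (fc u) (gc (f u))). Qed.

Let fst_cont : continuous (fst : R * R -> R).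
Proof. by move=> p; exact: cvg_fst. Qed.

Let snd_cont : continuous (snd : R * R -> R).
Proof. by move=> p; exact: cvg_snd. Qed.

Let cl2_cont : continuous cl2.
Proof.
by apply: pair_cont; apply: comp_cont cl_cont; [exact: fst_cont|exact: snd_cont].
Qed.

Let within2P (H : R * R -> T) :
  {within unit_square, continuous H} <-> continuous (H \o cl2).
Proof.
apply: within_retract => // [p|[s t]].
  by split; rewrite /unit_interval/= in_itv/= cl_in.
rewrite /unit_square /unit_interval /= !in_itv/=.
by case=> s1 t1; rewrite /cl2/= !cl_id.
Qed.

Let square_in (s t : R) : unit_square (s, t) <-> (0 <= s <= 1) /\ (0 <= t <= 1).
Proof. by rewrite /unit_square /unit_interval /= !in_itv. Qed.

(* homotopies extended to the whole plane *)
Let homotopicP X f g : homotopic X f g <->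
  exists H : R * R -> T,
  [/\ continuous H, forall p, X (H p),
      forall t, 0 <= t <= 1 -> H (0, t) = f t /\ H (1, t) = g t &
      forall s, 0 <= s <= 1 -> H (s, 0) = f 0 /\ H (s, 1) = f 1].
Proof.
split=> -[H [Hc HX Ht Hs]].
  exists (H \o cl2); split; first by apply/within2P.
  - by move=> p; apply: HX; rewrite /cl2; apply/square_in; rewrite !cl_in.
  - move=> t t1; rewrite /= /cl2/= (cl_id t1) !cl_id ?lexx ?ler01//.
    exact: Ht.
  - move=> s s1; rewrite /= /cl2/= (cl_id s1) !cl_id ?lexx ?ler01//.
    exact: Hs.
exists H; split => //; exact: continuous_subspaceT.
Qed.

Let paste (U : topologicalType) (F G : U -> T) (phi : U -> R) (c : R) :
    continuous F -> continuous G -> continuous phi ->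
    (forall u, phi u = c -> F u = G u) ->
  continuous (fun u => if phi u <= c then F u else G u).
Proof.
move=> Fc Gc phic FG.
pose A := phi @^-1` [set x | x <= c]; pose B := phi @^-1` [set x | c <= x].
have cA : closed A by apply: closed_comp => // ? _; exact: phic.
have cB : closed B by apply: closed_comp => // ? _; exact: phic.
have AB : A `|` B = setT.
  apply/seteqP; split => // u _; rewrite /A /B /=.
  by case: (leP (phi u) c) => [|/ltW]; [left|right].
have W : {within A `|` B, continuous (fun u => if phi u <= c then F u else G u)}.
  apply: withinU_continuous => //.
    apply: (@subspace_eq_continuous _ _ _ F); last exact: continuous_subspaceT.
    by move=> u /set_mem; rewrite /A /from_subspace /= => ->.
  apply: (@subspace_eq_continuous _ _ _ G); last exact: continuous_subspaceT.
  move=> u /set_mem; rewrite /B /from_subspace /= => cu; case: ifPn => // uc.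
  by apply/esym/FG/eqP; rewrite eq_le uc.
by apply/continuous_subspace_setT; rewrite -AB.
Qed.

Let add_cont (U : topologicalType) (f g : U -> R) : continuous f -> continuous g ->
  continuous (fun t => f t + g t).
Proof. by move=> fc gc t; exact: (continuousD (fc t) (gc t)). Qed.

Let sub_cont (U : topologicalType) (f g : U -> R) : continuous f -> continuous g ->
  continuous (fun t => f t - g t).
Proof. by move=> fc gc t; exact: (continuousB (fc t) (gc t)). Qed.

Let mul_cont (U : topologicalType) (f g : U -> R) : continuous f -> continuous g ->
  continuous (fun t => f t * g t).
Proof. by move=> fc gc t; exact: (continuousM (fc t) (gc t)). Qed.

Let affc (a b : R) : continuous (fun t : R => a * t + b).
Proof.
apply: add_cont; last exact: cst_continuous.
by apply: mul_cont; [exact: cst_continuous|move=> ?].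
Qed.

Lemma path_in_cat X x y z f g :
  path_in X x y f -> path_in X y z g -> path_in X x z (path_cat f g).
Proof.
move=> [fc fX f0 f1] [gc gX g0 g1]; split.
- apply: (@subspace_eq_continuous _ _ _ (fun t : R =>
    if t <= 2^-1 then (f \o cl) (2 * t + 0) else (g \o cl) (2 * t + (-1)))).
    move=> t /set_mem; rewrite /from_subspace /unit_interval/= in_itv/= => /andP[t0 t1].
    rewrite /path_cat addr0; case: ifPn => t2; rewrite cl_id//.
      by apply/andP; split; lra.
    by move: t2; rewrite -ltNge => t2; apply/andP; split; lra.
  apply/continuous_subspaceT/paste.
  + by apply: comp_cont; [exact: affc|exact/within1P].
  + by apply: comp_cont; [exact: affc|exact/within1P].
  + by move=> ?.
  + move=> u -> /=; rewrite divff// addr0 subrr !cl_id ?lexx ?ler01//.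
    by rewrite f1 g0.
- move=> t /andP[t0 t1]; rewrite /path_cat; case: ifPn => t2.
    by apply: fX; apply/andP; split; lra.
  by move: t2; rewrite -ltNge => t2; apply: gX; apply/andP; split; lra.
- by rewrite /path_cat mulr0 invr_ge0 ler0n.
- rewrite /path_cat ifF; first by rewrite -[RHS]g1; congr g; lra.
  by apply/negbTE; rewrite -ltNge; lra.
Qed.

Lemma path_in_rev X x y f : path_in X x y f -> path_in X y x (path_rev f).
Proof.
move=> [fc fX f0 f1]; split.
- apply: (@subspace_eq_continuous _ _ _ (fun t : R => (f \o cl) (-1 * t + 1))).
    move=> t /set_mem; rewrite /from_subspace /unit_interval/= in_itv/= => /andP[t0 t1].
    rewrite /path_rev cl_id//; first by congr f; lra.
    by apply/andP; split; lra.
  by apply/continuous_subspaceT/comp_cont; [exact: affc|exact/within1P].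
- by move=> t /andP[t0 t1]; apply: fX; apply/andP; split; lra.
- by rewrite /path_rev subr0.
- by rewrite /path_rev subrr.
Qed.

Lemma path_in_cst X x : X x -> path_in X x x (cst x).
Proof. by move=> Xx; split => //; exact/continuous_subspaceT/cst_continuous. Qed.

Let reparam X x y f (phi psi : R -> R) : path_in X x y f ->
    continuous phi -> continuous psi ->
    (forall t, 0 <= t <= 1 -> 0 <= phi t <= 1) ->
    (forall t, 0 <= t <= 1 -> 0 <= psi t <= 1) ->
    phi 0 = psi 0 -> phi 1 = psi 1 ->
  homotopic X (f \o phi) (f \o psi).
Proof.
move=> [fc fX _ _] phic psic phi1 psi1 E0 E1; apply/homotopicP.
exists (fun p => (f \o cl) (phi p.2 + p.1 * (psi p.2 - phi p.2))); split.
- apply: (@comp_cont _ _ _ _ (f \o cl)); last exact/within1P.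
  apply: add_cont; first exact: comp_cont snd_cont phic.
  apply: mul_cont; first exact: fst_cont.
  by apply: sub_cont; apply: comp_cont snd_cont _.
- by move=> p; apply: fX; exact: cl_in.
- move=> t t1 /=; split; rewrite ?mul0r ?addr0 ?mul1r; first by rewrite cl_id ?phi1.
  by rewrite addrC subrK cl_id ?psi1.
- move=> s _ /=; rewrite -E0 -E1 !subrr mulr0 !addr0 !cl_id ?phi1// ?lexx ?ler01//.
Qed.

Let homotopic_congr X f f' g g' :
  {in `[0, 1], f =1 f'} -> {in `[0, 1], g =1 g'} ->
  homotopic X f g -> homotopic X f' g'.
Proof.
move=> ff' gg' [H [Hc HX Ht Hs]]; exists H; split => //.
- move=> t t1; have [-> ->] := Ht _ t1.
  by rewrite ff' ?gg' // in_itv.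
- move=> s s1; have [-> ->] := Hs _ s1.
  by rewrite !ff' // in_itv /= ?lexx ?ler01.
Qed.

Lemma homotopic_refl X x y f : path_in X x y f -> homotopic X f f.
Proof.
by move=> fp; apply: (reparam (phi := id) (psi := id) fp) => // ? ?.
Qed.

Lemma homotopic_sym X f g : homotopic X f g -> homotopic X g f.
Proof.
move=> /homotopicP[H [Hc HX Ht Hs]]; apply/homotopicP.
exists (fun p => H (1 - p.1, p.2)); split => //.
- apply: (comp_cont (f := fun p : R * R => (1 - p.1, p.2))) Hc.
  apply: pair_cont snd_cont; apply: sub_cont; last exact: fst_cont.
  exact: cst_continuous.
- by move=> t t1; have [H0 H1] := Ht _ t1; rewrite /= subr0 subrr.
- move=> s /andP[s0 s1] /=.
  have [|-> ->] := Hs (1 - s); first by apply/andP; split; lra.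
  have I0 : 0 <= (0 : R) <= 1 by rewrite lexx ler01.
  have I1 : 0 <= (1 : R) <= 1 by rewrite lexx ler01.
  have [_ <-] := Ht _ I0; have [_ <-] := Ht _ I1.
  by have [-> ->] := Hs _ I1.
Qed.

Lemma homotopic_trans X f g h :
  homotopic X f g -> homotopic X g h -> homotopic X f h.
Proof.
move=> /homotopicP[H [Hc HX Ht Hs]] /homotopicP[K [Kc KX Kt Ks]].
have I0 : 0 <= (0 : R) <= 1 by rewrite lexx ler01.
have I1 : 0 <= (1 : R) <= 1 by rewrite lexx ler01.
have fg0 : f 0 = g 0 by have [_ <-] := Ht _ I0; have [-> _] := Hs _ I1.
have fg1 : f 1 = g 1 by have [_ <-] := Ht _ I1; have [_ ->] := Hs _ I1.
apply/homotopicP; exists (fun p => if p.1 <= 2^-1 then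
  H (cl (2 * p.1 + 0), cl p.2) else K (cl (2 * p.1 + (-1)), cl p.2)); split.
- have cc (a b : R) : continuous (fun p : R * R => (cl (a * p.1 + b), cl p.2)).
    apply: pair_cont; last exact: comp_cont snd_cont cl_cont.
    apply: (comp_cont (f := fun p : R * R => a * p.1 + b)) cl_cont.
    exact: (comp_cont (f := fst)) fst_cont (@affc a b).
  apply: paste.
  + exact: comp_cont (cc 2 0) Hc.
  + exact: comp_cont (cc 2 (-1)) Kc.
  + exact: fst_cont.
  + move=> [s t] /= ->; rewrite divff// addr0 subrr (cl_id I0) (cl_id I1).
    by have [_ ->] := Ht _ (cl_in t); have [-> _] := Kt _ (cl_in t).
- by move=> p; case: ifP.
- move=> t t1 /=; rewrite invr_ge0 ler0n mulr0 addr0 (cl_id t1) (cl_id I0).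
  have -> : (1 <= 2^-1 :> R) = false by apply/negbTE; rewrite -ltNge; lra.
  have -> : 2 * 1 + -1 = 1 :> R by lra.
  by rewrite (cl_id I1); split; [case: (Ht _ t1)|case: (Kt _ t1)].
- move=> s s1 /=; rewrite !(cl_id I0) !(cl_id I1).
  case: ifP => _; first by case: (Hs _ (cl_in (2 * s + 0))).
  by have [-> ->] := Ks _ (cl_in (2 * s + -1)); rewrite fg0 fg1.
Qed.

Lemma homotopic_cat X x y z f f' g g' :
    path_in X x y f -> path_in X y z g ->
    homotopic X f f' -> homotopic X g g' ->
  homotopic X (path_cat f g) (path_cat f' g').
Proof.
move=> [_ _ f0 f1] [_ _ g0 g1].
move=> /homotopicP[H [Hc HX Ht Hs]] /homotopicP[K [Kc KX Kt Ks]].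
have I0 : 0 <= (0 : R) <= 1 by rewrite lexx ler01.
have I1 : 0 <= (1 : R) <= 1 by rewrite lexx ler01.
apply/homotopicP; exists (fun p => if p.2 <= 2^-1 then
  H (cl p.1, cl (2 * p.2 + 0)) else K (cl p.1, cl (2 * p.2 + (-1)))); split.
- have cc (a b : R) : continuous (fun p : R * R => (cl p.1, cl (a * p.2 + b))).
    apply: pair_cont; first exact: comp_cont fst_cont cl_cont.
    apply: (comp_cont (f := fun p : R * R => a * p.2 + b)) cl_cont.
    exact: (comp_cont (f := snd)) snd_cont (@affc a b).
  apply: paste.
  + exact: comp_cont (cc 2 0) Hc.
  + exact: comp_cont (cc 2 (-1)) Kc.
  + exact: snd_cont.
  + move=> [s t] /= ->; rewrite divff// addr0 subrr (cl_id I0) (cl_id I1).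
    by have [_ ->] := Hs _ (cl_in s); have [-> _] := Ks _ (cl_in s); rewrite f1 g0.
- by move=> p; case: ifP.
- move=> t /andP[t0 t1] /=; rewrite /path_cat (cl_id I0) (cl_id I1) addr0.
  case: ifPn => t2.
    have t3 : 0 <= 2 * t <= 1 by apply/andP; split; lra.
    by rewrite (cl_id t3); exact: Ht.
  have t3 : 0 <= 2 * t - 1 <= 1.
    by move: t2; rewrite -ltNge => t2; apply/andP; split; lra.
  by rewrite (cl_id t3); exact: Kt.
- move=> s s1 /=; rewrite /path_cat invr_ge0 ler0n mulr0 addr0 (cl_id I0) (cl_id s1).
  have -> : (1 <= 2^-1 :> R) = false by apply/negbTE; rewrite -ltNge; lra.
  have -> : 2 * 1 - 1 = 1 :> R by lra.
  by rewrite (cl_id I1); case: (Hs _ s1) => -> _; case: (Ks _ s1) => _ ->.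
Qed.

Lemma homotopic_rev X f g :
  homotopic X f g -> homotopic X (path_rev f) (path_rev g).
Proof.
move=> /homotopicP[H [Hc HX Ht Hs]]; apply/homotopicP.
exists (fun p => H (p.1, 1 - p.2)); split => //.
- apply: (comp_cont (f := fun p : R * R => (p.1, 1 - p.2))) Hc.
  apply: pair_cont; first exact: fst_cont.
  by apply: sub_cont; [exact: cst_continuous|exact: snd_cont].
- by move=> t /andP[t0 t1] /=; apply: Ht; apply/andP; split; lra.
- move=> s s1 /=; rewrite /path_rev subr0 subrr.
  by have [-> ->] := Hs _ s1.
Qed.

Let minc (a b c d : R) :
  continuous (fun t : R => Num.min (a * t + b) (c * t + d)).
Proof. by apply: min_cont; exact: affc. Qed.

Let maxc (a b c d : R) :
  continuous (fun t : R => Num.max (a * t + b) (c * t + d)).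
Proof. by apply: max_cont; exact: affc. Qed.

Lemma path_catA X x y z w f g h :
    path_in X x y f -> path_in X y z g -> path_in X z w h ->
  homotopic X (path_cat f (path_cat g h)) (path_cat (path_cat f g) h).
Proof.
move=> fp gp hp; have p := path_in_cat fp (path_in_cat gp hp).
pose phi t : R := Num.min (Num.min (2 * t + 0) (1 * t + 4^-1)) (2^-1 * t + 2^-1).
have phic : continuous phi by apply: min_cont; [exact: minc|exact: affc].
have phi1 t : t <= 4^-1 -> phi t = 2 * t.
  by move=> t4; rewrite /phi !min_l; lra.
have phi2 t : 4^-1 < t -> t <= 2^-1 -> phi t = t + 4^-1.
  by move=> t4 t2; rewrite /phi min_l; [rewrite min_r; lra|rewrite min_r; lra].
have phi3 t : 2^-1 < t -> phi t = 2^-1 * t + 2^-1.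
  by move=> t2; rewrite /phi min_r // le_min; apply/andP; split; lra.
apply: (homotopic_congr _ _ (reparam (phi := id) (psi := phi) p _ _ _ _ _ _)) => //.
- move=> t _; rewrite /path_cat /=.
  have [t4|t4] := leP t 4^-1.
    have -> : (t <= 2^-1) = true by lra.
    have -> : (2 * t <= 2^-1) = true by lra.
    rewrite phi1//; have -> : (2 * t <= 2^-1) = true by lra.
    by [].
  have [t2|t2] := leP t 2^-1.
    have -> : (2 * t <= 2^-1) = false by apply/negbTE; rewrite -ltNge; lra.
    rewrite phi2//.
    have -> : (t + 4^-1 <= 2^-1) = false by apply/negbTE; rewrite -ltNge; lra.
    have -> : (2 * (t + 4^-1) - 1 <= 2^-1) = true by lra.
    by congr g; lra.
  rewrite phi3//.
  have -> : (2^-1 * t + 2^-1 <= 2^-1) = false by apply/negbTE; rewrite -ltNge; lra.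
  have -> : (2 * (2^-1 * t + 2^-1) - 1 <= 2^-1) = false.
    by apply/negbTE; rewrite -ltNge; lra.
  by congr h; lra.
- by move=> ?.
- move=> t /andP[t0 t1]; have [t4|t4] := leP t 4^-1.
    by rewrite phi1//; apply/andP; split; lra.
  have [t2|t2] := leP t 2^-1; first by rewrite phi2//; apply/andP; split; lra.
  by rewrite phi3//; apply/andP; split; lra.
- by rewrite phi1 ?mulr0.
- by rewrite phi3 /=; lra.
Qed.

Lemma path_cat1p X x y f :
  path_in X x y f -> homotopic X (path_cat (cst x) f) f.
Proof.
move=> fp; have [_ _ <- _] := fp.
pose phi t : R := Num.max (0 * t + 0) (2 * t + (-1)).
have phic : continuous phi by exact: maxc.
apply: (homotopic_congr _ _ (reparam (phi := phi) (psi := id) fp _ _ _ _ _ _)) => //.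
- move=> t; rewrite in_itv/= => /andP[t0 t1]; rewrite /phi /path_cat /=.
  minmax; try (exfalso; lra);
  by rewrite /cst; congr f; lra.
- by move=> ?.
- move=> t /andP[t0 t1]; rewrite /phi.
  by minmax; apply/andP; split; lra.
- by rewrite /phi; minmax; lra.
- by rewrite /phi; minmax; lra.
Qed.

Lemma path_catp1 X x y f :
  path_in X x y f -> homotopic X (path_cat f (cst y)) f.
Proof.
move=> fp; have [_ _ _ <-] := fp.
pose phi t : R := Num.min (2 * t + 0) (0 * t + 1).
have phic : continuous phi by exact: minc.
apply: (homotopic_congr _ _ (reparam (phi := phi) (psi := id) fp _ _ _ _ _ _)) => //.
- move=> t; rewrite in_itv/= => /andP[t0 t1]; rewrite /phi /path_cat /=.
  minmax; try (exfalso; lra);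
  by rewrite /cst; congr f; lra.
- by move=> ?.
- move=> t /andP[t0 t1]; rewrite /phi.
  by minmax; apply/andP; split; lra.
- by rewrite /phi; minmax; lra.
- by rewrite /phi; minmax; lra.
Qed.

Lemma path_catpV X x y f :
  path_in X x y f -> homotopic X (path_cat f (path_rev f)) (cst x).
Proof.
move=> fp; have [_ _ <- _] := fp.
pose phi t : R := Num.min (2 * t + 0) (-2 * t + 2).
have phic : continuous phi by exact: minc.
apply: (homotopic_congr _ _ (reparam (phi := phi) (psi := cst 0) fp _ _ _ _ _ _)) => //.
- move=> t; rewrite in_itv/= => /andP[t0 t1]; rewrite /phi /path_cat /path_rev /=.
  by minmax; try (exfalso; lra); congr f; lra.
- exact: cst_continuous.
- move=> t /andP[t0 t1]; rewrite /phi.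
  by minmax; apply/andP; split; lra.
- by move=> t _; rewrite lexx ler01.
- by rewrite /phi /=; minmax; lra.
- by rewrite /phi /=; minmax; lra.
Qed.

Lemma path_catVp X x y f :
  path_in X x y f -> homotopic X (path_cat (path_rev f) f) (cst y).
Proof.
move=> fp; have [_ _ _ <-] := fp.
pose phi t : R := Num.max (2 * t + (-1)) (-2 * t + 1).
have phic : continuous phi by exact: maxc.
apply: (homotopic_congr _ _ (reparam (phi := phi) (psi := cst 1) fp _ _ _ _ _ _)) => //.
- move=> t; rewrite in_itv/= => /andP[t0 t1]; rewrite /phi /path_cat /path_rev /=.
  by minmax; try (exfalso; lra); congr f; lra.
- exact: cst_continuous.
- move=> t /andP[t0 t1]; rewrite /phi.
  by minmax; apply/andP; split; lra.
- by move=> t _; rewrite lexx ler01.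
- by rewrite /phi /=; minmax; lra.
- by rewrite /phi /=; minmax; lra.
Qed.

End Paths.
Record pointed_set (T : Type) := PointedSet {
  carrier :> set T;
  basept : T;
  basept_in : carrier basept
}.

Section FundamentalGroup.
Variables (R : realType) (T : topologicalType) (X : pointed_set T).

Local Notation is_loop := (path_in X (basept X) (basept X)).

Record loop := Loop { loop_fun :> R -> T; loopP : is_loop loop_fun }.

HB.instance Definition _ := gen_eqMixin loop.
HB.instance Definition _ := gen_choiceMixin loop.

Definition loop_equiv : rel loop := fun f g => `[< homotopic X f g >].

Let loop_equiv_refl : reflexive loop_equiv.
Proof. by move=> f; apply/asboolP; exact: homotopic_refl (loopP f). Qed.

Let loop_equiv_sym : symmetric loop_equiv.
Proof. by move=> f g; apply/asboolP/asboolP; exact: homotopic_sym. Qed.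

Let loop_equiv_trans : transitive loop_equiv.
Proof.
by move=> g f h /asboolP fg /asboolP gh; apply/asboolP; exact: homotopic_trans gh.
Qed.

Canonical loop_equiv_rel :=
  EquivRel loop_equiv loop_equiv_refl loop_equiv_sym loop_equiv_trans.

Definition pi1 := {eq_quot loop_equiv_rel}%qT.

HB.instance Definition _ := Choice.on pi1.

Definition loop_one : loop := Loop (path_in_cst R (@basept_in _ X)).
Definition loop_mul (f g : loop) : loop := Loop (path_in_cat (loopP f) (loopP g)).
Definition loop_inv (f : loop) : loop := Loop (path_in_rev (loopP f)).

Definition pi1_one : pi1 := (\pi_pi1 loop_one)%qT.
Definition pi1_mul (a b : pi1) : pi1 := (\pi_pi1 (loop_mul (repr a) (repr b)))%qT.
Definition pi1_inv (a : pi1) : pi1 := (\pi_pi1 (loop_inv (repr a)))%qT.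

Lemma pi1_eqP (f g : loop) :
  (\pi_pi1 f = \pi_pi1 g)%qT <-> homotopic X f g.
Proof.
split; first by move/eqmodP => /asboolP.
by move=> fg; apply/eqmodP/asboolP.
Qed.

Let repr_homotopic (f : loop) : homotopic X (repr (\pi_pi1 f)%qT) f.
Proof. by apply/pi1_eqP; rewrite reprK. Qed.

Lemma pi1_mulE (f g : loop) :
  pi1_mul (\pi_pi1 f)%qT (\pi_pi1 g)%qT = (\pi_pi1 (loop_mul f g))%qT.
Proof.
apply/pi1_eqP; apply: homotopic_cat; [exact: loopP|exact: loopP| |];
  exact: repr_homotopic.
Qed.

Lemma pi1_invE (f : loop) : pi1_inv (\pi_pi1 f)%qT = (\pi_pi1 (loop_inv f))%qT.
Proof. by apply/pi1_eqP; exact/homotopic_rev/repr_homotopic. Qed.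

Let pi1_mulA : associative pi1_mul.
Proof.
elim/quotW=> f; elim/quotW=> g; elim/quotW=> h.
rewrite (pi1_mulE g h) (pi1_mulE f g) !pi1_mulE.
by apply/pi1_eqP; exact: (path_catA (loopP f) (loopP g) (loopP h)).
Qed.

Let pi1_mul1 : left_id pi1_one pi1_mul.
Proof.
elim/quotW=> f; rewrite pi1_mulE; apply/pi1_eqP.
exact: (path_cat1p (loopP f)).
Qed.

Let pi1_mulr1 : right_id pi1_one pi1_mul.
Proof.
elim/quotW=> f; rewrite pi1_mulE; apply/pi1_eqP.
exact: (path_catp1 (loopP f)).
Qed.

Let pi1_mulV : left_inverse pi1_one pi1_inv pi1_mul.
Proof.
elim/quotW=> f; rewrite pi1_invE pi1_mulE; apply/pi1_eqP.
exact: (path_catVp (loopP f)).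
Qed.

Let pi1_mulrV : right_inverse pi1_one pi1_inv pi1_mul.
Proof.
elim/quotW=> f; rewrite pi1_invE pi1_mulE; apply/pi1_eqP.
exact: (path_catpV (loopP f)).
Qed.

HB.instance Definition _ :=
  isGroup.Build pi1 pi1_mulA pi1_mul1 pi1_mulr1 pi1_mulV pi1_mulrV.

(* the class of f, and the trivial class if f is not a loop of X *)
Definition pi1_class (f : R -> T) : pi1 :=
  if pselect (is_loop f) is left fl then (\pi_pi1 (Loop fl))%qT else pi1_one.

End FundamentalGroup.

Section Presentations.
Local Open Scope group_scope.
Variable G : groupType.

Inductive commutator_subgroup : G -> Prop :=
| CommOne : commutator_subgroup 1
| CommGen g h : commutator_subgroup (g * h * g^-1 * h^-1)
| CommMul g h : commutator_subgroup g -> commutator_subgroup h ->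
    commutator_subgroup (g * h)
| CommInv g : commutator_subgroup g -> commutator_subgroup g^-1.

(* the quotient map onto H_1 = G / [G, G], when the latter is infinite cyclic *)
Definition abelianization (alpha : G -> int) : Prop :=
  [/\ forall g h, alpha (g * h) = (alpha g + alpha h)%R,
      forall n : int, exists g, alpha g = n &
      forall g, alpha g = 0%R <-> commutator_subgroup g].

(* the letter (i, false) stands for x_i and (i, true) for x_i^-1 *)
Definition word n := seq ('I_n * bool).

Definition word_inv n (w : word n) : word n :=
  rev [seq (p.1, ~~ p.2) | p <- w].

Definition word_eval n (x : 'I_n -> G) (w : word n) : G :=
  foldr (fun p g => (if p.2 then (x p.1)^-1 else x p.1) * g) 1 w.

(* equality in the group < x_1, .., x_n | rel_1, .., rel_k > *)
Inductive word_equiv n k (rel : 'I_k -> word n) : word n -> word n -> Prop :=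
| WordRefl w : word_equiv rel w w
| WordSym w w' : word_equiv rel w w' -> word_equiv rel w' w
| WordTrans w w' w'' :
    word_equiv rel w w' -> word_equiv rel w' w'' -> word_equiv rel w w''
| WordCancel u v i b : word_equiv rel (u ++ (i, b) :: (i, ~~ b) :: v) (u ++ v)
| WordRel u v i : word_equiv rel (u ++ rel i ++ v) (u ++ v).

Definition presents n k (x : 'I_n -> G) (rel : 'I_k -> word n) : Prop :=
  (forall g, exists w, word_eval x w = g) /\
  (forall w, word_eval x w = 1 <-> word_equiv rel w [::]).

Record deficiency_one_presentation (m : nat) := DeficiencyOnePresentation {
  gen : 'I_m.+1 -> G;
  relator : 'I_m -> word m.+1;
  presentationP : presents gen relator
}.

End Presentations.

(* d w / d x_j, as a formal sum of integer multiples of words *)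
Fixpoint fox n (j : 'I_n) (w : word n) : seq (int * word n) :=
  if w is (i, b) :: w' then
    (if i == j then [:: if b then (-1, [:: (i, true)]) else (1, [::])] else [::])
      ++ [seq (c.1, (i, b) :: c.2) | c <- fox j w']
  else [::].

Section RationalFunctions.
Variable A : idomainType.
Local Notation K := {fraction {poly A}}.

Definition tvar : K := tofrac 'X.
Definition cst_frac (a : A) : K := tofrac a%:P.

Definition laurent (f : K) : Prop :=
  exists (p : {poly A}) (m : int), f = tvar ^ m * tofrac p.
Definition even_laurent (f : K) : Prop :=
  exists (p : {poly A}) (m : int), f = tvar ^ (m *+ 2) * tofrac (p \Po 'X^2).
Definition laurent_dvd (f g : K) : Prop :=
  exists2 q : K, laurent q & g = f * q.

(* equality up to a factor +- t^m *)
Definition doteq (f g : K) : Prop :=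
  exists (e : bool) (m : int), f = (-1) ^+ e * tvar ^ m * g.

(* f(a t) *)
Definition dilate (a : A) (f : K) : K :=
  let r := repr f in
  tofrac ((frac r).1 \Po (a *: 'X)) / tofrac ((frac r).2 \Po (a *: 'X)).

End RationalFunctions.
Arguments tvar {A}.

Section TwistedAlexander.
Variables (A : idomainType) (G : groupType) (m n : nat).
Variables (P : deficiency_one_presentation G m) (alpha : G -> int).
Variable (phi : G -> 'M[A]_n).
Local Notation K := {fraction {poly A}}.

Definition Phi_word (w : word m.+1) : 'M[K]_n :=
  let g := word_eval (gen P) w in
  tvar ^ alpha g *: map_mx (@cst_frac A) (phi g).

Definition Phi (c : seq (int * word m.+1)) : 'M[K]_n :=
  \sum_(p <- c) Phi_word p.2 *~ p.1.

Definition twisted_alexander (l : 'I_m.+1) : K :=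
  \det (\mxblock_(i < m, j < m) Phi (fox (lift l j) (relator P i)))
  / \det (Phi [:: (1, [:: (l, false)]); (-1, [::])]).

End TwistedAlexander.

Section AlexanderPolynomial.
Variables (G : groupType) (m : nat).
Variables (P : deficiency_one_presentation G m) (alpha : G -> int).
Local Notation K := {fraction {poly int}}.

Definition alexander_matrix : 'M[K]_(m, m.+1) :=
  \matrix_(i, j) \sum_(p <- fox j (relator P i))
    tvar ^ alpha (word_eval (gen P) p.2) *~ p.1.

(* D is a greatest common divisor in Z[t, t^-1] of the maximal minors of the
   Alexander matrix *)
Definition alexander_polynomial (D : {poly int}) : Prop :=
  (forall l, laurent_dvd (tofrac D) (\det (col' l alexander_matrix))) /\
  (forall E : K, laurent E ->
     (forall l, laurent_dvd E (\det (col' l alexander_matrix))) ->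
     laurent_dvd E (tofrac D)).

End AlexanderPolynomial.

Section Representations.
Variables (R : realType) (G : groupType).
Local Notation C := R[i].

Definition SL2_representation (rho : G -> 'M[C]_2) : Prop :=
  (forall g h, rho (g * h)%g = rho g *m rho h) /\ (forall g, \det (rho g) = 1).

Definition irreducible2 (rho : G -> 'M[C]_2) : Prop :=
  ~ exists v : 'cV[C]_2, v != 0 /\ forall g, exists c : C, rho g *m v = c *: v.

Definition metabelian (rho : G -> 'M[C]_2) : Prop :=
  forall g h, commutator_subgroup g -> commutator_subgroup h ->
    rho g *m rho h = rho h *m rho g.

Definition mx22 (a b c d : C) : 'M[C]_2 :=
  \matrix_(i, j) if i == 0 then (if j == 0 then a else b)
                 else (if j == 0 then c else d).

Definition sl2E := mx22 0 1 0 0.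
Definition sl2H := mx22 1 0 0 (-1).
Definition sl2F := mx22 0 0 1 0.

Definition Ad (a v : 'M[C]_2) : 'M[C]_2 := a *m v *m invmx a.

(* matrix of Ad_a on sl_2 in the basis E, H, F; the coordinates of a traceless
   matrix v in this basis are v_01, v_00, v_10 *)
Definition Ad_mx (a : 'M[C]_2) : 'M[C]_3 :=
  \matrix_(i, j) let v := Ad a (tnth [tuple sl2E; sl2H; sl2F] j) in
                 tnth [tuple v 0 1; v 0 0; v 1 0] i.

(* matrix of Ad_a on the span of E, F, when Ad_a preserves it *)
Definition AdEF_mx (a : 'M[C]_2) : 'M[C]_2 :=
  \matrix_(i, j) let v := Ad a (tnth [tuple sl2E; sl2F] j) in
                 tnth [tuple v 0 1; v 1 0] i.

End Representations.

Section TwistedHomology.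
Variables (R : realType) (T : topologicalType) (V : lmodType R[i]).

Definition std_simplex n : set 'rV[R]_n.+1 :=
  [set x | (forall i, 0 <= x 0 i) /\ \sum_i x 0 i = 1].
Arguments std_simplex : clear implicits.
Definition vertex n (i : 'I_n.+1) : 'rV[R]_n.+1 := \row_j (j == i)%:R.
Definition face_map n (i : 'I_n.+2) (x : 'rV[R]_n.+1) : 'rV[R]_n.+2 :=
  \row_j if unlift i j is Some k then x 0 k else 0.

(* A singular n-simplex of the universal cover of (X, x0) is given by a singular
   n-simplex of X together with a lift of its vertex 0, that is a path from x0
   to this vertex, up to homotopy. *)
Definition lifted_simplex n : Type := ((R -> T) * ('rV[R]_n.+1 -> T))%type.

Definition is_lifted_simplex (X : set T) (x0 : T) n (s : lifted_simplex n) :=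
  [/\ {within std_simplex n, continuous s.2},
      forall x, std_simplex n x -> X (s.2 x) &
      path_in X x0 (s.2 (vertex ord0)) s.1].

(* the vertex 0 of the face opposite to vertex 0 is vertex 1 *)
Definition lifted_face n (i : 'I_n.+2) (s : lifted_simplex n.+1) :
    lifted_simplex n :=
  (if i == ord0 then
     path_cat s.1 (fun t => s.2 ((1 - t) *: vertex ord0 + t *: vertex (lift ord0 ord0)))
   else s.1,
   s.2 \o face_map i).

(* formal sums of v (x) s *)
Definition chain n := seq (V * lifted_simplex n).

Definition chain_boundary n (c : chain n.+1) : chain n :=
  flatten [seq [seq ((-1) ^+ i *: p.1, lifted_face i p.2) | i : 'I_n.+2] | p <- c].

Definition chain_scale n (a : R[i]) (c : chain n) : chain n :=
  [seq (a *: p.1, p.2) | p <- c].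

Variables (X : set T) (x0 : T) (act : V -> (R -> T) -> V).

(* equality in V (x)_{Z[pi_1(X, x0)]} C_n(universal cover), where
   act v f is the right action on v of the class of the loop f *)
Inductive chain_eq n : chain n -> chain n -> Prop :=
| ChainRefl c : chain_eq c c
| ChainSym c d : chain_eq c d -> chain_eq d c
| ChainTrans c d e : chain_eq c d -> chain_eq d e -> chain_eq c e
| ChainCat c c' d d' :
    chain_eq c c' -> chain_eq d d' -> chain_eq (c ++ d) (c' ++ d')
| ChainComm c d : chain_eq (c ++ d) (d ++ c)
| ChainZero s : chain_eq [:: (0, s)] [::]
| ChainAdd v w s : chain_eq [:: (v + w, s)] [:: (v, s); (w, s)]
| ChainLift v f f' (sigma sigma' : 'rV[R]_n.+1 -> T) :
    homotopic X f f' -> {in std_simplex n, sigma =1 sigma'} ->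
    chain_eq [:: (v, (f, sigma))] [:: (v, (f', sigma'))]
| ChainDeck v g f (sigma : 'rV[R]_n.+1 -> T) :
    path_in X x0 x0 g -> path_in X x0 (f 1) f ->
    chain_eq [:: (v, (path_cat g f, sigma))] [:: (act v g, (f, sigma))].

Definition valid_chain n (c : chain n) : Prop :=
  forall p, p \in c -> is_lifted_simplex X x0 p.2.

Definition cycle1 (c : chain 1) : Prop :=
  valid_chain c /\ chain_eq (chain_boundary c) [::].

Definition homologous1 (c d : chain 1) : Prop :=
  exists2 b : chain 2, valid_chain b & chain_eq c (d ++ chain_boundary b).

Definition dim_H1_eq1 : Prop :=
  exists z : chain 1, [/\ cycle1 z, ~ homologous1 z [::] &
    forall c, cycle1 c -> exists a : R[i], homologous1 c (chain_scale a z)].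

End TwistedHomology.

Section Knots.
Variable R : realType.
Local Notation E4 := 'rV[R]_4.

Definition sqnorm n (v : 'rV[R]_n) : R := \sum_i v 0 i ^+ 2.

Definition sphere n : set 'rV[R]_n.+1 := [set v | sqnorm v = 1].
Definition disc n (r : R) : set 'rV[R]_n := [set v | sqnorm v <= r ^+ 2].

Definition circle_pt (t : R) : 'rV[R]_2 :=
  \row_i if i == 0 then cos (2 * pi * t) else sin (2 * pi * t).

Arguments sphere : clear implicits.
Arguments disc : clear implicits.

(* A closed tubular neighbourhood of the knot K, parametrized by the solid torus
   of radius 2; the open tubular neighbourhood to be removed is the image of the
   open solid torus of radius 1. The larger radius ensures that the boundary
   torus is tame. *)
Record tubular_nbhd (K : set E4) := TubularNbhd {
  nbhd :> 'rV[R]_2 * 'rV[R]_2 -> E4;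
  nbhd_cont : {within sphere 1 `*` disc 2 2, continuous nbhd};
  nbhd_inj : {in sphere 1 `*` disc 2 2 &, injective nbhd};
  nbhd_sphere : forall p, (sphere 1 `*` disc 2 2) p -> sphere 3 (nbhd p);
  nbhd_core : K = nbhd @` (sphere 1 `*` [set 0])
}.

Section Exterior.
Variables (K : set E4) (N : tubular_nbhd K).

Definition exterior_set : set E4 :=
  sphere 3 `\` N @` (sphere 1 `*` [set w | sqnorm w < 1]).

Lemma sqnorm_circle_pt t : sqnorm (circle_pt t) = 1.
Proof.
by rewrite /sqnorm big_ord_recl big_ord1 !mxE /= cos2Dsin2.
Qed.

Lemma exterior_base : exterior_set (N (circle_pt 0, circle_pt 0)).
Proof.
have c1 t : sphere 1 (circle_pt t) by exact: sqnorm_circle_pt.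
have c2 t : disc 2 2 (circle_pt t).
  by rewrite /disc /= sqnorm_circle_pt expr2; lra.
have c12 : (sphere 1 `*` disc 2 2) (circle_pt 0, circle_pt 0).
  exact: (conj (c1 0) (c2 0)).
split; first exact: nbhd_sphere.
case=> -[u w] [u1 w1] E; rewrite /= in u1 w1.
have w2 : (sphere 1 `*` disc 2 2) (u, w).
  by split=> //; rewrite /disc /= expr2; apply: le_trans (ltW w1) _; lra.
have [_ ww] := nbhd_inj (mem_set w2) (mem_set c12) E.
by move: w1; rewrite ww sqnorm_circle_pt ltxx.
Qed.

Definition exterior : pointed_set E4 := PointedSet exterior_base.

Definition knot_group : groupType := pi1 R exterior.

Definition boundary_torus : set E4 := N @` (sphere 1 `*` sphere 1).

Definition meridian (t : R) : E4 := N (circle_pt 0, circle_pt t).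
Definition longitude (t : R) : E4 := N (circle_pt t, circle_pt 0).
Definition longitude_circle : set E4 := N @` (sphere 1 `*` [set circle_pt 0]).

Definition mu : knot_group := pi1_class exterior meridian.
Definition lambda : knot_group := pi1_class exterior longitude.

Definition preferred_framing : Prop := commutator_subgroup lambda.

End Exterior.

(* A ball of dimension d.+1 with k handles [0, 1] x D^d attached along the images
   of {0, 1} x D^d: for d = 2 a handlebody of genus k, for d = 1 a disc with k
   bands, that is a compact surface with boundary. *)
Record handle_decomposition (d k : nat) (X : set E4) := HandleDecomposition {
  ball0 : 'rV[R]_d.+1 -> E4;
  handle1 : 'I_k -> R * 'rV[R]_d -> E4;
  ball0_cont : {within disc d.+1 1, continuous ball0};
  ball0_inj : {in disc d.+1 1 &, injective ball0};
  handle1_cont : forall j,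
    {within @unit_interval R `*` disc d 1, continuous (handle1 j)};
  handle1_inj : forall j,
    {in @unit_interval R `*` disc d 1 &, injective (handle1 j)};
  handle1_disj : forall i j p q, i != j ->
    (@unit_interval R `*` disc d 1) p -> (@unit_interval R `*` disc d 1) q ->
    handle1 i p <> handle1 j q;
  handle1_attach : forall j w, disc d 1 w ->
    (ball0 @` sphere d) (handle1 j (0, w)) /\
    (ball0 @` sphere d) (handle1 j (1, w));
  handle1_free : forall j s w, 0 < s < 1 -> disc d 1 w ->
    ~ (ball0 @` disc d.+1 1) (handle1 j (s, w));
  handle_cover :
    X = ball0 @` disc d.+1 1 `|`
        \bigcup_j (handle1 j @` (@unit_interval R `*` disc d 1))
}.

Section HandleDecomposition.
Variables (d k : nat) (X : set E4) (D : handle_decomposition d k X).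

Definition handle_boundary : set E4 :=
  [set x | (ball0 D @` sphere d) x /\
     forall j p, (@unit_interval R `*` disc d 1) p -> handle1 D j p = x ->
       sqnorm p.2 = 1] `|`
  \bigcup_j (handle1 D j @` (@unit_interval R `*` [set w | sqnorm w = 1])).

(* f is homotopic in X to the loop based at x0 which goes once over the j-th
   handle; eta is a path joining x0 to the ball *)
Definition core_loop (x0 : E4) (eta : R -> E4) (j : 'I_k) (f : R -> E4) : Prop :=
  exists y p q,
    let B := ball0 D @` disc d.+1 1 in
    [/\ path_in X x0 y eta,
        path_in B y (handle1 D j (0, 0)) p,
        path_in B (handle1 D j (1, 0)) y q,
        path_in X x0 x0 f &
        homotopic X f
          (path_cat eta (path_cat p (path_cat (fun t => handle1 D j (t, 0))
            (path_cat q (path_rev eta)))))].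

End HandleDecomposition.

Definition closed_pm1 : set R := `[-1, 1]%classic.
Definition open_pm1 : set R := `]-1, 1[%classic.

(* A free Seifert surface of genus g, seen in the exterior of the knot: a disc
   with 2g bands, bicollared, whose boundary is a single circle, parallel to
   the preferred longitude. The bicollar is normalized on the boundary torus so
   that it occupies there the angles between -1/2 and 0 (in turns): the positive
   side of the surface meets the base point of the exterior. *)
Record free_seifert_surface (K : set E4) (N : tubular_nbhd K) (g : nat) :=
    FreeSeifertSurface {
  surface : set E4;
  surface_sub : surface `<=` exterior_set N;
  spine : handle_decomposition 1 (2 * g) surface;
  collar : E4 * R -> E4;
  collar_cont : {within surface `*` closed_pm1, continuous collar};
  collar_inj : {in surface `*` closed_pm1 &, injective collar};
  collar_sub : forall p, (surface `*` closed_pm1) p -> exterior_set N (collar p);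
  collar0 : forall x, surface x -> collar (x, 0) = x;
  surface_boundary :
    handle_boundary spine = N @` (sphere 1 `*` [set circle_pt (- 4^-1)]);
  collar_boundary : forall u s, sphere 1 u -> closed_pm1 s ->
    collar (N (u, circle_pt (- 4^-1)), s) = N (u, circle_pt ((s - 1) / 4));
  collar_proper : forall x s, surface x -> closed_pm1 s ->
    boundary_torus N (collar (x, s)) -> handle_boundary spine x;
  (* the complement of an open neighbourhood of the surface is a handlebody *)
  complement : set E4 := exterior_set N `\` collar @` (surface `*` open_pm1);
  cores : handle_decomposition 2 (2 * g) complement
}.

Section LinPresentation.
Variables (K : set E4) (N : tubular_nbhd K) (g : nat).

Fixpoint word_loop n (x0 : E4) (x : 'I_n -> R -> E4) (w : word n) : R -> E4 :=
  if w is (i, b) :: w' then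
    path_cat (if b then path_rev (x i) else x i) (word_loop x0 x w')
  else cst x0.

Definition lin_generator (x : 'I_(2 * g) -> R -> E4) (i : 'I_(2 * g).+1) :
    knot_group N :=
  if unlift ord_max i is Some j then pi1_class (exterior N) (x j) else mu N.

Definition widen_word n (w : word n) : word n.+1 :=
  [seq (lift ord_max p.1, p.2) | p <- w].

(* mu a^+ mu^-1 = a^- *)
Definition lin_relator n (ap am : 'I_n -> word n) (i : 'I_n) : word n.+1 :=
  (ord_max, false) :: widen_word (ap i) ++
  (ord_max, true) :: widen_word (word_inv (am i)).

Record lin_presentation := LinPresentation {
  seifert : free_seifert_surface N g;
  (* the loops x_j along the cores of the 1-handles of the complement *)
  lin_x : 'I_(2 * g) -> R -> E4;
  lin_eta : R -> E4;
  lin_x_core : forall j,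
    core_loop (cores seifert) (basept (exterior N)) lin_eta j (lin_x j);
  (* the loops a_i of the spine of the surface *)
  lin_a : 'I_(2 * g) -> R -> E4;
  lin_zeta : R -> E4;
  lin_a_core : forall i,
    core_loop (spine seifert) (N (circle_pt 0, circle_pt (- 4^-1))) lin_zeta i
      (lin_a i);
  lin_ap : 'I_(2 * g) -> word (2 * g);
  lin_am : 'I_(2 * g) -> word (2 * g);
  lin_apP : forall i,
    homotopic (complement seifert)
      (fun t => collar seifert (lin_a i t, 1))
      (word_loop (basept (exterior N)) lin_x (lin_ap i));
  (* the negative push-off is joined to the base point by the half of the
     meridian lying in the complement of the collar *)
  lin_amP : forall i,
    let delta t := N (circle_pt 0, circle_pt (t / 2)) in
    homotopic (complement seifert)
      (path_cat delta
        (path_cat (fun t => collar seifert (lin_a i t, -1)) (path_rev delta)))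
      (word_loop (basept (exterior N)) lin_x (lin_am i));
  lin_presents : presents (lin_generator lin_x) (lin_relator lin_ap lin_am)
}.

Variable L : lin_presentation.

(* rho(x_i) = diag(z_i, 1/z_i), rho(mu) = (0 1; -1 0) *)
Definition lin_form (rho : knot_group N -> 'M[R[i]]_2)
    (z : 'I_(2 * g) -> R[i]) : Prop :=
  (forall i, rho (pi1_class (exterior N) (lin_x L i)) = mx22 (z i) 0 0 (z i)^-1) /\
  rho (mu N) = mx22 0 1 (-1) 0.

End LinPresentation.

Section LongitudeRegular.
Variables (K : set E4) (N : tubular_nbhd K).
Variable rho : knot_group N -> 'M[R[i]]_2.

(* sl_2(C), in coordinates in the basis E, H, F, as a right module via
   Ad o rho^-1 *)
Definition Ad_act (v : 'cV[R[i]]_3) (f : R -> E4) : 'cV[R[i]]_3 :=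
  Ad_mx (rho (pi1_class (exterior N) f)^-1%g) *m v.

Let x0 := basept (exterior N).

Definition longitude_regular : Prop :=
  [/\ SL2_representation rho /\ irreducible2 rho,
      dim_H1_eq1 (exterior_set N) x0 Ad_act,
      forall c, cycle1 (exterior_set N) x0 Ad_act c ->
        exists2 d, cycle1 (longitude_circle N) x0 Ad_act d &
          homologous1 (exterior_set N) x0 Ad_act c d &
      (exists2 Q : 'M[R[i]]_2, Q \in unitmx &
         forall f, path_in (boundary_torus N) x0 x0 f ->
           exists (e : bool) (w : R[i]),
             Q *m rho (pi1_class (exterior N) f) *m invmx Q =
               mx22 ((-1) ^+ e) w 0 ((-1) ^+ e)) ->
      rho (lambda N) <> 1%:M /\ rho (lambda N) <> - 1%:M].

End LongitudeRegular.

End Knots.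

(* Main.v *)
Require Import Defs.
From HB Require Import structures.
From mathcomp Require Import all_boot all_order all_algebra perm fraction generic_quotient.
From mathcomp Require Import all_classical all_reals all_analysis.
From mathcomp.real_closed Require Import complex.
From mathcomp Require Import ring lra zify.

Set Implicit Arguments.
Unset Strict Implicit.
Unset Printing Implicit Defensive.

Import Order.TTheory GRing.Theory Num.Theory.
Import numFieldNormedType.Exports.
Local Open Scope ring_scope.

(** The proof rests on one linear map, the Fox matrix of a presentation, read
    with several coefficient systems.

    Two representations that agree on the generators of Lin's presentation are
    equal. The homomorphism that sends mu to 1 and every x_j to 0 respects Lin's
    relators, so it is the abelianization and alpha x_j = 0
    ([lin_generator_alpha]). Comparing generators, psi_2 is conjugate to
    g |-> i^(alpha g) arho g ([psi2_associated]). Twisting by i^alpha is the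
    substitution t -> i t, which is an automorphism of the field of rational
    functions, and the first equality follows ([twist_psi2_associated]).

    By the same token every rho0 g is diagonal or antidiagonal according to the
    parity of alpha g ([lin_dihedral]), so Ad o rho is conjugate to the direct sum
    of psi_1 = (-1)^alpha and psi_2, and its twisted polynomial is the product of
    theirs ([twist_Ad_split]). The factor of psi_1 is a maximal minor of the
    Alexander matrix over t^(alpha g_l) - 1, taken at -t. Bordering the Alexander
    matrix by the Fox derivatives of a word of degree one gives a square matrix
    whose determinant is, by Cramer's rule, the greatest common divisor of the minors
    up to a unit ([alexander_bordered]); hence this factor is Delta_K(-t) / (-t - 1)
    ([twist_sign]) and the product formula follows.

    It remains to see that the twisted polynomial of psi_2 divided by t^2 - 1 is an
    even Laurent polynomial. Irreducibility provides an element of degree zero,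
    some x_j, for which psi_2 - 1 is invertible. Bordering the Fox matrix of psi_2
    by a word w for this element shows that the twisted polynomial is a constant
    multiple of a determinant with Laurent polynomial entries
    ([fox_bordered_det]). Conjugation by diag(1, -1) shows that it is invariant
    under t -> -t ([twist_psi2_even]), so only its vanishing at t = 1 is at stake
    ([even_laurent_quotient]).

    Suppose that it does not vanish at 1. Then the bordered matrix of psi_2 at t = 1
    is invertible, which makes the Fox complex of psi_2 exact at the middle term
    ([fox_bordered_exact]). The Fox complex of psi_1 is always exact there, because
    the corresponding integer determinant is odd: modulo 2 the sign disappears, and
    the abelianization is infinite cyclic ([fox_sign_bordered_neq0]). Therefore the
    Fox complex of sl_2 is exact there ([sl2_exact]). A Hurewicz argument with local
    coefficients writes every singular 1-cycle as a sum of loops, to which this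
    exactness applies, so that H_1(E_K; sl_2) = 0 ([cycle_null]). This contradicts
    dim H_1(E_K; sl_2) = 1, the first condition of longitude-regularity. *)

(** * Ring morphisms between fields of fractions *)

Lemma fraction_quot (A : idomainType) (x : {fraction A}) :
  x = tofrac (frac (repr x)).1 / tofrac (frac (repr x)).2.
Proof.
rewrite -{1}[x]reprK; set r := repr x.
have d0 : tofrac (frac r).2 != 0 by rewrite tofrac_eq0 denom_ratioP.
apply: (mulIf d0); rewrite mulfVK //; unlock FracField.tofrac.
rewrite -[LHS]FracField.pi_mul; apply/eqmodP => /=.
rewrite /FracField.equivf /FracField.mulf /=.
by rewrite !numden_Ratio ?mulf_neq0 ?oner_neq0 ?denom_ratioP // !mulr1 mulrC.
Qed.

Lemma fractionP (A : idomainType) (x : {fraction A}) :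
  exists p q : A, q != 0 /\ x = tofrac p / tofrac q.
Proof.
by exists (frac (repr x)).1, (frac (repr x)).2; rewrite denom_ratioP -fraction_quot.
Qed.

(** An injective ring morphism extends to the fields of fractions. The extension is
    computed on the chosen representative of a fraction, the form in which
    [dilate] is defined. *)
Section FractionMorphism.
Variables (A B : idomainType) (f : {rmorphism A -> B}).
Hypothesis f_inj : injective f.

Definition frac_map (_ : injective f) (x : {fraction A}) : {fraction B} :=
  tofrac (f (frac (repr x)).1) / tofrac (f (frac (repr x)).2).
Local Notation F := (frac_map f_inj).

Let f_eq0 p : (tofrac (f p) == 0) = (p == 0).
Proof. by rewrite tofrac_eq0 -(inj_eq f_inj) rmorph0. Qed.

Lemma frac_map_quot p q : q != 0 ->
  F (tofrac p / tofrac q) = tofrac (f p) / tofrac (f q).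
Proof.
move=> q0; rewrite /frac_map; set x := tofrac p / tofrac q.
have := fraction_quot x; set r := repr x => E.
have d0 : (frac r).2 != 0 by rewrite denom_ratioP.
have {E} : p * (frac r).2 = (frac r).1 * q.
  apply/eqP; rewrite -tofrac_eq !rmorphM /=; apply/eqP.
  by move: E; rewrite /x => /eqP; rewrite eqr_div ?tofrac_eq0 // => /eqP ->.
move=> /(congr1 (fun a => tofrac (f a))); rewrite !rmorphM /= => E.
by apply/eqP; rewrite eqr_div ?f_eq0 // E.
Qed.

Lemma frac_map_tofrac p : F (tofrac p) = tofrac (f p).
Proof.
by rewrite -[X in F X](divr1 (tofrac p)) -tofrac1 frac_map_quot ?oner_neq0 // !rmorph1 divr1.
Qed.

Lemma frac_map_is_zmod_morphism : zmod_morphism F.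
Proof.
move=> x y; have [p [q [q0 ->]]] := fractionP x; have [r [s [s0 ->]]] := fractionP y.
rewrite !frac_map_quot // -!mulNr -!rmorphN /= !addf_div ?f_eq0 ?tofrac_eq0 //.
by rewrite -!rmorphM -!rmorphD frac_map_quot ?mulf_neq0 // !rmorphD !rmorphM !rmorphN.
Qed.

Lemma frac_map_is_monoid_morphism : monoid_morphism F.
Proof.
split=> [|x y]; first by rewrite -tofrac1 frac_map_tofrac !rmorph1.
have [p [q [q0 ->]]] := fractionP x; have [r [s [s0 ->]]] := fractionP y.
rewrite mulf_div -!rmorphM !frac_map_quot ?mulf_neq0 //.
by rewrite !rmorphM mulf_div.
Qed.

HB.instance Definition _ :=
  GRing.isZmodMorphism.Build _ _ F frac_map_is_zmod_morphism.
HB.instance Definition _ :=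
  GRing.isMonoidMorphism.Build _ _ F frac_map_is_monoid_morphism.

End FractionMorphism.

Lemma comp_scaleX_inj (A : idomainType) (a : A) :
  a != 0 -> injective (comp_poly (a *: 'X) : {poly A} -> {poly A}).
Proof.
move=> a0; apply: raddf_inj => p /eqP.
rewrite -size_poly_eq0 size_comp_poly2 ?size_poly_eq0; first by move/eqP.
by rewrite size_scale // size_polyX.
Qed.

(** * Fox calculus with coefficients in a module *)

(** A right action of G on V is the coefficient system. A crossed map L, additive in
    the coefficient and satisfying L v (gh) = L v g + L (v.g) h, behaves as
    v (x) [g] does in degree one homology, and Fox derivatives are the universal
    way to express L v g through the generators. *)
Section CrossedMorphisms.
Variables (G : groupType) (n : nat) (x : 'I_n -> G).
Variables (V : zmodType) (act : V -> G -> V).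
Hypothesis actD : forall g, {morph act^~ g : u v / u + v}.
Hypothesis actM : forall v g h, act v (g * h)%g = act (act v g) h.

Definition fox_act (v : V) (c : seq (int * word n)) : V :=
  \sum_(p <- c) act v (word_eval x p.2) *~ p.1.

Let fox_act_cons v i b c :
  fox_act v [seq (p.1, (i, b) :: p.2) | p <- c] =
  fox_act (act v (if b then (x i)^-1 else x i)%g) c.
Proof.
by rewrite /fox_act big_map; apply: eq_bigr => p _ /=; rewrite -actM.
Qed.

Hypothesis act1 : forall v, act v 1%g = v.

Section Crossed.
Variables (Q : zmodType) (L : V -> G -> Q).
Hypothesis LD : forall g, {morph L^~ g : u v / u + v}.
Hypothesis LM : forall v g h, L v (g * h)%g = L v g + L (act v g) h.

Lemma crossed0 g : L 0 g = 0.
Proof. by apply: (addrI (L 0 g)); rewrite -LD !addr0. Qed.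

Lemma crossedN v g : L (- v) g = - L v g.
Proof. by apply/eqP; rewrite -subr_eq0 opprK -LD addNr crossed0. Qed.

Lemma crossed_sum I (r : seq I) (P : pred I) (F : I -> V) g :
  L (\sum_(i <- r | P i) F i) g = \sum_(i <- r | P i) L (F i) g.
Proof. exact: (big_morph (L^~ g) (LD g) (crossed0 g)). Qed.

Lemma crossed1 v : L v 1%g = 0.
Proof.
by apply: (addrI (L v 1%g)); rewrite addr0 -{3}(mulg1 1%g) LM act1.
Qed.

Lemma crossedV v g : L v (g^-1)%g = L (- act v (g^-1)%g) g.
Proof.
by apply/eqP; rewrite crossedN -subr_eq0 opprK -LM mulVg crossed1.
Qed.

(** Both sides satisfy the same recursion on the letters of w; a letter x^-1
    contributes - (v . x^-1), whence the sign in [fox]. *)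
Lemma fox_crossed v w :
  L v (word_eval x w) = \sum_j L (fox_act v (fox j w)) (x j).
Proof.
elim: w v => [|[i b] w IH] v.
  by rewrite crossed1 big1 // => j _; rewrite /fox_act big_nil crossed0.
rewrite [word_eval x _]/= LM IH.
have -> : \sum_j L (fox_act v (fox j ((i, b) :: w))) (x j) =
    \sum_j L (fox_act v (if i == j then
       [:: if b then (-1, [:: (i, true)]) else (1, [::])] else [::])) (x j) +
    \sum_j L (fox_act (act v (if b then (x i)^-1 else x i)%g) (fox j w)) (x j).
  rewrite -big_split; apply: eq_bigr => j _ /=.
  by rewrite -LD -fox_act_cons /fox_act -big_cat.
congr (_ + _); rewrite (bigD1 i) //= eqxx big1 ?addr0 => [|j ji]; last first.
  by rewrite eq_sym (negbTE ji) /fox_act big_nil crossed0.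
rewrite /fox_act big_seq1; case: b => /=; last by rewrite act1.
by rewrite crossedV mulg1 mulrN1z.
Qed.

End Crossed.

Let dact v g := act v g - v.

Let dactD g : {morph dact^~ g : u v / u + v}.
Proof. by move=> u v; rewrite /dact actD opprD addrACA. Qed.

Let dactM v g h : dact v (g * h)%g = dact v g + dact (act v g) h.
Proof. by rewrite /dact actM [RHS]addrC addrA subrK. Qed.

(** Exactness of the Fox complex V^k -> V^n -> V at the middle term, that is the
    vanishing of the first homology of the presentation with coefficients in V. *)
Definition fox_exact k (rel : 'I_k -> word n) :=
  forall w : 'I_n -> V, \sum_j (act (w j) (x j) - w j) = 0 ->
  exists u : 'I_k -> V, forall j, w j = \sum_i fox_act (u i) (fox j (rel i)).

(** The fundamental formula of Fox calculus is [fox_crossed] for the crossed map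
    v, g |-> v.g - v. *)
Lemma fox_fundamental v w :
  act v (word_eval x w) - v =
  \sum_j (act (fox_act v (fox j w)) (x j) - fox_act v (fox j w)).
Proof. exact: (fox_crossed dactD dactM). Qed.

(** A 1-cycle of the group is moved to the generators by [fox_crossed]; exactness
    then presents it as a combination of the relators, and crossed maps vanish on
    relators because they vanish on the identity. *)
Lemma crossed_vanish (Q : zmodType) (L : V -> G -> Q)
    k (rel : 'I_k -> word n) :
    (forall g, {morph L^~ g : u v / u + v}) ->
    (forall v g h, L v (g * h)%g = L v g + L (act v g) h) ->
    presents x rel -> fox_exact rel ->
  forall s : seq (V * G), \sum_(p <- s) (act p.1 p.2 - p.1) = 0 ->
  \sum_(p <- s) L p.1 p.2 = 0.
Proof.
move=> LD LM [xgen xrel] ex s s0.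
have [wd wdE] := choice xgen.
have E (Q' : zmodType) (L' : V -> G -> Q') :
    (forall g, {morph L'^~ g : u v / u + v}) ->
    (forall v g h, L' v (g * h)%g = L' v g + L' (act v g) h) ->
    \sum_(p <- s) L' p.1 p.2 =
    \sum_j L' (\sum_(p <- s) fox_act p.1 (fox j (wd p.2))) (x j).
  move=> LD' LM'; under [RHS]eq_bigr do rewrite (crossed_sum LD').
  rewrite exchange_big; apply: eq_bigr => p _ /=.
  by rewrite -(fox_crossed LD' LM') wdE.
rewrite E //; move: s0; rewrite (E _ dact) // => /ex[u uE].
under eq_bigr do rewrite uE (crossed_sum LD).
rewrite exchange_big big1 // => i _; rewrite -(fox_crossed LD LM).
have -> : word_eval x (rel i) = 1%g; last exact: crossed1.
by apply/xrel; have := WordRel rel [::] [::] i; rewrite /= cats0.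
Qed.

End CrossedMorphisms.

Lemma word_eval_cat (G : groupType) n (x : 'I_n -> G) u v :
  word_eval x (u ++ v) = (word_eval x u * word_eval x v)%g.
Proof.
by elim: u => [|p u IH] /=; rewrite ?mul1g // IH mulgA.
Qed.

Lemma word_eval_rel (G : groupType) n k (x : 'I_n -> G) (rel : 'I_k -> word n) i :
  presents x rel -> word_eval x (rel i) = 1%g.
Proof.
by case=> _ xrel; apply/xrel; have := WordRel rel [::] [::] i; rewrite /= cats0.
Qed.

Section AdditiveExtension.
Variables (G : groupType) (A : zmodType) (n : nat).

Definition word_sum (y : 'I_n -> A) (w : word n) : A :=
  \sum_(p <- w) (if p.2 then - y p.1 else y p.1).

Variables (k : nat) (x : 'I_n -> G) (rel : 'I_k -> word n) (y : 'I_n -> A).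
Hypothesis pres : presents x rel.
Hypothesis yrel : forall i, word_sum y (rel i) = 0.

Lemma presents_additive : exists f : G -> A,
  (forall g h, f (g * h)%g = f g + f h) /\
  (forall w, f (word_eval x w) = word_sum y w).
Proof.
have [xgen xrel] := pres; have [wd wdE] := choice xgen.
have ws_cat u v : word_sum y (u ++ v) = word_sum y u + word_sum y v.
  by rewrite /word_sum big_cat.
have ws_inv u : word_sum y (word_inv u) = - word_sum y u.
  rewrite /word_sum /word_inv (perm_big _ (permEl (perm_rev _))) big_map -sumrN.
  by apply: eq_bigr => -[i []] _ //=; rewrite opprK.
have ev_inv u : word_eval x (word_inv u) = (word_eval x u)^-1%g.
  elim: u => [|[i b] u IH]; first by rewrite /= invg1.
  rewrite /word_inv /= rev_cons -cats1 word_eval_cat -/(word_inv u) IH /= mulg1.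
  by rewrite invgM; case: b; rewrite /= ?invgK.
have equiv u v : word_equiv rel u v -> word_sum y u = word_sum y v.
  elim=> // [? ? ? _ -> _ -> //|u' v' i b|u' v' i]; last first.
    by rewrite !ws_cat yrel add0r.
  rewrite !ws_cat -cat1s -(cat1s (i, ~~ b)) !ws_cat; congr (_ + _).
  rewrite addrA -[RHS]add0r; congr (_ + _).
  by rewrite /word_sum !big_seq1 /=; case: b; rewrite /= ?addNr ?subrr.
have ws_eq u v : word_eval x u = word_eval x v -> word_sum y u = word_sum y v.
  move=> uv; apply/eqP; rewrite -subr_eq0 -ws_inv -ws_cat; apply/eqP.
  rewrite (equiv _ [::]); first by rewrite /word_sum big_nil.
  by apply/xrel; rewrite word_eval_cat ev_inv uv mulgV.
exists (fun g => word_sum y (wd g)); split=> [g h|w]; last by apply: ws_eq; rewrite wdE.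
by rewrite -ws_cat; apply: ws_eq; rewrite word_eval_cat !wdE.
Qed.

End AdditiveExtension.

(** The kernel of alpha is the commutator subgroup, which f kills; so f g only
    depends on alpha g, and g1 ^ (alpha g) has the same degree as g. *)
Lemma abelianization_factor (G : groupType) (alpha : G -> int) (A : zmodType)
    (f : G -> A) (g1 : G) :
    abelianization alpha -> alpha g1 = 1 ->
    (forall g h, f (g * h)%g = f g + f h) ->
  forall g, f g = f g1 *~ alpha g.
Proof.
case=> [alphaM _ alpha0] a1 fM.
have f1 : f 1%g = 0 by apply: (addrI (f 1%g)); rewrite -fM mulg1 addr0.
have fV g : f g^-1%g = - f g.
  by apply/eqP; rewrite -subr_eq0 opprK -fM mulVg f1.
have fcomm g : commutator_subgroup g -> f g = 0.
  elim=> // [g' h|g' h _ E _ E'|g' _ E]; last by rewrite fV E oppr0.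
    by rewrite !fM !fV addrAC addrK subrr.
  by rewrite fM E E' addr0.
have alpha1 : alpha 1%g = 0 by apply/alpha0; exact: CommOne.
have alphaV g : alpha g^-1%g = - alpha g.
  by apply/eqP; rewrite -subr_eq0 opprK -alphaM mulVg alpha1.
have fX k : f (g1 ^+ k)%g = f g1 *+ k.
  by elim: k => [|k IH]; rewrite ?f1 // expgS fM IH mulrS.
have aX k : alpha (g1 ^+ k)%g = k%:Z.
  by elim: k => [|k IH]; rewrite ?alpha1 // expgS alphaM IH a1 -intS.
move=> g; case E : (alpha g) => [k|k].
  have /alpha0/fcomm : alpha (g * (g1 ^+ k)^-1)%g = 0.
    by rewrite alphaM alphaV aX E subrr.
  by rewrite fM fV fX => /eqP; rewrite subr_eq0 => /eqP ->.
have /alpha0/fcomm : alpha (g * (g1 ^+ k.+1))%g = 0.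
  by rewrite alphaM aX E NegzE addNr.
by rewrite fM fX NegzE => /eqP; rewrite addr_eq0 mulrNz => /eqP ->.
Qed.

(** * Fox matrices and bordered determinants *)

(** Rows and columns are permuted in the same way, so the two signs cancel. *)
Lemma det_reindex (K : comNzRingType) p q (f : 'I_p -> 'I_q) (A : 'M[K]_q) :
  bijective f -> \det (\matrix_(i, j) A (f i) (f j)) = \det A.
Proof.
move=> fbij; have pq : p = q by rewrite -(card_ord p) -(card_ord q) (bij_eq_card fbij).
subst q; pose s := perm (bij_inj fbij).
have -> : \matrix_(i, j) A (f i) (f j) = row_perm s (col_perm s A).
  by apply/matrixP => i j; rewrite !mxE !permE.
rewrite row_permE col_permE !det_mulmx.
rewrite !det_perm odd_permV mulrC -mulrA -signr_addb addbb expr0 mulr1 //.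
Qed.

Lemma mxblock_Rank (T : Type) p q (p_ : 'I_p -> nat) (q_ : 'I_q -> nat)
    (B : forall i j, 'M[T]_(p_ i, q_ j)) i j a b :
  (\mxblock_(i, j) B i j) (tagnat.Rank i a) (tagnat.Rank j b) = B i j a b.
Proof. by have /matrixP/(_ a b) := mxblockK B i j; rewrite mxE. Qed.

Lemma Rank_const_inj m n (i j : 'I_m) (a b : 'I_n) :
  tagnat.Rank (p_ := fun=> n) i a = tagnat.Rank j b -> i = j /\ a = b.
Proof.
move=> /(can_inj tagnat.rankK) E; split; first exact: (congr1 tag E).
by apply: val_inj; exact: (congr1 (fun s => nat_of_ord (tagged s)) E).
Qed.

Lemma sig_const_inj m n (a b : 'I_(\sum_(i < m) n)) :
  tagnat.sig1 a = tagnat.sig1 b ->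
  tagnat.sig2 a = tagnat.sig2 b :> 'I_n -> a = b.
Proof.
move=> E1 E2; rewrite -[a]tagnat.sig2K -[b]tagnat.sig2K.
exact: (f_equal2 (fun (i : 'I_m) (k : 'I_n) => tagnat.Rank (p_ := fun=> n) i k) E1 E2).
Qed.

(** Grouping the first and the second coordinates of every block is a simultaneous
    permutation of rows and columns. *)
Lemma det_mxblock_split (K : comNzRingType) m n1 n2
    (A : 'I_m -> 'I_m -> 'M[K]_n1) (D : 'I_m -> 'I_m -> 'M[K]_n2) :
  \det (\mxblock_(i < m, j < m) block_mx (A i j) 0 0 (D i j)) =
  \det (\mxblock_(i < m, j < m) A i j) * \det (\mxblock_(i < m, j < m) D i j).
Proof.
pose f (s : 'I_(\sum_(i < m) n1 + \sum_(i < m) n2)) : 'I_(\sum_(i < m) (n1 + n2)) :=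
  match fintype.split s with
  | inl a => tagnat.Rank (tagnat.sig1 a) (lshift n2 (tagnat.sig2 a))
  | inr b => tagnat.Rank (tagnat.sig1 b) (rshift n1 (tagnat.sig2 b))
  end.
have fbij : bijective f.
  apply: inj_card_bij; last by rewrite !card_ord big_split.
  move=> s t; rewrite /f.
  case: (split_ordP s) => a ->; case: (split_ordP t) => b -> /Rank_const_inj[E1];
    move=> /(congr1 val) /= E2.
  - by congr lshift; apply: sig_const_inj => //; apply: val_inj.
  - by have := ltn_ord (tagnat.sig2 a); rewrite E2 ltnNge leq_addr.
  - by have := ltn_ord (tagnat.sig2 b); rewrite -E2 ltnNge leq_addr.
  - congr rshift; apply: sig_const_inj => //; apply: val_inj; exact: addnI E2.
rewrite -(det_reindex _ fbij) -[RHS](det_ublock _ 0); congr (\det _).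
apply/matrixP => s t; rewrite mxE /f.
pose B i j := block_mx (A i j) 0 0 (D i j) : 'M[K]_(n1 + n2).
have BE := mxblock_Rank (p_ := fun=> (n1 + n2)%N) (q_ := fun=> (n1 + n2)%N) B.
case: (split_ordP s) => a ->; case: (split_ordP t) => b ->; rewrite BE /B.
- by rewrite !block_mxEul [RHS]mxE.
- by rewrite !block_mxEur !mxE.
- by rewrite !block_mxEdl !mxE.
- by rewrite !block_mxEdr [RHS]mxE.
Qed.

Lemma det_mxblock11 (K : comNzRingType) m (A : 'I_m -> 'I_m -> 'M[K]_1) :
  \det (\mxblock_(i < m, j < m) A i j) = \det (\matrix_(i < m, j < m) A i j 0 0).
Proof.
pose f (i : 'I_m) : 'I_(\sum_(i < m) 1) := tagnat.Rank i 0.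
have fbij : bijective f.
  apply: inj_card_bij; last by rewrite !card_ord sum1_card card_ord.
  by move=> i j /(can_inj tagnat.rankK)/(congr1 tag).
rewrite -(det_reindex _ fbij); congr (\det _).
apply/matrixP => i j; rewrite mxE [RHS]mxE.
exact: (mxblock_Rank (p_ := fun=> 1%N) (q_ := fun=> 1%N)).
Qed.

Lemma det_mxblock_conj (K : comNzRingType) m n (U V : 'M[K]_n)
    (B : 'I_m -> 'I_m -> 'M[K]_n) :
  U *m V = 1%:M ->
  \det (\mxblock_(i < m, j < m) (U *m B i j *m V)) = \det (\mxblock_(i < m, j < m) B i j).
Proof.
move=> UV; rewrite -mul_mxblock_mxdiag -mul_mxdiag_mxblock !det_mulmx mulrAC -det_mulmx.
have -> : (\mxdiag_(i < m) U) *m (\mxdiag_(i < m) V) = 1%:M.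
  rewrite {2}/mxdiag mul_mxdiag_mxblock -(mxdiagZ (p_ := fun=> n) 1).
  apply: eq_mxblock => i j; case: eqP => _; last by rewrite mulmx0.
  by rewrite !conform_mx_id UV.
by rewrite det1 mul1r.
Qed.

Section FoxMatrix.
Variables (K : fieldType) (G : groupType) (n m : nat).
Variables (x : 'I_m.+1 -> G) (rel : 'I_m -> word m.+1) (Phi : G -> 'M[K]_n).
Hypothesis PhiM : forall g h, Phi (g * h)%g = Phi g *m Phi h.
Hypothesis Phi1 : Phi 1%g = 1%:M.
Hypothesis relP : forall i, word_eval x (rel i) = 1%g.

Definition fox_mx (c : seq (int * word m.+1)) : 'M[K]_n :=
  \sum_(p <- c) Phi (word_eval x p.2) *~ p.1.

Definition row_act k (v : 'M[K]_(k, n)) (g : G) := v *m Phi g.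

Lemma row_actD k g : {morph (@row_act k)^~ g : u v / u + v}.
Proof. by move=> u v; exact: mulmxDl. Qed.

Lemma row_actM k (v : 'M[K]_(k, n)) g h :
  row_act v (g * h)%g = row_act (row_act v g) h.
Proof. by rewrite /row_act PhiM mulmxA. Qed.

Lemma row_act1 k (v : 'M[K]_(k, n)) : row_act v 1%g = v.
Proof. by rewrite /row_act Phi1 mulmx1. Qed.

Lemma fox_act_mx k (v : 'M[K]_(k, n)) c :
  fox_act x (@row_act k) v c = v *m fox_mx c.
Proof.
rewrite /fox_act /fox_mx mulmx_sumr; apply: eq_bigr => p _.
by rewrite /row_act -raddfMz.
Qed.

Lemma fox_mx_fundamental w :
  \sum_j fox_mx (fox j w) *m (Phi (x j) - 1%:M) = Phi (word_eval x w) - 1%:M.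
Proof.
have := fox_fundamental x (@row_actD n) (@row_actM n) (@row_act1 n) 1%:M w.
rewrite {1}/row_act mul1mx => ->; apply: eq_bigr => j _.
by rewrite fox_act_mx mul1mx mulmxBr mulmx1.
Qed.

Variable l : 'I_m.+1.

Definition fox_minor : 'M[K]_(\sum_(i < m) n) :=
  \mxblock_(i < m, j < m) fox_mx (fox (lift l j) (rel i)).

(** The square matrix with block rows the Fox derivatives of the relators and of one
    further word w, the columns of the generator l being put last. *)
Definition fox_bordered w : 'M[K]_(\sum_(i < m) n + n) :=
  block_mx fox_minor (\mxcol_(i < m) fox_mx (fox l (rel i)))
           (\mxrow_(j < m) fox_mx (fox (lift l j) w)) (fox_mx (fox l w)).

(** Multiply the bordered matrix by the matrix that replaces the last block column by
    the column of the Phi x_j - 1: the fundamental formula turns that column into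
    zeros, except for Phi w - 1 in the last row. *)
Lemma fox_bordered_det w :
  \det (fox_bordered w) * \det (Phi (x l) - 1%:M) =
  \det fox_minor * \det (Phi (word_eval x w) - 1%:M).
Proof.
pose B := \mxcol_(j < m) (Phi (x (lift l j)) - 1%:M).
have -> : \det (Phi (x l) - 1%:M) = \det (block_mx 1%:M B 0 (Phi (x l) - 1%:M)).
  by rewrite det_ublock det1 mul1r.
rewrite -det_mulmx mulmx_block !mulmx1 !mulmx0 !addr0.
have split_sum w' : \sum_(j < m) fox_mx (fox (lift l j) w') *m (Phi (x (lift l j)) - 1%:M) +
    fox_mx (fox l w') *m (Phi (x l) - 1%:M) = Phi (word_eval x w') - 1%:M.
  by rewrite -fox_mx_fundamental [RHS](bigD1_ord l) //= addrC.
rewrite mul_mxblock_mxrow mul_mxrow_mxcol split_sum mxcol_mul -mxcolD.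
rewrite (_ : mxcol _ = 0) ?det_lblock // -[RHS](mxcol0 (p_ := fun=> n)).
by apply: eq_mxcol => i; rewrite split_sum relP Phi1 subrr.
Qed.

(** A cycle y is a combination of the rows of the invertible bordered matrix. The
    boundary of the relator rows is zero and that of the last row is Phi w - 1, which
    is invertible; so the last row does not occur. *)
Lemma fox_bordered_exact w :
    Phi (word_eval x w) - 1%:M \in unitmx -> \det (fox_bordered w) != 0 ->
  fox_exact x (@row_act 1) rel.
Proof.
move=> wU; rewrite -unitfE -unitmxE => aU y y0.
pose Y : 'rV[K]_(\sum_(i < m) n + n) := row_mx (\mxrow_(j < m) y (lift l j)) (y l).
pose U := Y *m invmx (fox_bordered w).
pose u i := submxrow (lsubmx U) i; pose t := rsubmx U.
have YE : Y = row_mx (\mxrow_i u i) t *m fox_bordered w.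
  by rewrite submxrowK hsubmxK mulmxKV.
have yE j : y j = \sum_i u i *m fox_mx (fox j (rel i)) + t *m fox_mx (fox j w).
  move: YE; rewrite mul_row_block mul_mxrow_mxblock mul_mxrow_mxcol mul_mxrow -mxrowD.
  move=> /eq_row_mx[/eq_mxrowP El Er].
  by have [j' ->|->] := unliftP l j; [exact: El|exact: Er].
have t0 : t *m (Phi (word_eval x w) - 1%:M) = 0.
  rewrite -fox_mx_fundamental mulmx_sumr -[RHS]y0.
  have -> : \sum_j (row_act (y j) (x j) - y j) = \sum_j y j *m (Phi (x j) - 1%:M).
    by apply: eq_bigr => j _; rewrite mulmxBr mulmx1.
  under [RHS]eq_bigr => j _ do rewrite yE mulmxDl mulmx_suml.
  rewrite big_split /= exchange_big [X in X + _]big1 ?add0r => [|i _].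
    by apply: eq_bigr => j _; rewrite mulmxA.
  under eq_bigr do rewrite -mulmxA.
  by rewrite -mulmx_sumr fox_mx_fundamental relP Phi1 subrr mulmx0.
have {}t0 : t = 0 by rewrite -[t](mulmxK wU) t0 mul0mx.
exists u => j; rewrite yE t0 mul0mx addr0.
by apply: eq_bigr => i _; rewrite fox_act_mx.
Qed.

End FoxMatrix.

(** * Paths and classes of loops *)

Section PathLemmas.
Local Open Scope classical_set_scope.
Variables (R : realType) (T : topologicalType).
Implicit Types (X : set T) (f g : R -> T).

Lemma within_continuous_comp (U W : topologicalType) (A : set U) (B : set W)
    (h : W -> U) (f : U -> T) :
  {within A, continuous f} -> continuous h -> (forall w, B w -> A (h w)) ->
  {within B, continuous (fun w => f (h w))}.
Proof.
move=> fc hc hB; apply/subspace_continuousP => w Bw Z fZ.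
move/subspace_continuousP : fc => /(_ _ (hB _ Bw) _ fZ).
rewrite !nbhs_simpl /= => H; have {}H := hc w _ H; rewrite !nbhs_simpl /= in H *.
by apply: (filterS _ H) => v fv Bv; apply: fv; exact: hB.
Qed.

Lemma continuous_pair (U V W : topologicalType) (f : U -> V) (g : U -> W) :
  continuous f -> continuous g -> continuous (fun u => (f u, g u)).
Proof. by move=> fc gc u; have := cvg_pair (fc u) (gc u); apply. Qed.

(** A homotopy has values in X and is continuous on the square, so its end is a path
    even if only its beginning was assumed to be one. *)
Lemma path_in_homotopic X x y f g :
  homotopic X f g -> path_in X x y f -> path_in X x y g.
Proof.
move=> [H [Hc HX Ht Hs]] [fc fX f0 f1].
have in01 (t : R) : 0 <= t <= 1 -> unit_interval t by rewrite /unit_interval /= in_itv.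
have I0 : 0 <= (0 : R) <= 1 by rewrite lexx ler01.
have I1 : 0 <= (1 : R) <= 1 by rewrite lexx ler01.
have H1c : {within @unit_interval R, continuous (fun t : R => H (1, t))}.
  refine (@within_continuous_comp (R * R)%type R _ _ (fun t : R => (1 : R, t)) H Hc _ _).
    by apply: continuous_pair => [t|t]; [exact: cst_continuous|].
  by move=> t t01; split => //; apply: in01.
split.
- apply: (@subspace_eq_continuous _ _ _ (fun t => H (1, t))) => //.
  move=> t /set_mem; rewrite /from_subspace /unit_interval /= in_itv /= => t1.
  by have [_ ->] := Ht _ t1.
- by move=> t t1; have [_ <-] := Ht _ t1; apply: HX; split; apply: in01.
- by have [_ <-] := Ht _ I0; have [-> _] := Hs _ I1.
- by have [_ <-] := Ht _ I1; have [_ ->] := Hs _ I1.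
Qed.

Lemma homotopic_eq X x y f g : path_in X x y f ->
  (forall t, 0 <= t <= 1 -> f t = g t) -> homotopic X f g.
Proof.
move=> fp fg; have [H [Hc HX Ht Hs]] := homotopic_refl fp.
by exists H; split => // t t1; have [-> ->] := Ht _ t1; rewrite fg.
Qed.

End PathLemmas.

Section Pi1Class.
Variables (R : realType) (T : topologicalType) (X : pointed_set T).
Local Notation is_loop := (@path_in R T X (basept X) (basept X)).
Local Notation cls := (@pi1_class R T X).

Lemma pi1_classE f (fl : is_loop f) : cls f = (\pi_(pi1 R X) (Loop fl))%qT.
Proof.
rewrite /pi1_class; case: pselect => [fl'|] //.
by apply/pi1_eqP; exact: homotopic_refl fl'.
Qed.

Lemma pi1_class_homotopic f g : is_loop f -> homotopic X f g -> cls f = cls g.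
Proof.
move=> fl fg; have gl := path_in_homotopic fg fl.
by rewrite (pi1_classE fl) (pi1_classE gl); apply/pi1_eqP.
Qed.

Lemma pi1_class_cat f g : is_loop f -> is_loop g ->
  cls (path_cat f g) = (cls f * cls g)%g.
Proof.
move=> fl gl; rewrite (pi1_classE fl) (pi1_classE gl).
by rewrite (pi1_classE (path_in_cat fl gl)); symmetry; exact: pi1_mulE.
Qed.

Lemma pi1_classK (g : pi1 R X) : cls (repr g) = g.
Proof.
rewrite (pi1_classE (loopP (repr g))) -[RHS]reprK.
by apply/pi1_eqP; exact: homotopic_refl (loopP (repr g)).
Qed.

Lemma homotopic_repr_class f : is_loop f -> homotopic X f (repr (cls f)).
Proof.
by move=> fl; apply/(pi1_eqP (Loop fl)); rewrite reprK (pi1_classE fl).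
Qed.

End Pi1Class.

(** * Chains modulo boundaries with local coefficients *)

Section Homology.
Variables (R : realType) (T : topologicalType) (V : lmodType R[i]).
Variables (X : set T) (x0 : T) (act : V -> (R -> T) -> V).

Local Notation chain := (@chain R T V).
Local Notation ceq := (@chain_eq R T V X x0 act _).
Local Notation valid := (@valid_chain R T V X x0 _).
Local Notation homologous := (@homologous1 R T V X x0 act).

Definition chain_opp n (c : chain n) : chain n := [seq (- p.1, p.2) | p <- c].

Lemma chain_addC n (c d e : chain n) : ceq (c ++ (d ++ e)) (d ++ (c ++ e)).
Proof. by rewrite !catA; apply: ChainCat (ChainRefl _ _ _ _); exact: ChainComm. Qed.

Lemma chain_addN n (c : chain n) : ceq (c ++ chain_opp c) [::].
Proof.
elim: c => [|[v s] c IH]; first exact: ChainRefl.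
rewrite /= -cat1s; apply: ChainTrans (_ : ceq _ ([:: (v, s); (- v, s)] ++ (c ++ chain_opp c))) _.
  by rewrite -[_ :: chain_opp c]cat1s -[in X in ceq _ X]cat1s -catA;
    apply: ChainCat (ChainRefl _ _ _ _) (chain_addC _ _ _).
rewrite -[X in ceq _ X]cats0; apply: ChainCat IH.
apply: ChainTrans (ChainSym (ChainAdd _ _ _ v (- v) s)) _.
by rewrite subrr; exact: ChainZero.
Qed.

Lemma chain_boundary_cat n (b c : chain n.+1) :
  chain_boundary (b ++ c) = chain_boundary b ++ chain_boundary c.
Proof. by rewrite /chain_boundary map_cat flatten_cat. Qed.

Lemma chain_boundary_opp n (b : chain n.+1) :
  chain_boundary (chain_opp b) = chain_opp (chain_boundary b).
Proof.
rewrite /chain_boundary /chain_opp map_flatten -!map_comp; congr flatten.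
apply: eq_map => p /=; rewrite -map_comp; apply: eq_map => i /=.
by rewrite scalerN.
Qed.

Lemma valid_chain_cat n (b c : chain n) : valid b -> valid c -> valid (b ++ c).
Proof. by move=> vb vc p; rewrite mem_cat => /orP[]; [exact: vb|exact: vc]. Qed.

Lemma valid_chain_opp n (b : chain n) : valid b -> valid (chain_opp b).
Proof. by move=> vb p /mapP[p' /vb ? ->]. Qed.

Lemma chain_eq_homologous (c d : chain 1) : ceq c d -> homologous c d.
Proof. by move=> cd; exists [::]; rewrite ?cats0. Qed.

Lemma homologous_refl (c : chain 1) : homologous c c.
Proof. exact/chain_eq_homologous/ChainRefl. Qed.

Lemma homologous_sym (c d : chain 1) : homologous c d -> homologous d c.
Proof.
case=> b vb cd; exists (chain_opp b); first exact: valid_chain_opp.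
rewrite chain_boundary_opp; apply: ChainSym.
apply: ChainTrans (ChainCat cd (ChainRefl _ _ _ _)) _.
rewrite -catA -[X in ceq _ X]cats0.
by apply: ChainCat (ChainRefl _ _ _ _) (chain_addN _).
Qed.

Lemma homologous_trans (c d e : chain 1) :
  homologous c d -> homologous d e -> homologous c e.
Proof.
case=> b vb cd [b' vb' de]; exists (b' ++ b); first exact: valid_chain_cat.
rewrite chain_boundary_cat catA; apply: ChainTrans cd _.
exact: ChainCat de (ChainRefl _ _ _ _).
Qed.

Lemma homologous_cat (c c' d d' : chain 1) :
  homologous c c' -> homologous d d' -> homologous (c ++ d) (c' ++ d').
Proof.
case=> b vb cc' [b' vb' dd']; exists (b ++ b'); first exact: valid_chain_cat.
apply: ChainTrans (ChainCat cc' dd') _; rewrite chain_boundary_cat -!catA.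
exact: ChainCat (ChainRefl _ _ _ _) (chain_addC _ _ _).
Qed.

Lemma chain_opp_eq n (c d : chain n) : ceq c d -> ceq (chain_opp c) (chain_opp d).
Proof.
move=> cd; rewrite -[X in ceq X _]cats0.
apply: ChainTrans (ChainCat (ChainRefl _ _ _ _) (ChainSym (chain_addN d))) _.
apply: ChainTrans (ChainCat (ChainRefl _ _ _ _) (ChainCat (ChainSym cd) (ChainRefl _ _ _ _))) _.
rewrite catA -[X in ceq _ X]cat0s; apply: ChainCat (ChainRefl _ _ _ _).
exact: ChainTrans (ChainComm _ _ _ _ _) (chain_addN c).
Qed.

Lemma homologous_opp (c d : chain 1) :
  homologous c d -> homologous (chain_opp c) (chain_opp d).
Proof.
case=> b vb cd; exists (chain_opp b); first exact: valid_chain_opp.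
by rewrite chain_boundary_opp /chain_opp -map_cat; exact: chain_opp_eq.
Qed.

Definition homologousb : rel (chain 1) := fun c d => `[< homologous c d >].

Let homologousb_refl : reflexive homologousb.
Proof. by move=> c; apply/asboolP; exact: homologous_refl. Qed.

Let homologousb_sym : symmetric homologousb.
Proof. by move=> c d; apply/asboolP/asboolP; exact: homologous_sym. Qed.

Let homologousb_trans : transitive homologousb.
Proof.
by move=> d c e /asboolP cd /asboolP de; apply/asboolP; exact: homologous_trans de.
Qed.

Canonical homologous_equiv :=
  EquivRel homologousb homologousb_refl homologousb_sym homologousb_trans.

(** All 1-chains, not only cycles, are divided by boundaries, since the
    computations below split cycles into edges that are not closed. *)
Definition chains_mod_boundaries := {eq_quot homologous_equiv}%qT.
Local Notation Q := chains_mod_boundaries.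
HB.instance Definition _ := Choice.on Q.

Definition chain_class (c : chain 1) : Q := (\pi_Q c)%qT.

Lemma chain_classP c d : chain_class c = chain_class d <-> homologous c d.
Proof.
split=> [/eqmodP/asboolP //|cd]; exact/eqmodP/asboolP.
Qed.

Let repr_homologous c : homologous (repr (chain_class c)) c.
Proof. by apply/chain_classP; rewrite /chain_class reprK. Qed.

Let Q0 : Q := chain_class [::].
Let Qadd (a b : Q) : Q := chain_class (repr a ++ repr b).
Let Qopp (a : Q) : Q := chain_class (chain_opp (repr a)).

Let QaddE c d : Qadd (chain_class c) (chain_class d) = chain_class (c ++ d).
Proof. by apply/chain_classP/homologous_cat; exact: repr_homologous. Qed.

Let QoppE c : Qopp (chain_class c) = chain_class (chain_opp c).
Proof. by apply/chain_classP/homologous_opp; exact: repr_homologous. Qed.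

Let QaddA : associative Qadd.
Proof.
by elim/quotW=> c; elim/quotW=> d; elim/quotW=> e; rewrite -!/(chain_class _) !QaddE catA.
Qed.

Let QaddC : commutative Qadd.
Proof.
elim/quotW=> c; elim/quotW=> d; rewrite -!/(chain_class _) !QaddE.
exact/chain_classP/chain_eq_homologous/ChainComm.
Qed.

Let Qadd0 : left_id Q0 Qadd.
Proof. by elim/quotW=> c; rewrite -!/(chain_class _) QaddE. Qed.

Let QaddN : left_inverse Q0 Qopp Qadd.
Proof.
elim/quotW=> c; rewrite -!/(chain_class _) QaddC QoppE QaddE.
exact/chain_classP/chain_eq_homologous/chain_addN.
Qed.

HB.instance Definition _ := GRing.isZmodule.Build Q QaddA QaddC Qadd0 QaddN.

Lemma chain_class_cat c d : chain_class (c ++ d) = chain_class c + chain_class d.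
Proof. by rewrite -[RHS]/(Qadd _ _) QaddE. Qed.

Definition simplex_class (v : V) (s : lifted_simplex R T 1) : Q :=
  chain_class [:: (v, s)].

Lemma chain_class_sum c : chain_class c = \sum_(p <- c) simplex_class p.1 p.2.
Proof.
elim: c => [|[v s] c IH]; first by rewrite big_nil.
by rewrite big_cons -IH -cat1s chain_class_cat.
Qed.

Lemma simplex_classD s : {morph simplex_class^~ s : v w / v + w}.
Proof.
move=> v w; rewrite /simplex_class -chain_class_cat.
exact/chain_classP/chain_eq_homologous/ChainAdd.
Qed.

Lemma simplex_class_lift v f f' (sigma sigma' : 'rV[R]_2 -> T) :
  homotopic X f f' ->
  (forall x, std_simplex (n := 1) x -> sigma x = sigma' x) ->
  simplex_class v (f, sigma) = simplex_class v (f', sigma').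
Proof.
move=> ff' ss'; apply/chain_classP/chain_eq_homologous/ChainLift => // x /set_mem.
exact: ss'.
Qed.

Lemma simplex_class_deck v g f sigma :
  path_in X x0 x0 g -> path_in X x0 (f 1) f ->
  simplex_class v (path_cat g f, sigma) = simplex_class (act v g) (f, sigma).
Proof. by move=> gl fp; exact/chain_classP/chain_eq_homologous/ChainDeck. Qed.

Lemma chain_class_boundary b : valid b -> chain_class (chain_boundary b) = 0.
Proof. by move=> vb; apply/chain_classP; exists b => //; exact: ChainRefl. Qed.

End Homology.

(** * Triangles in a space *)

Section Triangles.
Variables (R : realType) (T : topologicalType).
Local Open Scope classical_set_scope.

(** The 1-simplex that runs through a path; its parameter is the second barycentric
    coordinate. *)
Definition edge_simplex (a : R -> T) : 'rV[R]_2 -> T := fun x => a (x 0 ord_max).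
Definition bary2 (t : R) : 'rV[R]_2 :=
  (1 - t) *: vertex R ord0 + t *: vertex R (lift ord0 ord0).

Lemma bary2E t : bary2 t = \row_i [:: 1 - t; t]`_i.
Proof.
by apply/rowP => -[[|[|]]] //= i; rewrite !mxE /= ?mulr1 ?mulr0 ?addr0 ?add0r.
Qed.

Lemma std_simplex1P (x : 'rV[R]_2) : std_simplex (n := 1) x ->
  0 <= x 0 ord_max <= 1 /\ x = bary2 (x 0 ord_max).
Proof.
case=> x0; rewrite big_ord_recl big_ord1 => x1.
have E : x 0 ord0 = 1 - x 0 ord_max.
  by rewrite -x1 (_ : lift _ _ = ord_max) ?addrK //; exact: val_inj.
split; first by rewrite x0 -subr_ge0 -E x0.
apply/rowP => i; rewrite bary2E mxE; case: i => -[|[|]] //= i.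
  by rewrite -E; congr (x 0 _); exact: val_inj.
by congr (x 0 _); exact: val_inj.
Qed.

Lemma std_simplex_bary2 t : 0 <= t <= 1 -> std_simplex (n := 1) (bary2 t).
Proof.
move=> /andP[t0 t1]; rewrite bary2E; split=> [[[|[|]] //= i]|].
- by rewrite !mxE subr_ge0.
- by rewrite !mxE.
- by rewrite big_ord_recl big_ord1 !mxE /= subrK.
Qed.

Lemma face_map_vertex n (i : 'I_n.+2) (j : 'I_n.+1) :
  face_map i (vertex R j) = vertex R (lift i j).
Proof.
apply/rowP => k; rewrite !mxE; case: unliftP => [k' ->|->].
  by rewrite mxE (inj_eq lift_inj).
by rewrite (negbTE (neq_lift _ _)).
Qed.

Lemma face_map_bary2 (i : 'I_3) t : face_map i (bary2 t) =
  (1 - t) *: vertex R (lift i ord0) + t *: vertex R (lift i (lift ord0 ord0)).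
Proof.
rewrite -!(face_map_vertex i); apply/rowP => k; rewrite !mxE.
by case: unliftP => [k' _|_]; rewrite ?mulr0 ?addr0 // !mxE.
Qed.

Lemma coordinate_continuous n (i : 'I_n.+1) : continuous (fun x : 'rV[R]_n.+1 => x 0 i).
Proof. by move=> x; exact: coord_continuous. Qed.

End Triangles.

(** * A Hurewicz argument with local coefficients *)

Section Hurewicz.
Variables (R : realType) (T : topologicalType) (V : lmodType R[i]).
Variables (X : pointed_set T) (actg : V -> pi1 R X -> V).
Hypothesis actD : forall g, {morph actg^~ g : u v / u + v}.
Hypothesis actM : forall v g h, actg v (g * h)%g = actg (actg v g) h.
Hypothesis act1 : forall v, actg v 1%g = v.

Local Notation x0 := (basept X).
Local Notation cls := (@pi1_class R T X).
Local Notation act := (fun v (f : R -> T) => actg v (cls f)).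
Local Notation chain := (@chain R T V).
Local Notation ceq := (@chain_eq R T V X x0 act _).
Local Notation Q := (chains_mod_boundaries X x0 act).
Local Notation sc := (simplex_class X x0 act).
Local Notation Xs := (carrier X).
Local Notation cst0 := (cst x0 : R -> T).
Local Open Scope classical_set_scope.

(** The edge that runs through the path a, lifted to start at the point of the
    universal cover given by f. *)
Definition edge_class (v : V) (f a : R -> T) : Q := sc v (f, edge_simplex a).

Lemma boundary2_class v s : chain_class X x0 act (chain_boundary [:: (v, s)]) =
  sc v (lifted_face ord0 s) - sc v (lifted_face (lift ord0 ord0) s) +
  sc v (lifted_face ord_max s).
Proof.
rewrite chain_class_sum /chain_boundary /= cats0 big_map big_enum /=.
rewrite !big_ord_recl big_ord0 /= expr0 scale1r addr0 addrA; congr (_ + _ + _).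
  rewrite expr1 scaleN1r; apply/eqP; rewrite -subr_eq0 opprK -simplex_classD addNr.
  by apply/eqP; apply: (addrI (sc 0 (lifted_face (lift ord0 ord0) s))); rewrite -simplex_classD !addr0.
by rewrite sqrrN expr1n scale1r; congr (sc v (lifted_face _ s)); exact: val_inj.
Qed.

(** The boundary of the singular triangle tau, whose sides 01, 12 and 02 run
    through a, b and c. *)
Lemma triangle v f x y a b c (tau : 'rV[R]_3 -> T) :
    path_in X x0 x f -> path_in X x y a ->
    {within @std_simplex R 2, continuous tau} ->
    (forall p, std_simplex (n := 2) p -> Xs (tau p)) ->
    (forall t, 0 <= t <= 1 -> tau (face_map ord_max (bary2 t)) = a t) ->
    (forall t, 0 <= t <= 1 -> tau (face_map ord0 (bary2 t)) = b t) ->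
    (forall t, 0 <= t <= 1 -> tau (face_map (lift ord0 ord0) (bary2 t)) = c t) ->
  edge_class v f c = edge_class v f a + edge_class v (path_cat f a) b.
Proof.
move=> fp ap tauc tauX ea eb ec.
have I0 : 0 <= (0 : R) <= 1 by rewrite lexx ler01.
have fm : face_map ord_max (bary2 0) = vertex R (ord0 : 'I_3).
  rewrite face_map_bary2 subr0 scale1r scale0r addr0; congr (vertex R _).
  exact: val_inj.
have tau0 : tau (vertex R ord0) = x by rewrite -fm ea //; case: ap.
have vs : is_lifted_simplex X x0 (n := 2) (f, tau) by split; rewrite //= tau0.
have /chain_class_boundary : valid_chain X x0 [:: (v, (f, tau) : lifted_simplex R T 2)].
  by move=> p; rewrite inE => /eqP ->.
move=> /(_ act); rewrite boundary2_class.
move=> /eqP; rewrite addrAC subr_eq0 eq_sym => /eqP E.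
have face g h i : homotopic X g g ->
    (forall t, 0 <= t <= 1 -> tau (face_map i (bary2 t)) = h t) ->
  sc v (g, tau \o face_map i) = edge_class v g h.
  move=> gg hE; apply: simplex_class_lift => // p /std_simplex1P[p1 ->].
  by rewrite /= hE // /edge_simplex bary2E mxE.
have ff := homotopic_refl fp.
have <- : sc v (lifted_face (lift ord0 ord0) (f, tau)) = edge_class v f c.
  exact: face ec.
rewrite E addrC; congr (_ + _); first exact: face ea.
rewrite /edge_class /lifted_face eqxx; apply: simplex_class_lift => [|p].
  apply: homotopic_sym; apply: (homotopic_cat fp ap ff).
  apply: homotopic_eq ap _ => t t1 /=; rewrite -ea // face_map_bary2.
  by congr (tau (_ *: vertex R _ + _ *: vertex R _)); exact: val_inj.
by move=> /std_simplex1P[p1 ->]; rewrite /= eb // /edge_simplex bary2E mxE.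
Qed.

(** The triangle is the composite of path_cat a b with the affine map that sends the
    vertices to 0, 1/2 and 1. *)
Lemma edge_class_cat v f x y z a b :
    path_in X x0 x f -> path_in X x y a -> path_in X y z b ->
  edge_class v f (path_cat a b) =
  edge_class v f a + edge_class v (path_cat f a) b.
Proof.
move=> fp ap bp; have [cc cX _ _] := path_in_cat ap bp.
pose h (p : 'rV[R]_3) : R := p 0 (lift ord0 ord0) / 2 + p 0 ord_max.
have hc : continuous h.
  move=> p; apply: (continuousD (f := fun p : 'rV[R]_3 => p 0 (lift ord0 ord0) / 2)).
    by apply: continuousM; [exact: coordinate_continuous|exact: cst_continuous].
  exact: coordinate_continuous.
have h01 p : std_simplex (n := 2) p -> 0 <= h p <= 1.
  case=> p0; rewrite !big_ord_recl big_ord0 addr0 (_ : lift ord0 (lift ord0 ord0) = ord_max).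
    have := p0 ord0; have := p0 (lift ord0 ord0); have := p0 ord_max; rewrite /h.
    by move: (p 0 ord0) (p 0 (lift ord0 ord0)) (p 0 ord_max) => r s t *; lra.
  exact: val_inj.
apply: (triangle (tau := fun p => path_cat a b (h p)) v fp ap).
- apply: within_continuous_comp cc hc _ => p /h01.
  by rewrite /unit_interval /= in_itv.
- by move=> p /h01; exact: cX.
- move=> t /andP[t0 t1]; rewrite /h face_map_bary2 !mxE /= /path_cat.
  rewrite ifT; last by lra.
  by congr a; lra.
- move=> t /andP[t0 t1]; rewrite /h face_map_bary2 !mxE /= /path_cat.
  case: ifPn => t2; last by congr b; lra.
  have -> : t = 0 by lra.
  case: ap => _ _ _ a1; case: bp => _ _ -> _; rewrite -a1; congr a; lra.
- by move=> t /andP[t0 t1]; rewrite /h face_map_bary2 !mxE /=; congr path_cat; lra.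
Qed.

(** A constant path equals its own double, so its class is twice itself. *)
Lemma edge_class_cst v f x : path_in X x0 x f -> edge_class v f (cst x) = 0.
Proof.
move=> fp; have Xx : Xs x by case: fp => _ fX _ <-; apply: fX; rewrite ler01 lexx.
have cp := path_in_cst R Xx.
have := edge_class_cat v fp cp cp.
rewrite (_ : path_cat (cst x) (cst x) = cst x); last first.
  by apply/funext => t; rewrite /path_cat if_same.
have -> : edge_class v (path_cat f (cst x)) (cst x) = edge_class v f (cst x).
  by apply: simplex_class_lift => //; exact: path_catp1 fp.
by move=> E; apply: (addrI (edge_class v f (cst x))); rewrite -E addr0.
Qed.

Lemma edge_class_lift v f f' a : homotopic X f f' ->
  edge_class v f a = edge_class v f' a.
Proof. by move=> ff'; exact: simplex_class_lift. Qed.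

(** The diagonal cuts the square of the homotopy into two triangles, each with one
    constant side. *)
Lemma edge_class_homotopic v f x y a a' :
    path_in X x0 x f -> path_in X x y a -> homotopic X a a' ->
  edge_class v f a = edge_class v f a'.
Proof.
move=> fp ap aa'; have a'p := path_in_homotopic aa' ap.
have [H [Hc HX Ht Hs]] := aa'; have [_ aX a0 a1] := ap; have [_ _ a0' a1'] := a'p.
have I0 : 0 <= (0 : R) <= 1 by rewrite lexx ler01.
have I1 : 0 <= (1 : R) <= 1 by rewrite lexx ler01.
have Xx : Xs x by rewrite -a0; exact: aX.
have Xy : Xs y by rewrite -a1; exact: aX.
pose d t := H (t, t).
have coords p : std_simplex (n := 2) p ->
    0 <= p 0 ord_max <= 1 /\ 0 <= p 0 (lift ord0 ord0) + p 0 ord_max <= 1.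
  case=> p0; rewrite !big_ord_recl big_ord0 addr0 (_ : lift ord0 (lift ord0 ord0) = ord_max).
    have := p0 ord0; have := p0 (lift ord0 ord0); have := p0 ord_max.
    by move: (p 0 ord0) (p 0 (lift ord0 ord0)) (p 0 ord_max) => r s t *; split; lra.
  exact: val_inj.
have sumc : continuous (fun p : 'rV[R]_3 => p 0 (lift ord0 ord0) + p 0 ord_max).
  move=> p; apply: (continuousD (f := fun p : 'rV[R]_3 => p 0 (lift ord0 ord0)));
  exact: coordinate_continuous.
have sq (s t : R) : 0 <= s <= 1 -> 0 <= t <= 1 -> unit_square (s, t).
  by move=> s1 t1; split; rewrite /unit_interval /= in_itv.
transitivity (edge_class v f d).
  rewrite -[LHS]addr0.
  have fap := path_in_cat fp ap.
  rewrite -(edge_class_cst v fap).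
  symmetry; apply: (triangle
    (tau := fun p => H (p 0 ord_max, p 0 (lift ord0 ord0) + p 0 ord_max)) v fp ap).
  - apply: (within_continuous_comp
      (h := fun p : 'rV[R]_3 => (p 0 ord_max, p 0 (lift ord0 ord0) + p 0 ord_max)) Hc).
      by apply: continuous_pair sumc; exact: coordinate_continuous.
    by move=> p /coords[p1 p2]; exact: sq.
  - by move=> p /coords[p1 p2]; apply: HX; exact: sq.
  - move=> t t1; rewrite face_map_bary2 !mxE /= !mulr0 !mulr1 !addr0 add0r.
    by have [-> _] := Ht _ t1.
  - move=> t t1; rewrite face_map_bary2 !mxE /= !mulr0 !mulr1 !addr0 !add0r subrK.
    by have [_ ->] := Hs _ t1.
  - by move=> t t1; rewrite face_map_bary2 !mxE /= !mulr0 !mulr1 !addr0 !add0r.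
have cp := path_in_cst R Xx.
have -> : edge_class v f a' = edge_class v f (cst x) + edge_class v (path_cat f (cst x)) a'.
  by rewrite edge_class_cst // add0r; apply/edge_class_lift/homotopic_sym/path_catp1/fp.
apply: (triangle
    (tau := fun p => H (p 0 (lift ord0 ord0) + p 0 ord_max, p 0 ord_max)) v fp cp).
- apply: (within_continuous_comp
    (h := fun p : 'rV[R]_3 => (p 0 (lift ord0 ord0) + p 0 ord_max, p 0 ord_max)) Hc).
    by apply: (continuous_pair sumc); exact: coordinate_continuous.
  by move=> p /coords[p1 p2]; exact: sq.
- by move=> p /coords[p1 p2]; apply: HX; exact: sq.
- move=> t t1; rewrite face_map_bary2 !mxE /= !mulr0 !mulr1 !addr0 add0r.
  by have [-> _] := Hs _ t1.
- move=> t t1; rewrite face_map_bary2 !mxE /= !mulr0 !mulr1 !addr0 !add0r subrK.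
  by have [_ ->] := Ht _ t1.
- by move=> t t1; rewrite face_map_bary2 !mxE /= !mulr0 !mulr1 !addr0 !add0r.
Qed.

Let cst0p : path_in X x0 x0 cst0 := path_in_cst R (@basept_in _ X).

(** The edge from the base point of the universal cover to the point given by f. It
    plays the role of a cone operator. *)
Definition cone v f : Q := edge_class v cst0 f.

Lemma coneD f : {morph cone^~ f : u v / u + v}.
Proof. exact: simplex_classD. Qed.

Lemma cone_homotopic v f x f' :
  path_in X x0 x f -> homotopic X f f' -> cone v f = cone v f'.
Proof. by move=> fp; exact: edge_class_homotopic cst0p fp. Qed.

Lemma cone_cat v f x y a : path_in X x0 x f -> path_in X x y a ->
  cone v (path_cat f a) = cone v f + edge_class v f a.
Proof.
move=> fp ap; rewrite /cone (edge_class_cat v cst0p fp ap); congr (_ + _).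
by apply: edge_class_lift; exact: path_cat1p fp.
Qed.

(** Translating by the deck transformation of g moves g to the coefficient. *)
Lemma cone_deck v g x f : path_in X x0 x0 g -> path_in X x0 x f ->
  cone v (path_cat g f) = cone v g + cone (actg v (cls g)) f.
Proof.
move=> gl fp; rewrite (cone_cat v gl fp); congr (_ + _).
rewrite (edge_class_lift _ _ (homotopic_sym (path_catp1 gl))).
exact: simplex_class_deck.
Qed.

(** The class of v (x) [g]; by [loop_classM] it is a crossed map. *)
Definition loop_class v (g : pi1 R X) : Q := cone v (repr g).

Lemma cone_loop v f : path_in X x0 x0 f -> cone v f = loop_class v (cls f).
Proof. by move=> fl; apply: (cone_homotopic _ fl); exact: homotopic_repr_class. Qed.

Lemma loop_classD g : {morph loop_class^~ g : u v / u + v}.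
Proof. exact: coneD. Qed.

Lemma loop_classM v g h :
  loop_class v (g * h)%g = loop_class v g + loop_class (actg v g) h.
Proof.
have [gl hl] := (loopP (repr g), loopP (repr h)).
have := cone_deck v gl hl; rewrite (cone_loop v (path_in_cat gl hl)).
by rewrite (pi1_class_cat gl hl) !pi1_classK.
Qed.

(** A chosen path to every point; it identifies the fibre of the universal cover over
    p with the group. *)
Definition ref_path (p : T) : R -> T := xget cst0 (@path_in R T X x0 p).

Lemma ref_pathP p (f : R -> T) : path_in X x0 p f -> path_in X x0 p (ref_path p).
Proof. by move=> fp; apply: (xgetPex cst0 (P := @path_in R T X x0 p)); exists f. Qed.

Local Notation vtx s := (s.2 (vertex R ord0)).

Definition lift_elt (s : lifted_simplex R T 0) : pi1 R X :=
  cls (path_cat s.1 (path_rev (ref_path (vtx s)))).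

(** The 0-chain is carried to the chosen lifts before F is applied. This makes the sum
    depend only on the class of the chain. The test discards simplices that are not
    lifted, which may occur in the intermediate chains of [chain_eq]. *)
Definition chain0_sum (A : zmodType) (F : V -> T -> A) (c : chain 0) : A :=
  \sum_(p <- c) if `[< path_in X x0 (vtx p.2) p.2.1 >]
                then F (actg p.1 (lift_elt p.2)) (vtx p.2) else 0.

Lemma lift_elt_loop (s : lifted_simplex R T 0) : path_in X x0 (vtx s) s.1 ->
  path_in X x0 x0 (path_cat s.1 (path_rev (ref_path (vtx s)))).
Proof. by move=> sp; exact: path_in_cat sp (path_in_rev (ref_pathP sp)). Qed.

Lemma vertex_std : std_simplex (vertex R (ord0 : 'I_1)).
Proof.
split=> [i|]; first by rewrite mxE ler0n.
by rewrite big_ord1 mxE.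
Qed.

Lemma chain0_sum_eq (A : zmodType) (F : V -> T -> A) c d :
  (forall p, {morph F^~ p : u v / u + v}) ->
  ceq c d -> chain0_sum F c = chain0_sum F d.
Proof.
move=> FD.
have F0 p : F 0 p = 0 by apply: (addrI (F 0 p)); rewrite -FD !addr0.
have a0 g : actg 0 g = 0 by apply: (addrI (actg 0 g)); rewrite -actD !addr0.
have cat (b b' : chain 0) : chain0_sum F (b ++ b') = chain0_sum F b + chain0_sum F b'.
  by rewrite /chain0_sum big_cat.
elim=> {c d} [//|c d _ -> //|c d e _ -> _ -> //|c c' d d' _ E _ E'|c d|s|v w s|v f f' s s' ff' ss'|v g f s gl fp].
- by rewrite !cat E E'.
- by rewrite !cat addrC.
- by rewrite /chain0_sum big_seq1 big_nil a0 F0 if_same.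
- rewrite /chain0_sum big_seq1 big_cons big_seq1 /=.
  by case: ifP; rewrite ?addr0 // actD FD.
- rewrite /chain0_sum !big_seq1 /= -(ss' _ (mem_set vertex_std)).
  set p := s _.
  have -> : `[< path_in X x0 p f >] = `[< path_in X x0 p f' >].
    by apply/asboolP/asboolP; apply: path_in_homotopic => //; exact: homotopic_sym.
  case: asboolP => // f'p; congr (F (actg _ _) _).
  have fp := path_in_homotopic (homotopic_sym ff') f'p.
  rewrite /lift_elt /= -(ss' _ (mem_set vertex_std)) -/p.
  apply: pi1_class_homotopic; first exact: path_in_cat fp (path_in_rev (ref_pathP fp)).
  have rp := path_in_rev (ref_pathP fp).
  exact: homotopic_cat fp rp ff' (homotopic_refl rp).
- rewrite /chain0_sum !big_seq1 /=; set p := s _.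
  have end_cat : path_cat g f 1 = f 1.
    rewrite /path_cat ifF; first by congr f; lra.
    by apply/negbTE; rewrite -ltNge; lra.
  have -> : `[< path_in X x0 p (path_cat g f) >] = `[< path_in X x0 p f >].
    apply/asboolP/asboolP => [[_ _ _ E]|pf]; last exact: path_in_cat gl pf.
    by rewrite -E end_cat.
  case: asboolP => // pf; congr (F _ _); rewrite /lift_elt /= -/p -actM; congr actg.
  have rp := path_in_rev (ref_pathP pf).
  rewrite -(pi1_class_cat gl (path_in_cat pf rp)).
  symmetry; apply: pi1_class_homotopic; first exact: path_in_cat gl (path_in_cat pf rp).
  exact: path_catA gl pf rp.
Qed.

Lemma edge_path (s : lifted_simplex R T 1) : is_lifted_simplex X x0 s ->
  path_in X (s.2 (vertex R ord0)) (s.2 (vertex R (lift ord0 ord0)))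
    (fun t => s.2 (bary2 t)).
Proof.
case: s => f sigma [/= sc' sX fp].
split=> [||/=|/=].
  - apply: within_continuous_comp sc' _ _.
      move=> t; apply: (continuousD (f := fun t : R => (1 - t) *: vertex R (ord0 : 'I_2))).
        apply: continuousZl; apply: continuousB => //; exact: cst_continuous.
      exact: continuousZl.
    by move=> t; rewrite /unit_interval /= in_itv /= => t1; exact: std_simplex_bary2.
  - by move=> t t1; apply: sX; exact: std_simplex_bary2.
  - by rewrite /bary2 subr0 scale1r scale0r addr0.
  - by rewrite /bary2 subrr scale0r scale1r add0r.
Qed.

(** By [cone_cat], an edge from f to f.a is the difference of the cones over its two
    ends. *)
Lemma simplex_class_cone v s : is_lifted_simplex X x0 (n := 1) s ->
  sc v s = \sum_(p <- chain_boundary [:: (v, s)]) cone p.1 p.2.1.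
Proof.
move=> sv; have ap := edge_path sv; case: s sv ap => f sigma [/= sc' sX fp] ap.
rewrite /chain_boundary /= cats0 big_map big_enum /= !big_ord_recl big_ord0 /=.
rewrite expr0 scale1r addr0 expr1 scaleN1r.
have coneN u h : cone (- u) h = - cone u h.
  by apply/eqP; rewrite -subr_eq0 opprK -coneD addNr;
     apply/eqP; apply: (addrI (cone 0 h)); rewrite -coneD !addr0.
rewrite coneN (cone_cat v fp ap) addrAC subrr add0r.
apply: simplex_class_lift; first exact: homotopic_refl fp.
by move=> p /std_simplex1P[_ {1}->].
Qed.

Lemma boundary_path (v : V) s : is_lifted_simplex X x0 (n := 1) s ->
  forall p, p \in chain_boundary [:: (v, s)] -> path_in X x0 (vtx p.2) p.2.1.
Proof.
move=> sv p; have ap := edge_path sv; case: sv => _ _ fp.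
rewrite /chain_boundary /= cats0 => /mapP[i _ ->] /=.
rewrite face_map_vertex; case: eqP => [->|/eqP i0] /=; first exact: path_in_cat fp ap.
by rewrite (_ : lift i ord0 = ord0) //; apply: val_inj; case: i i0 => -[].
Qed.

(** The first homology of the group with coefficients in V vanishes, in the form given
    by [crossed_vanish]. *)
Hypothesis group_exact : forall (Q : zmodType) (L : V -> pi1 R X -> Q),
  (forall g, {morph L^~ g : u v / u + v}) ->
  (forall v g h, L v (g * h)%g = L v g + L (actg v g) h) ->
  forall s : seq (V * pi1 R X), \sum_(p <- s) (actg p.1 p.2 - p.1) = 0 ->
  \sum_(p <- s) L p.1 p.2 = 0.

(** The class of a chain is the sum of the cones over its boundary. Passing through the
    chosen path to its end point, each cone becomes a loop followed by a cone that
    only depends on this point; as the boundary is zero, the latter cancel and the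
    loops form a cycle of the group. *)
Lemma cycle_null c : cycle1 X x0 act c -> homologous1 X x0 act c [::].
Proof.
case=> vc bc; apply/chain_classP; rewrite -[RHS]/(0 : Q).
have bE (d : chain 1) : chain_boundary d =
    flatten [seq chain_boundary [:: p] | p <- d].
  by rewrite /chain_boundary; congr flatten; apply: eq_map => p /=; rewrite cats0.
have bpath p : p \in chain_boundary c -> path_in X x0 (vtx p.2) p.2.1.
  rewrite bE => /flatten_mapP[[v s] /vc sv]; exact: boundary_path sv _.
have b0 : \sum_(p <- chain_boundary c) p.1 = 0.
  rewrite bE big_flatten big_map big1 // => p _.
  rewrite /chain_boundary /= cats0 big_map big_enum /= !big_ord_recl big_ord0 /=.
  by rewrite expr0 scale1r addr0 expr1 scaleN1r subrr.
(* The boundary is equal to the empty chain, so sums carried to the chosen lifts vanish. *)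
have sumE (A : zmodType) (F : V -> T -> A) : (forall p, {morph F^~ p : u v / u + v}) ->
    \sum_(p <- chain_boundary c) F (actg p.1 (lift_elt p.2)) (vtx p.2) = 0.
  move=> FD; have := chain0_sum_eq FD bc; rewrite {2}/chain0_sum big_nil => b0'.
  rewrite -[RHS]b0'.
  rewrite /chain0_sum big_seq [RHS]big_seq; apply: eq_bigr => p /bpath pp.
  by rewrite asboolT.
have -> : chain_class X x0 act c = \sum_(p <- chain_boundary c) cone p.1 p.2.1.
  rewrite bE big_flatten big_map chain_class_sum big_seq [RHS]big_seq.
  by apply: eq_bigr => -[v s] /vc sv; exact: simplex_class_cone.
pose s := [seq (p.1, lift_elt p.2) | p <- chain_boundary c].
have /(group_exact loop_classD loop_classM) : \sum_(p <- s) (actg p.1 p.2 - p.1) = 0.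
  by rewrite big_map sumrB b0 subr0; exact: (sumE _ (fun v _ => v)).
rewrite big_map => s0.
have r0 := sumE _ (fun v p => cone v (ref_path p)) (fun p => @coneD (ref_path p)).
rewrite -[RHS]s0 -[RHS]addr0 -[X in _ = _ + X]r0.
rewrite -big_split big_seq [RHS]big_seq; apply: eq_bigr => -[v s'] /bpath /= sp.
have rp := ref_pathP sp; have rvp := path_in_rev rp.
rewrite -(cone_loop v (lift_elt_loop sp)) -(cone_deck v (lift_elt_loop sp) rp).
apply: (cone_homotopic _ sp); apply: homotopic_sym.
apply: (homotopic_trans (homotopic_sym (path_catA sp rvp rp))).
apply: (homotopic_trans _ (path_catp1 sp)).
exact: homotopic_cat sp (path_in_cat rvp rp) (homotopic_refl sp) (path_catVp rp).
Qed.

End Hurewicz.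

(** * The adjoint action of diagonal and antidiagonal matrices *)

Lemma invmx_eq (K : comUnitRingType) n (A B : 'M[K]_n) : A *m B = 1%:M -> invmx A = B.
Proof.
move=> AB; have [AU _] := mulmx1_unit AB.
by rewrite -[LHS]mulmx1 -AB mulKmx.
Qed.

Lemma conj_mulmx (K : comNzRingType) n (D D' A B : 'M[K]_n) : D' *m D = 1%:M ->
  (D *m A *m D') *m (D *m B *m D') = D *m (A *m B) *m D'.
Proof.
by move=> D'D; rewrite -!mulmxA (mulmxA D' D) D'D mul1mx.
Qed.

Lemma scale_conj (K : comNzRingType) n (D D' A : 'M[K]_n) a b :
  a *: (D *m (b *: A) *m D') = D *m (b *: (a *: A)) *m D'.
Proof. by rewrite -!scalemxAr -!scalemxAl !scalerA mulrC. Qed.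

Section AdjointMatrices.
Variable R : realType.
Local Notation C := R[i].
Implicit Types (A B v : 'M[C]_2).

Lemma mx22_mul (a b c d a' b' c' d' : C) :
  mx22 a b c d *m mx22 a' b' c' d' =
  mx22 (a * a' + b * c') (a * b' + b * d') (c * a' + d * c') (c * b' + d * d').
Proof.
apply/matrixP => i j; rewrite !mxE !big_ord_recl big_ord0 !mxE /= addr0.
by case: (i == 0); case: (j == 0).
Qed.

Lemma mx22_eta A : A = mx22 (A 0 0) (A 0 1) (A 1 0) (A 1 1).
Proof.
by apply/matrixP => -[[|[|]]] //= i [[|[|]]] //= j; rewrite mxE /=; congr (A _ _); exact: val_inj.
Qed.

Lemma mx22_1 : mx22 1 0 0 1 = 1%:M :> 'M[C]_2.
Proof. by apply/matrixP => -[[|[|]]] //= i [[|[|]]] //= j; rewrite !mxE. Qed.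

Lemma mxtrace2 A : \tr A = A 0 0 + A 1 1.
Proof. by rewrite /mxtrace !big_ord_recl big_ord0 addr0; congr (_ + A _ _); exact: val_inj. Qed.

(** The coordinates in the basis E, H, F, the order used by [Ad_mx]. *)
Definition sl2_coord v : 'cV[C]_3 := \col_i tnth [tuple v 0 1; v 0 0; v 1 0] i.
Definition sl2_basis (j : 'I_3) : 'M[C]_2 := tnth [tuple sl2E R; sl2H R; sl2F R] j.

Lemma sl2_decomp v : \tr v = 0 -> v = \sum_j sl2_coord v j 0 *: sl2_basis j.
Proof.
rewrite mxtrace2 => /eqP; rewrite addr_eq0 => /eqP v0.
rewrite !big_ord_recl big_ord0 addr0 !mxE [LHS]mx22_eta.
rewrite /sl2_basis !(tnth_nth 0) /= v0.
apply/matrixP => -[[|[|]]] //= i [[|[|]]] //= j; rewrite !mxE /=;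
by rewrite ?(mulr1, mulr0, addr0, add0r, mulrN1, v0, opprK).
Qed.

Lemma Ad_sum A I (r : seq I) (P : pred I) (a : I -> C) (w : I -> 'M[C]_2) :
  Ad A (\sum_(i <- r | P i) a i *: w i) = \sum_(i <- r | P i) a i *: Ad A (w i).
Proof.
rewrite /Ad mulmx_sumr mulmx_suml; apply: eq_bigr => i _.
by rewrite -scalemxAr -scalemxAl.
Qed.

Lemma Ad_tr A v : A \in unitmx -> \tr (Ad A v) = \tr v.
Proof. by move=> AU; rewrite /Ad mxtrace_mulC mulmxA mulVmx // mul1mx. Qed.

Lemma Ad_mul A B v : A \in unitmx -> B \in unitmx -> Ad (A *m B) v = Ad A (Ad B v).
Proof.
move=> AU BU; rewrite /Ad (_ : invmx (A *m B) = invmx B *m invmx A) ?mulmxA //.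
by apply: invmx_eq; rewrite mulmxA mulmxK // mulmxV.
Qed.

Lemma Ad_mxE A i j : Ad_mx A i j = sl2_coord (Ad A (sl2_basis j)) i 0.
Proof. by rewrite [LHS]mxE [RHS]mxE. Qed.

Lemma Ad_mx_coord A v : \tr v = 0 -> Ad_mx A *m sl2_coord v = sl2_coord (Ad A v).
Proof.
move=> v0; apply/colP => i; rewrite {2}(sl2_decomp v0) Ad_sum mxE.
under eq_bigr do rewrite Ad_mxE.
have coordE (w : 'M[C]_2) : sl2_coord w i 0 = w (tnth [tuple 0; 0; 1] i) (tnth [tuple 1; 0; 0] i).
  by rewrite mxE; case: i => -[|[|[|]]] //= i; rewrite !(tnth_nth 0).
rewrite [RHS]coordE summxE; apply: eq_bigr => j _.
by rewrite coordE [RHS]mxE mulrC.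
Qed.

Lemma sl2_basis_tr j : \tr (sl2_basis j) = 0.
Proof.
rewrite mxtrace2 /sl2_basis (tnth_nth 0); case: j => -[|[|[|]]] //= j;
by rewrite !mxE /= ?addr0 ?subrr.
Qed.

Lemma Ad_mx_mul A B : A \in unitmx -> B \in unitmx ->
  Ad_mx (A *m B) = Ad_mx A *m Ad_mx B.
Proof.
move=> AU BU; apply/matrixP => i j; rewrite Ad_mxE Ad_mul // -Ad_mx_coord; last first.
  by rewrite Ad_tr // sl2_basis_tr.
by rewrite !mxE; apply: eq_bigr => k _; rewrite -Ad_mxE.
Qed.

Lemma Ad_mx1 : Ad_mx 1%:M = 1%:M :> 'M[C]_3.
Proof.
have inv1 : invmx (1%:M : 'M[C]_2) = 1%:M by apply: invmx_eq; rewrite mulmx1.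
apply/matrixP => i j; rewrite Ad_mxE /Ad inv1 mul1mx mulmx1 /sl2_basis !mxE.
by rewrite !(tnth_nth 0); case: i => -[|[|[|]]] //= i; case: j => -[|[|[|]]] //= j; rewrite !mxE.
Qed.

(** The position of E and F in the basis E, H, F. *)
Definition to_EHF (i : 'I_2) : 'I_3 := if i == 0 then ord0 else ord_max.

Lemma AdEF_mxE A i j : AdEF_mx A i j = Ad_mx A (to_EHF i) (to_EHF j).
Proof.
rewrite !mxE !(tnth_nth 0).
by case: i => -[|[|]] //= i; case: j => -[|[|]] //= j.
Qed.

(** The normalizer of the diagonal torus, as met in Lin's form: diagonal matrices for
    elements of even degree, antidiagonal ones for elements of odd degree. *)
Definition dihedral_mx (odd_part : bool) (a : C) : 'M[C]_2 :=
  if odd_part then mx22 0 a (- a^-1) 0 else mx22 a 0 0 a^-1.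

Lemma dihedral_mul o o' a b : a != 0 -> b != 0 ->
  exists2 c, c != 0 & dihedral_mx o a *m dihedral_mx o' b = dihedral_mx (o (+) o') c.
Proof.
move=> a0 b0; case: o; case: o'; rewrite /dihedral_mx /= mx22_mul.
- exists (- (a / b)); first by rewrite oppr_eq0 mulf_neq0 ?invr_eq0.
  by congr mx22; field; rewrite ?a0 ?b0.
- exists (a / b); first by rewrite mulf_neq0 ?invr_eq0.
  by congr mx22; field; rewrite ?a0 ?b0.
- exists (a * b); first by rewrite mulf_neq0.
  by congr mx22; field; rewrite ?a0 ?b0.
- exists (a * b); first by rewrite mulf_neq0.
  by congr mx22; field; rewrite ?a0 ?b0.
Qed.

Lemma dihedral_inv o a : a != 0 ->
  dihedral_mx o a *m dihedral_mx o (if o then - a else a^-1) = 1%:M.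
Proof.
move=> a0; rewrite -mx22_1; case: o; rewrite /dihedral_mx /= mx22_mul;
by congr mx22; field; rewrite ?a0.
Qed.

Lemma Ad_dihedral o a : a != 0 -> Ad_mx (dihedral_mx o a) =
  \matrix_(i, j) (nth [::]
    (if o then [:: [:: 0; 0; - a ^+ 2]; [:: 0; -1; 0]; [:: - a ^- 2; 0; 0]]
     else [:: [:: a ^+ 2; 0; 0]; [:: 0; 1; 0]; [:: 0; 0; a ^- 2]]) i)`_j.
Proof.
move=> a0; apply/matrixP => i j; rewrite Ad_mxE /Ad (invmx_eq (dihedral_inv o a0)).
rewrite /sl2_basis !(tnth_nth 0) [RHS]mxE.
case: j => -[|[|[|]]] //= j; case: o; rewrite /dihedral_mx /= !mx22_mul mxE !(tnth_nth 0);
case: i => -[|[|[|]]] //= i; rewrite !mxE /=; field; rewrite ?a0 //.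
Qed.

End AdjointMatrices.

(** * Fox matrices of characters and Laurent polynomials *)

(** For a character the blocks are scalars, and plain matrices allow Cramer's rule for
    all generators at once. *)
Section FoxCharacter.
Variables (K : comNzRingType) (G : groupType) (m : nat).
Variables (x : 'I_m.+1 -> G) (rel : 'I_m -> word m.+1) (chi : G -> K).
Hypothesis chiM : forall g h, chi (g * h)%g = chi g * chi h.
Hypothesis chi1 : chi 1%g = 1.
Hypothesis relP : forall i, word_eval x (rel i) = 1%g.

Definition fox_chi (c : seq (int * word m.+1)) : K :=
  \sum_(p <- c) chi (word_eval x p.2) *~ p.1.

Lemma fox_chi_fundamental w :
  \sum_j fox_chi (fox j w) * (chi (x j) - 1) = chi (word_eval x w) - 1.
Proof.
pose act (v : K) g := v * chi g.
have := @fox_fundamental G m.+1 x K act.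
move=> /(_ _ _ _ 1 w) E; rewrite -[chi _]mul1r E; last first.
- by move=> v; rewrite /act chi1 mulr1.
- by move=> v g h; rewrite /act chiM mulrA.
- by move=> g u v; rewrite /act mulrDl.
have fE c : fox_act x act 1 c = fox_chi c.
  by apply: eq_bigr => p _; rewrite /act mul1r.
by apply: eq_bigr => j _; rewrite fE /act mulrBr mulr1.
Qed.

Definition fox_chi_mx : 'M[K]_(m, m.+1) :=
  \matrix_(i, j) fox_chi (fox j (rel i)).

Definition bordered_word w (i : 'I_m.+1) : word m.+1 :=
  if unlift ord_max i is Some k then rel k else w.

Definition fox_chi_bordered w : 'M[K]_m.+1 :=
  \matrix_(i, j) fox_chi (fox j (bordered_word w i)).

Lemma fox_chi_cofactor w l : cofactor (fox_chi_bordered w) ord_max l =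
  (-1) ^+ (m + l) * \det (col' l fox_chi_mx).
Proof.
congr (_ * \det _); apply/matrixP => i j; rewrite !mxE /bordered_word.
by rewrite liftK.
Qed.

(** The bordered matrix S sends the vector of the chi x_j - 1 to a multiple of the last
    basis vector; apply the adjugate of S. *)
Lemma fox_chi_cramer w l :
  \det (fox_chi_bordered w) * (chi (x l) - 1) =
  (-1) ^+ (m + l) * \det (col' l fox_chi_mx) * (chi (word_eval x w) - 1).
Proof.
pose b : 'cV[K]_m.+1 := \col_j (chi (x j) - 1).
have Sb : fox_chi_bordered w *m b = (chi (word_eval x w) - 1) *: delta_mx ord_max 0.
  apply/colP => i; rewrite !mxE; under eq_bigr do rewrite !mxE.
  rewrite fox_chi_fundamental /bordered_word eqxx andbT.
  case: unliftP => [k ->|->]; last by rewrite eqxx mulr1.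
  by rewrite relP chi1 subrr eq_sym (negbTE (neq_lift _ _)) mulr0.
have := congr1 (fun M => (\adj (fox_chi_bordered w) *m M) l 0) Sb.
rewrite mulmxA mul_adj_mx mul_scalar_mx -scalemxAr -colE !mxE fox_chi_cofactor => ->.
by rewrite mulrC.
Qed.

End FoxCharacter.

Section Laurent.
Variable A : idomainType.
Local Notation K := {fraction {poly A}}.
Implicit Types f g : K.

Lemma tvar_neq0 : (tvar : K) != 0.
Proof. by rewrite tofrac_eq0 polyX_eq0. Qed.

Lemma tvarD (a b : int) : (tvar : K) ^ (a + b) = tvar ^ a * tvar ^ b.
Proof. by rewrite expfzDr // tvar_neq0. Qed.

Lemma tvar_poly (k : int) (p : {poly A}) : 0 <= k ->
  tvar ^ k * tofrac p = tofrac ('X^`|k| * p).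
Proof.
by case: k => // n _; rewrite rmorphM /= rmorphXn.
Qed.

Lemma laurent_common f g : laurent f -> laurent g ->
  exists p q (k : int), f = tvar ^ k * tofrac p /\ g = tvar ^ k * tofrac q.
Proof.
move=> [p [a ->]] [q [b ->]]; pose k := Num.min a b.
exists ('X^`|a - k| * p), ('X^`|b - k| * q), k.
rewrite -!tvar_poly; last 2 first.
- by rewrite subr_ge0 ge_min lexx orbT.
- by rewrite subr_ge0 ge_min lexx.
by rewrite !mulrA -!tvarD !addrA [_ + a]addrC [_ + b]addrC !addrK.
Qed.

Lemma laurentD f g : laurent f -> laurent g -> laurent (f + g).
Proof.
move=> lf lg; have [p [q [k [-> ->]]]] := laurent_common lf lg.
by exists (p + q), k; rewrite rmorphD mulrDr.
Qed.

Lemma laurentM f g : laurent f -> laurent g -> laurent (f * g).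
Proof.
move=> [p [a ->]] [q [b ->]]; exists (p * q), (a + b).
by rewrite tvarD rmorphM mulrACA.
Qed.

Lemma laurent_poly p : laurent (tofrac p : K).
Proof. by exists p, 0; rewrite expr0z mul1r. Qed.

Lemma laurent_tvar (k : int) : laurent (tvar ^ k : K).
Proof. by exists 1, k; rewrite rmorph1 mulr1. Qed.

Lemma laurent_sign n : laurent ((-1) ^+ n : K).
Proof. by have := laurent_poly ((-1) ^+ n); rewrite rmorph_sign. Qed.

Lemma laurent_int (z : int) : laurent (z%:~R : K).
Proof. by have := laurent_poly (z%:~R); rewrite rmorph_int. Qed.

Lemma laurent_sum I (r : seq I) (P : pred I) (F : I -> K) :
  (forall i, laurent (F i)) -> laurent (\sum_(i <- r | P i) F i).
Proof.
move=> lF; apply: big_ind => //; last exact: laurentD.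
by have := laurent_poly 0; rewrite rmorph0.
Qed.

Lemma laurent_prod I (r : seq I) (P : pred I) (F : I -> K) :
  (forall i, laurent (F i)) -> laurent (\prod_(i <- r | P i) F i).
Proof.
move=> lF; apply: big_ind => //; last exact: laurentM.
by have := laurent_poly 1; rewrite rmorph1.
Qed.

Lemma laurent_det n (M : 'M[K]_n) : (forall i j, laurent (M i j)) -> laurent (\det M).
Proof.
move=> lM; apply: laurent_sum => s; apply: laurentM; first exact: laurent_sign.
exact: laurent_prod.
Qed.

Lemma laurent_tvar_sub1 (k : int) :
  exists2 q : K, laurent q & tvar ^ k - 1 = (tvar - 1) * q.
Proof.
have nat_case n : exists2 q : K, laurent q & tvar ^+ n - 1 = (tvar - 1) * q.
  exists (\sum_(i < n) tvar ^+ i); last exact: subrX1.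
  by apply: laurent_sum => i; exact: (laurent_tvar i).
case: k => n; first exact: nat_case.
have [q lq E] := nat_case n.+1; exists (- (tvar ^ (Negz n) * q)).
  by rewrite -mulN1r; apply: laurentM (laurent_sign 1) (laurentM (laurent_tvar _) lq).
rewrite mulrN mulrCA -E mulrBr mulr1 NegzE -exprnN mulVf ?opprB //.
by rewrite expf_neq0 // tvar_neq0.
Qed.

End Laurent.

(** The units of the Laurent polynomials over the integers are +- t^k. *)
Lemma poly_int_dvd_Xn n (p q : {poly int}) : p * q = 'X^n ->
  exists (e : bool) (k : nat), p = (-1) ^+ e * 'X^k.
Proof.
elim: n p q => [|n IH] p q pq.
  have p0 : p \is a GRing.unit.
    by apply/unitrP; exists q; rewrite mulrC pq expr0.
  move: p0; rewrite poly_unitE => /andP[/size_poly1P[c c0 ->]].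
  rewrite coefC /= => /unitrP[d [/intUnitRing.unitzPl + _]].
  rewrite qualifE /= => /pred2P[] ->; [exists false|exists true]; exists 0%N.
    by rewrite expr0 mul1r rmorph1.
  by rewrite expr0 mulr1 expr1 rmorphN rmorph1.
have : p.[0] * q.[0] = 0 by rewrite -hornerM pq !hornerE /= exprS mul0r.
move/eqP; rewrite mulf_eq0 => /orP[] /factor_theorem[r rE]; rewrite subr0 in rE.
  have /IH[e [k rE']] : r * q = 'X^n.
    by apply: (mulIf (negbT (polyX_eq0 _))); rewrite -exprSr -pq rE mulrAC.
  by exists e, k.+1; rewrite rE rE' exprSr mulrA.
apply: (IH p r); apply: (mulIf (negbT (polyX_eq0 _))).
by rewrite -exprSr -pq rE mulrA.
Qed.

(** * The Alexander polynomial and the maximal minors *)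

Section Doteq.
Variable A : idomainType.
Local Notation K := {fraction {poly A}}.
Implicit Types f g h : K.

Lemma doteq_refl f : doteq f f.
Proof. by exists false, 0; rewrite expr0 expr0z !mul1r. Qed.

Lemma doteq_trans g f h : doteq f g -> doteq g h -> doteq f h.
Proof.
move=> [e [a ->]] [e' [b ->]]; exists (e (+) e'), (a + b).
by rewrite tvarD signr_addb mulrA; congr (_ * _); rewrite mulrACA.
Qed.

Lemma doteq_sym f g : doteq f g -> doteq g f.
Proof.
move=> [e [a ->]]; exists e, (- a).
by rewrite mulrA mulrACA -signr_addb addbb mul1r -tvarD addNr mul1r.
Qed.

Lemma doteqMr h f g : doteq f g -> doteq (f * h) (g * h).
Proof. by move=> [e [a ->]]; exists e, a; rewrite mulrA. Qed.

Lemma doteq_sign n f : doteq ((-1) ^+ n * f) f.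
Proof. by exists (odd n), 0; rewrite expr0z mulr1 signr_odd. Qed.

End Doteq.

Section AbelianizationBasics.
Variables (G : groupType) (alpha : G -> int).
Hypothesis ab : abelianization alpha.

Lemma abelianizationM g h : alpha (g * h)%g = alpha g + alpha h.
Proof. by case: ab. Qed.

Lemma abelianization1 : alpha 1%g = 0.
Proof. by apply: (addrI (alpha 1%g)); rewrite -abelianizationM mulg1 addr0. Qed.

Variables (A : idomainType).
Local Notation K := {fraction {poly A}}.

Lemma tvar_alphaM g h : (tvar : K) ^ alpha (g * h)%g = tvar ^ alpha g * tvar ^ alpha h.
Proof. by rewrite abelianizationM tvarD. Qed.

Lemma tvar_alpha1 : (tvar : K) ^ alpha 1%g = 1.
Proof. by rewrite abelianization1 expr0z. Qed.

End AbelianizationBasics.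

Section AlexanderPolynomialMinor.
Variables (G : groupType) (m : nat) (P : deficiency_one_presentation G m).
Variables (alpha : G -> int) (D : {poly int}).
Hypothesis ab : abelianization alpha.
Hypothesis hD : alexander_polynomial P alpha D.
Local Notation K := {fraction {poly int}}.
Local Notation chi := (fun g => (tvar : K) ^ alpha g).
Local Notation M := (alexander_matrix P alpha).

Let relP i : word_eval (gen P) (relator P i) = 1%g.
Proof. exact: word_eval_rel (presentationP P). Qed.

Lemma alexander_matrixE : M = fox_chi_mx (gen P) (relator P) chi.
Proof. by apply/matrixP => i j; rewrite !mxE. Qed.

Lemma laurent_fox_chi c : laurent (fox_chi (gen P) chi c).
Proof.
apply: laurent_sum => p; rewrite -mulrzr.
by apply: laurentM; [exact: laurent_tvar|exact: laurent_int].
Qed.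

Lemma tvar_sub1_neq0 (A : idomainType) : (tvar : {fraction {poly A}}) - 1 != 0.
Proof.
rewrite -tofrac1 -rmorphB tofrac_eq0 -size_poly_eq0.
by rewrite -[1]/(1%:P) size_XsubC.
Qed.

Lemma tvar_expz_eq1 (k : int) : (tvar : K) ^ k = 1 -> k = 0.
Proof.
have nat_case n : (tvar : K) ^+ n = 1 -> n = 0%N.
  rewrite -rmorphXn -tofrac1 => /eqP; rewrite tofrac_eq => /eqP/(congr1 (fun p : {poly int} => size p)).
  by rewrite size_polyXn size_poly1 => -[].
case: k => n; first by move/nat_case ->.
rewrite NegzE -exprnN => /eqP; rewrite invr_eq1 => /eqP/nat_case.
by [].
Qed.

(** Expanding along the last row, D divides the determinant of the bordered matrix S.
    Conversely Cramer's rule shows that det S divides every minor, with quotient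
    (t^a - 1) / (t - 1) up to sign; by the maximality of D it divides D. *)
Lemma alexander_bordered w : alpha (word_eval (gen P) w) = 1 ->
  doteq (\det (fox_chi_bordered (gen P) (relator P) chi w)) (tofrac D).
Proof.
move=> w1; set S := fox_chi_bordered _ _ _ _.
have cramer l := fox_chi_cramer (tvar_alphaM ab int) (tvar_alpha1 ab int) relP w l.
have [Dminor Dmax] := hD.
have [q lq Sq] : exists2 q : K, laurent q & \det S = tofrac D * q.
  rewrite (expand_det_row S ord_max).
  have dvd l : exists q : K, laurent q /\ S ord_max l * cofactor S ord_max l = tofrac D * q.
    have [q lq E] := Dminor l; exists (S ord_max l * (-1) ^+ (m + l) * q); split.
      apply: laurentM lq; apply: laurentM; last exact: laurent_sign.
      by rewrite mxE; exact: laurent_fox_chi.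
    by rewrite fox_chi_cofactor -alexander_matrixE E; ring.
  have [q qE] := choice dvd; exists (\sum_l q l).
    by apply: laurent_sum => l; case: (qE l).
  by rewrite mulr_sumr; apply: eq_bigr => l _; case: (qE l).
have [q' lq' Dq'] : exists2 q : K, laurent q & tofrac D = \det S * q.
  apply: Dmax => [|l].
    by apply: laurent_det => i j; rewrite mxE; exact: laurent_fox_chi.
  have [q0 lq0 E] := laurent_tvar_sub1 int (alpha (gen P l)).
  exists ((-1) ^+ (m + l) * q0); first by apply: laurentM lq0; exact: laurent_sign.
  apply: (mulIf (tvar_sub1_neq0 int)); have := cramer l.
  rewrite w1 expr1z E -alexander_matrixE -/S => C.
  transitivity ((-1) ^+ (m + l) * ((-1) ^+ (m + l) * \det (col' l M) * (tvar - 1))).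
    by rewrite !mulrA -expr2 sqrr_sign mul1r.
  by rewrite -C; ring.
have [D0|D0] := eqVneq (tofrac D) 0.
  by rewrite Sq D0 mul0r; exact: doteq_refl.
have qq : q * q' = 1.
  by apply: (mulfI D0); rewrite mulr1 {2}Dq' Sq mulrA.
have [p [a qE]] := lq; have [r [b q'E]] := lq'.
have pr : tvar ^ (a + b) * tofrac (p * r) = 1.
  by rewrite rmorphM tvarD mulrACA -qE -q'E.
have [e [k pE]] : exists (e : bool) (k : nat), p = (-1) ^+ e * 'X^k.
  case E : (a + b) => [n|n]; rewrite E in pr.
    have : 'X^n * (p * r) = 1.
      by apply/eqP; rewrite -tofrac_eq rmorphM rmorphXn rmorph1 -pr.
    by rewrite mulrCA -(expr0 'X) => /poly_int_dvd_Xn.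
  apply: (@poly_int_dvd_Xn n.+1 p r); apply/eqP; rewrite -tofrac_eq.
  have := congr1 (fun f => tvar ^ n.+1 * f) pr.
  by rewrite mulrA -tvarD NegzE subrr expr0z mul1r mulr1 => ->; rewrite rmorphXn.
exists e, (a + k%:Z); rewrite Sq qE pE tvarD rmorphM rmorph_sign rmorphXn.
by rewrite -exprnP; ring.
Qed.

Lemma alexander_minor l : alpha (gen P l) <> 0 ->
  doteq (\det (col' l M) / (tvar ^ alpha (gen P l) - 1)) (tofrac D / (tvar - 1)).
Proof.
move=> al; have [_ /(_ 1)[g g1] _] := ab.
have [w wE] := (presentationP P).1 g.
have w1 : alpha (word_eval (gen P) w) = 1 by rewrite wE.
apply: doteq_trans (doteqMr _ (alexander_bordered w1)).
have := fox_chi_cramer (tvar_alphaM ab int) (tvar_alpha1 ab int) relP w l.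
rewrite w1 expr1z -alexander_matrixE => C.
have tl : tvar ^ alpha (gen P l) - 1 != 0 :> K.
  by rewrite subr_eq0; apply/eqP => /tvar_expz_eq1.
apply: doteq_sym; apply: (doteq_trans (g := (-1) ^+ (m + l) * (\det (col' l M) / (tvar ^ alpha (gen P l) - 1)))).
  rewrite (_ : _ / (tvar - 1) = (-1) ^+ (m + l) * (\det (col' l M) / (tvar ^ alpha (gen P l) - 1))).
    exact: doteq_refl.
  by apply/eqP; rewrite mulrA (eqr_div _ _ (tvar_sub1_neq0 int) tl) C.
exact: doteq_sign.
Qed.

End AlexanderPolynomialMinor.

Section Twist.
Variables (G : groupType) (m : nat) (x : 'I_m.+1 -> G) (rel : 'I_m -> word m.+1).

(** Wada's quotient for a representation Phi over the field of rational functions. *)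
Definition twist (K : fieldType) n (Phi : G -> 'M[K]_n) l : K :=
  \det (fox_minor x rel Phi l) / \det (Phi (x l) - 1%:M).

Lemma fox_mx_ext (K : fieldType) n (Phi Phi' : G -> 'M[K]_n) c :
  (forall g, Phi g = Phi' g) -> fox_mx x Phi c = fox_mx x Phi' c.
Proof. by move=> E; apply: eq_bigr => p _; rewrite E. Qed.

Lemma twist_ext (K : fieldType) n (Phi Phi' : G -> 'M[K]_n) l :
  (forall g, Phi g = Phi' g) -> twist Phi l = twist Phi' l.
Proof.
move=> E; rewrite /twist E; congr (\det _ / _).
by apply: eq_mxblock => i j; exact: fox_mx_ext.
Qed.

Lemma twist_conj (K : fieldType) n (Phi Phi' : G -> 'M[K]_n) (U V : 'M[K]_n) l :
  U *m V = 1%:M -> (forall g, Phi' g = U *m Phi g *m V) -> twist Phi' l = twist Phi l.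
Proof.
move=> UV E; rewrite /twist; congr (_ / _).
  rewrite -[RHS](det_mxblock_conj _ UV); congr (\det _).
  apply: eq_mxblock => i j; rewrite /fox_mx mulmx_sumr mulmx_suml.
  by apply: eq_bigr => p _; rewrite E -!scaler_int -scalemxAr -scalemxAl.
have -> : Phi' (x l) - 1%:M = U *m (Phi (x l) - 1%:M) *m V.
  by rewrite mulmxBr mulmx1 mulmxBl UV -E.
by rewrite !det_mulmx mulrAC -det_mulmx UV det1 mul1r.
Qed.

Lemma twist_block (K : fieldType) n1 n2 (phi1 : G -> 'M[K]_n1) (phi2 : G -> 'M[K]_n2) l :
  twist (fun g => block_mx (phi1 g) 0 0 (phi2 g)) l = twist phi1 l * twist phi2 l.
Proof.
rewrite /twist mulf_div; congr (_ / _).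
  rewrite -det_mxblock_split; congr (\det _); apply: eq_mxblock => i j.
  rewrite /fox_mx; elim/big_ind3 : _ => [|A1 A2 A3 B1 B2 B3 -> ->|p _].
  - by rewrite block_mx0.
  - by rewrite add_block_mx !addr0.
  - by rewrite -!scaler_int scale_block_mx !scaler0.
by rewrite scalar_mx_block opp_block_mx add_block_mx !oppr0 !addr0 det_ublock.
Qed.

Lemma twist_map (K K' : fieldType) n (f : {rmorphism K -> K'}) (Phi : G -> 'M[K]_n) l :
  f (twist Phi l) = twist (fun g => map_mx f (Phi g)) l.
Proof.
rewrite /twist fmorph_div -!det_map_mx map_mxB map_scalar_mx rmorph1; congr (\det _ / _).
apply/matrixP => i j; rewrite !mxE /fox_mx !summxE rmorph_sum; apply: eq_bigr => p _.
by rewrite -!scaler_int !mxE rmorphM rmorph_int.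
Qed.

End Twist.

(** * Twisting by the abelianization *)

HB.instance Definition _ (A : idomainType) :=
  GRing.RMorphism.copy (@cst_frac A) (@FracField.tofrac _ \o polyC).

Section Twisting.
Variables (A : idomainType) (G : groupType) (n : nat) (alpha : G -> int).
Variable phi : G -> 'M[A]_n.
Hypothesis ab : abelianization alpha.
Hypothesis phiM : forall g h, phi (g * h)%g = phi g *m phi h.
Hypothesis phi1 : phi 1%g = 1%:M.
Local Notation K := {fraction {poly A}}.

(** The representation alpha (x) phi. *)
Definition alpha_tensor (g : G) : 'M[K]_n :=
  tvar ^ alpha g *: map_mx (@cst_frac A) (phi g).

Lemma alpha_tensorM g h : alpha_tensor (g * h)%g = alpha_tensor g *m alpha_tensor h.
Proof.
rewrite /alpha_tensor tvar_alphaM // phiM map_mxM -scalemxAl -scalemxAr.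
by rewrite scalerA.
Qed.

Lemma alpha_tensor1 : alpha_tensor 1%g = 1%:M.
Proof. by rewrite /alpha_tensor tvar_alpha1 // phi1 map_mx1 scale1r. Qed.

Lemma twisted_alexanderE m (P : deficiency_one_presentation G m) l :
  twisted_alexander P alpha phi l = twist (gen P) (relator P) alpha_tensor l.
Proof.
rewrite /twisted_alexander /twist; congr (_ / \det _).
rewrite /Phi big_cons big_seq1 /Phi_word /= mulg1 mulr1z mulrN1z.
by rewrite -/(alpha_tensor _) -/(alpha_tensor 1%g) alpha_tensor1.
Qed.

End Twisting.

Section DilationMorphism.
Variables (A : idomainType) (a : A).
Hypothesis a0 : a != 0.
Local Notation K := {fraction {poly A}}.

Definition dilation : {rmorphism K -> K} := frac_map (comp_scaleX_inj a0).

Lemma dilateE f : dilate a f = dilation f.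
Proof. by []. Qed.

Lemma dilation_cst c : dilation (cst_frac c) = cst_frac c.
Proof. by rewrite /dilation /= frac_map_tofrac /= comp_polyC. Qed.

Lemma dilation_tvar : dilation tvar = cst_frac a * tvar.
Proof.
by rewrite /dilation /= frac_map_tofrac /= comp_polyX -mul_polyC rmorphM.
Qed.

Lemma dilation_tvarX (k : int) : dilation (tvar ^ k) = cst_frac a ^ k * tvar ^ k.
Proof. by rewrite fmorphXz dilation_tvar expfzMl. Qed.

End DilationMorphism.

Lemma odd_absD (a b : int) : odd (absz (a + b)) = odd (absz a) (+) odd (absz b).
Proof. lia. Qed.

Lemma expN1z (K : fieldType) (k : int) : (-1 : K) ^ k = (-1) ^+ odd (absz k).
Proof.
case: k => n; first by rewrite signr_odd.
by rewrite NegzE -exprnN -exprVn invrN1 signr_odd.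
Qed.

Section IntToField.
Variable C : numFieldType.

(** The substitution t -> -t together with the inclusion of integer polynomials. *)
Definition neg_intr : {rmorphism {poly int} -> {poly C}} :=
  comp_poly (-1 *: 'X) \o map_poly intr.

Lemma neg_intr_inj : injective neg_intr.
Proof.
apply: inj_comp; last by apply: map_inj_poly; [exact: intr_inj|].
by apply: comp_scaleX_inj; rewrite oppr_eq0 oner_eq0.
Qed.

Definition neg_fraction : {rmorphism {fraction {poly int}} -> {fraction {poly C}}} :=
  frac_map neg_intr_inj.

Lemma neg_fraction_tofrac D :
  neg_fraction (tofrac D) = dilate (-1) (tofrac (map_poly intr D)).
Proof.
have n1 : (-1 : C) != 0 by rewrite oppr_eq0 oner_eq0.
by rewrite (dilateE n1) /= !frac_map_tofrac.
Qed.

Lemma neg_fraction_tvar : neg_fraction tvar = - tvar.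
Proof.
rewrite /neg_fraction /= frac_map_tofrac /= map_polyX comp_polyX scaleN1r.
by rewrite rmorphN.
Qed.

Lemma neg_fraction_doteq f g : doteq f g -> doteq (neg_fraction f) (neg_fraction g).
Proof.
move=> [e [k ->]]; exists (e (+) odd (absz k)), k.
rewrite !rmorphM rmorph_sign fmorphXz neg_fraction_tvar.
by rewrite -[- tvar]mulN1r expfzMl expN1z (mulrA ((-1) ^+ e)) -signr_addb.
Qed.

End IntToField.

(** For the sign character Wada's quotient is the image, under t -> -t, of a maximal
    minor of the Alexander matrix over t^(alpha g_l) - 1. *)
Lemma twist_sign (C : numFieldType) (G : groupType) m
    (P : deficiency_one_presentation G m) (alpha : G -> int) l D :
    abelianization alpha -> alexander_polynomial P alpha D ->
    alpha (gen P l) <> 0 ->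
  doteq (twist (gen P) (relator P)
           (alpha_tensor alpha (fun g => ((-1) ^+ odd (absz (alpha g)))%:M : 'M[C]_1)) l)
        (dilate (-1) (tofrac (map_poly intr D)) / (- tvar - 1)).
Proof.
move=> ab hD al; rewrite -neg_fraction_tofrac -neg_fraction_tvar.
rewrite -(rmorph1 (neg_fraction C)) -rmorphB -fmorph_div.
rewrite -(@twist_ext _ _ (gen P) (relator P) _ _
  (fun g => map_mx (neg_fraction C) (tvar ^ alpha g)%:M)); last first.
  move=> g; rewrite map_scalar_mx /alpha_tensor fmorphXz neg_fraction_tvar.
  rewrite map_scalar_mx scale_scalar_mx -[- tvar]mulN1r expfzMl expN1z mulrC; congr (_ * _)%:M.
  by rewrite rmorph_sign.
rewrite -twist_map; apply: neg_fraction_doteq.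
apply: doteq_trans (alexander_minor ab hD al).
rewrite /twist (_ : \det _ = \det (col' l (alexander_matrix P alpha))); last first.
  rewrite /fox_minor det_mxblock11; congr (\det _); apply/matrixP => i j.
  rewrite !mxE /fox_mx summxE; apply: eq_bigr => p _.
  by rewrite -scaler_int !mxE eqxx mulr1n mulrzl.
by rewrite det_mx11 !mxE eqxx !mulr1n; exact: doteq_refl.
Qed.

(** * Representations in Lin's form *)

Section LinGenerators.
Variables (G : groupType) (alpha : G -> int) (n : nat).
Variables (y : 'I_n.+1 -> G) (ap am : 'I_n -> word n).
Hypothesis ab : abelianization alpha.
Hypothesis pres : presents y (lin_relator ap am).
Hypothesis mu1 : alpha (y ord_max) = 1.

(** Sending mu to 1 and all x_j to 0 kills Lin's relators mu a^+ mu^-1 (a^-)^-1, so it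
    extends to a homomorphism to the integers. It agrees with alpha because both
    factor through the abelianization and have the value 1 at mu. *)
Lemma lin_generator_alpha j : alpha (y (lift ord_max j)) = 0.
Proof.
pose v (i : 'I_n.+1) : int := (i == ord_max)%:R.
have widen0 w : word_sum v (widen_word w) = 0.
  rewrite /word_sum big_map big1 // => p _ /=.
  by rewrite /v eq_sym (negbTE (neq_lift _ _)) oppr0 if_same.
have vrel i : word_sum v (lin_relator ap am i) = 0.
  rewrite /lin_relator /word_sum big_cons big_cat big_cons -!/(word_sum v _) /=.
  by rewrite !widen0 add0r addr0 subrr.
have [f [fM fE]] := presents_additive pres vrel.
have fy i : f (y i) = v i.
  by have := fE [:: (i, false)]; rewrite /= mulg1 /word_sum big_seq1.
have := abelianization_factor ab mu1 fM (y (lift ord_max j)).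
rewrite !fy /v eqxx eq_sym (negbTE (neq_lift _ _)) => /esym.
by rewrite mulr1n intz.
Qed.

End LinGenerators.

Lemma rep_inv (K : fieldType) (G : groupType) n (f : G -> 'M[K]_n) g :
    (forall g h, f (g * h)%g = f g *m f h) -> f 1%g = 1%:M ->
  f g^-1%g = invmx (f g).
Proof. by move=> fM f1; symmetry; apply: invmx_eq; rewrite -fM mulgV. Qed.

Lemma rep_ext (K : fieldType) (G : groupType) n k (x : 'I_k -> G) (f f' : G -> 'M[K]_n) :
    (forall g, exists w, word_eval x w = g) ->
    (forall g h, f (g * h)%g = f g *m f h) -> (forall g h, f' (g * h)%g = f' g *m f' h) ->
    f 1%g = 1%:M -> f' 1%g = 1%:M ->
    (forall i, f (x i) = f' (x i)) ->
  forall g, f g = f' g.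
Proof.
move=> gen fM f'M f1 f'1 fx g; have [w <-] := gen g.
elim: w => [|[i b] w IH] /=; first by rewrite f1.
by rewrite fM f'M IH; case: b; rewrite ?rep_inv ?fx.
Qed.

Lemma SL2_unit (R : realType) (G : groupType) (rho : G -> 'M[R[i]]_2) g :
  SL2_representation rho -> rho g \in unitmx.
Proof. by case=> _ d; rewrite unitmxE d unitr1. Qed.

Lemma SL2_one (R : realType) (G : groupType) (rho : G -> 'M[R[i]]_2) :
  SL2_representation rho -> rho 1%g = 1%:M.
Proof.
move=> hrho; have U := SL2_unit 1%g hrho; case: hrho => M _.
by rewrite -[LHS](mulmxK U) -M mulg1 mulmxV.
Qed.

Section LinForm.
Variables (R : realType) (G : groupType) (alpha : G -> int) (n : nat).
Local Notation C := R[i].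
Variables (y : 'I_n.+1 -> G) (rho0 : G -> 'M[C]_2) (z : 'I_n -> C).
Hypothesis ab : abelianization alpha.
Hypothesis gen : forall g, exists w, word_eval y w = g.
Hypothesis mu1 : alpha (y ord_max) = 1.
Hypothesis alpha0 : forall j, alpha (y (lift ord_max j)) = 0.
Hypothesis hrho0 : SL2_representation rho0.
Hypothesis rho0y : forall j, rho0 (y (lift ord_max j)) = mx22 (z j) 0 0 (z j)^-1.
Hypothesis rho0mu : rho0 (y ord_max) = mx22 0 1 (-1) 0.

Local Notation par g := (odd (absz (alpha g))).

Let rho0M := hrho0.1.
Let rho01 := SL2_one hrho0.

Lemma lin_z_neq0 j : z j != 0.
Proof.
apply/eqP => z0; have := SL2_unit (y (lift ord_max j)) hrho0.
rewrite rho0y z0 invr0 => /mulmxV; move: (invmx _) => B /matrixP/(_ 0 0).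
rewrite mxE [RHS]mxE big1 => [/esym/eqP|k _]; first by rewrite oner_eq0.
by rewrite mxE /= if_same mul0r.
Qed.

Lemma par_mul g h : par (g * h)%g = par g (+) par h.
Proof. by rewrite abelianizationM // odd_absD. Qed.

(** The generators have this form, which is stable under products and inverses. *)
Lemma lin_dihedral g : exists2 a, a != 0 & rho0 g = dihedral_mx (par g) a.
Proof.
have base i : exists2 a, a != 0 & rho0 (y i) = dihedral_mx (par (y i)) a.
  have [j ->|->] := unliftP ord_max i.
    by exists (z j); rewrite ?lin_z_neq0 // alpha0 rho0y.
  by exists 1; rewrite ?oner_neq0 // mu1 rho0mu /dihedral_mx /= invr1.
have [w <-] := gen g; elim: w => [|[i b] w [a a0 E]] /=.
  exists 1; rewrite ?oner_neq0 // rho01 (abelianization1 ab) /dihedral_mx /= invr1.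
  by rewrite mx22_1.
have [c c0 Ei] : exists2 c, c != 0 &
    rho0 (if b then (y i)^-1 else y i)%g = dihedral_mx (par (if b then (y i)^-1 else y i)%g) c.
  case: b => //; have [c c0 Ei] := base i.
  have pV : par (y i)^-1%g = par (y i).
    have := par_mul (y i)^-1%g (y i); rewrite mulVg (abelianization1 ab).
    by case: (par _); case: (par _).
  exists (if par (y i) then - c else c^-1).
    by case: ifP; rewrite ?oppr_eq0 ?invr_eq0.
  by rewrite pV rep_inv // Ei (invmx_eq (dihedral_inv _ c0)).
have [d d0 Ed] := dihedral_mul (par (if b then (y i)^-1 else y i)%g) (par (word_eval y w)) c0 a0.
by exists d; rewrite // par_mul -Ed -Ei -E rho0M.
Qed.

Lemma Ad_rho0M g h : Ad_mx (rho0 (g * h)%g) = Ad_mx (rho0 g) *m Ad_mx (rho0 h).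
Proof. by rewrite rho0M Ad_mx_mul // SL2_unit. Qed.

Definition psi1 (g : G) : 'M[C]_1 := ((-1) ^+ par g)%:M.
Definition psi2 (g : G) : 'M[C]_2 := AdEF_mx (rho0 g).
(** It reorders the basis E, H, F into H, E, F, which separates the two summands. *)
Definition swapEH : 'M[C]_3 := perm_mx (tperm ord0 (lift ord0 ord0)).

Lemma swapEH_mul : swapEH *m swapEH = 1%:M.
Proof. by rewrite /swapEH -perm_mxM tperm2 perm_mx1. Qed.

Lemma Ad_rho0_block g :
  Ad_mx (rho0 g) = swapEH *m block_mx (psi1 g) 0 0 (psi2 g) *m swapEH.
Proof.
suff <- : swapEH *m Ad_mx (rho0 g) *m swapEH = block_mx (psi1 g) 0 0 (psi2 g).
  by rewrite !mulmxA swapEH_mul mul1mx -mulmxA swapEH_mul mulmx1.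
rewrite /swapEH -{2}tpermV -row_permE -col_permE.
set s := tperm _ _.
have s0 : s (lshift 2 (0 : 'I_1)) = lift ord0 ord0.
  have -> : lshift 2 (0 : 'I_1) = ord0 :> 'I_3 by exact: val_inj.
  exact: tpermL.
have s1 (k : 'I_2) : s (rshift 1 k) = to_EHF k.
  case: k => -[|[|]] //= k.
    have -> : rshift 1 (Ordinal k) = lift ord0 ord0 :> 'I_3 by exact: val_inj.
    exact: tpermR.
  have -> : rshift 1 (Ordinal k) = ord_max :> 'I_3 by exact: val_inj.
  exact: tpermD.
have [a a0 E] := lin_dihedral g; have A := Ad_dihedral (par g) a0; rewrite -E in A.
apply/matrixP => i j; rewrite [LHS]mxE [LHS]mxE.
case: (@split_ordP 1 2 i) => i' ->; case: (@split_ordP 1 2 j) => j' ->.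
- apply: etrans (esym (block_mxEul (psi1 g) 0 0 (psi2 g) i' j')).
  rewrite (ord1 i') (ord1 j') s0 A !mxE /=.
  by case: (par g); rewrite /= ?expr1 ?expr0.
- apply: etrans (esym (block_mxEur (psi1 g) 0 0 (psi2 g) i' j')).
  rewrite (ord1 i') s0 s1 A !mxE /=.
  by rewrite /to_EHF; case: (par g); case: (j' == 0).
- apply: etrans (esym (block_mxEdl (psi1 g) 0 0 (psi2 g) i' j')).
  rewrite (ord1 j') s0 s1 A !mxE /=.
  by rewrite /to_EHF; case: (par g); case: (i' == 0).
- apply: etrans (esym (block_mxEdr (psi1 g) 0 0 (psi2 g) i' j')).
  by rewrite !s1 -AdEF_mxE.
Qed.

Let blockE g : block_mx (psi1 g) 0 0 (psi2 g) = swapEH *m Ad_mx (rho0 g) *m swapEH.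
Proof.
by rewrite Ad_rho0_block !mulmxA swapEH_mul mul1mx -mulmxA swapEH_mul mulmx1.
Qed.

(** Multiplicativity is inherited from the full adjoint representation through the
    block decomposition. *)
Lemma psi2M g h : psi2 (g * h)%g = psi2 g *m psi2 h.
Proof.
have : block_mx (psi1 (g * h)%g) 0 0 (psi2 (g * h)%g) =
    block_mx (psi1 g) 0 0 (psi2 g) *m block_mx (psi1 h) 0 0 (psi2 h).
  by rewrite !blockE Ad_rho0M conj_mulmx // swapEH_mul.
by rewrite mulmx_block !mul0mx !mulmx0 !add0r => /eq_block_mx[].
Qed.

Lemma psi21 : psi2 1%g = 1%:M.
Proof.
have := blockE 1%g; rewrite rho01 Ad_mx1 mulmx1 swapEH_mul.
by rewrite (@scalar_mx_block _ 1 2) => /eq_block_mx[].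
Qed.

Lemma psi2_dihedral g : exists2 a, a != 0 &
  psi2 g = if par g then mx22 0 (- a) (- a^-1) 0 else mx22 a 0 0 a^-1.
Proof.
have [a a0 E] := lin_dihedral g; exists (a ^+ 2); first by rewrite expf_neq0.
apply/matrixP => i j; rewrite AdEF_mxE E Ad_dihedral // mxE.
by case: (par g); case: i => -[|[|]] //= i; case: j => -[|[|]] //= j; rewrite !mxE.
Qed.

Section Associated.
Variable arho : G -> 'M[C]_2.
Hypothesis harho : SL2_representation arho.
Hypothesis arhoy : forall j, arho (y (lift ord_max j)) = mx22 (z j ^+ 2) 0 0 (z j ^+ 2)^-1.
Hypothesis arhomu : arho (y ord_max) = mx22 0 1 (-1) 0.

(** Both sides are representations, so it suffices to compare them on mu and the x_j;
    conjugating by diag(1, -i) turns i (0 1; -1 0) into (0 -1; -1 0). *)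
Lemma psi2_associated g : psi2 g =
  mx22 1 0 0 (- 'i)%C *m ('i%C ^ alpha g *: arho g) *m mx22 1 0 0 'i%C.
Proof.
set D := mx22 1 0 0 (- 'i)%C; set D' := mx22 1 0 0 'i%C.
have DD' : D *m D' = 1%:M.
  by rewrite mx22_mul !mulr0 !mul0r !addr0 !add0r mulr1 mulNr -expr2 sqr_i opprK mx22_1.
have i0 : 'i%C != 0 :> C.
  by rewrite -sqrf_eq0 sqr_i oppr_eq0 oner_eq0.
have D'D := mulmx1C DD'.
pose f g := D *m ('i%C ^ alpha g *: arho g) *m D'.
have [arhoM _] := harho.
have fM g' h' : f (g' * h')%g = f g' *m f h'.
  rewrite /f abelianizationM // expfzDr // arhoM.
  by rewrite (conj_mulmx _ _ D'D) -(scalemxAl _ (arho g')) -(scalemxAr _ (arho g')) scalerA.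
have f1 : f 1%g = 1%:M.
  by rewrite /f (abelianization1 ab) expr0z scale1r (SL2_one harho) mulmx1.
apply: (rep_ext gen psi2M fM psi21 f1) => i.
have [j ->|->] := unliftP ord_max i.
  rewrite /f alpha0 expr0z scale1r arhoy !mx22_mul /psi2 rho0y.
  have zj := lin_z_neq0 j.
  apply/matrixP => k l; rewrite AdEF_mxE (Ad_dihedral false zj) mxE.
  case: k => -[|[|]] //= k; case: l => -[|[|]] //= l; rewrite !mxE /=; 
  rewrite ?(mulr0, mul0r, addr0, add0r, mul1r, mulr1) //.
  by rewrite mulrAC mulNr -expr2 sqr_i opprK mul1r.
rewrite /f mu1 expr1z arhomu /psi2 rho0mu.
have E : mx22 0 1 (-1) 0 = dihedral_mx true (1 : C) by rewrite /dihedral_mx invr1.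
apply/matrixP => k l; rewrite AdEF_mxE [in LHS]E (Ad_dihedral true (oner_neq0 _)) mxE.
have -> : 'i%C *: mx22 0 1 (-1) 0 = mx22 0 'i%C (- 'i%C) 0 :> 'M[C]_2.
  by apply/matrixP => -[[|[|]]] //= ? [[|[|]]] //= ?; rewrite !mxE /= ?mulr0 ?mulr1 ?mulrN1.
rewrite !mx22_mul; case: k => -[|[|]] //= k; case: l => -[|[|]] //= l; rewrite !mxE /=;
rewrite ?(mulr0, mul0r, addr0, add0r, mul1r, mulr1, expr1n, invr1) //.
  by rewrite -expr2 sqr_i.
by rewrite mulrNN -expr2 sqr_i.
Qed.

End Associated.
End LinForm.

(** * Values at one and even Laurent polynomials *)

Section ValueAtOne.
Variable A : idomainType.
Local Notation K := {fraction {poly A}}.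

(** The value at t = 1 of a Laurent polynomial inside the field of fractions. It is a
    relation because only Laurent polynomials have one here. *)
Definition value1 (f : K) (c : A) : Prop :=
  exists (p : {poly A}) (k : int), f = tvar ^ k * tofrac p /\ p.[1] = c.

Lemma value1D f g c d : value1 f c -> value1 g d -> value1 (f + g) (c + d).
Proof.
move=> [p [a [-> <-]]] [q [b [-> <-]]]; pose k := Num.min a b.
have ka : 0 <= a - k by rewrite subr_ge0 ge_min lexx.
have kb : 0 <= b - k by rewrite subr_ge0 ge_min lexx orbT.
exists ('X^(absz (a - k)) * p + 'X^(absz (b - k)) * q), k; split.
  rewrite rmorphD /= mulrDr -(tvar_poly p ka) -(tvar_poly q kb) !mulrA -!tvarD.
  by rewrite !addrA [k + a]addrC [k + b]addrC !addrK.
by rewrite hornerD !hornerM !hornerXn !expr1n !mul1r.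
Qed.

Lemma value1M f g c d : value1 f c -> value1 g d -> value1 (f * g) (c * d).
Proof.
move=> [p [a [-> <-]]] [q [b [-> <-]]]; exists (p * q), (a + b).
by rewrite hornerM tvarD rmorphM mulrACA.
Qed.

Lemma value1_poly p : value1 (tofrac p) p.[1].
Proof. by exists p, 0; rewrite expr0z mul1r. Qed.

Lemma value1_tvar (k : int) : value1 (tvar ^ k) 1.
Proof. by exists 1, k; rewrite rmorph1 mulr1 hornerC. Qed.

Lemma value1_cst c : value1 (cst_frac c) c.
Proof. by have := value1_poly c%:P; rewrite hornerC. Qed.

Lemma value1_sum I (r : seq I) (P : pred I) (F : I -> K) (c : I -> A) :
  (forall i, value1 (F i) (c i)) ->
  value1 (\sum_(i <- r | P i) F i) (\sum_(i <- r | P i) c i).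
Proof.
move=> Fc; elim/big_ind2 : _ => // [|? ? ? ?]; last exact: value1D.
by have := value1_cst 0; rewrite rmorph0.
Qed.

Lemma value1_prod I (r : seq I) (P : pred I) (F : I -> K) (c : I -> A) :
  (forall i, value1 (F i) (c i)) ->
  value1 (\prod_(i <- r | P i) F i) (\prod_(i <- r | P i) c i).
Proof.
move=> Fc; elim/big_ind2 : _ => // [|? ? ? ?]; last exact: value1M.
by have := value1_cst 1; rewrite rmorph1.
Qed.

Definition value1_mx m n (M : 'M[K]_(m, n)) (N : 'M[A]_(m, n)) : Prop :=
  forall i j, value1 (M i j) (N i j).

Lemma value1_det n (M : 'M[K]_n) (N : 'M[A]_n) :
  value1_mx M N -> value1 (\det M) (\det N).
Proof.
move=> MN; apply: value1_sum => s; apply: value1M; last exact: value1_prod.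
by have := value1_cst ((-1) ^+ s); rewrite rmorph_sign.
Qed.

Lemma value1_block m1 m2 n1 n2 (M1 : 'M[K]_(m1, n1)) (M2 : 'M[K]_(m1, n2))
    (M3 : 'M[K]_(m2, n1)) (M4 : 'M[K]_(m2, n2)) N1 N2 N3 N4 :
  value1_mx M1 N1 -> value1_mx M2 N2 -> value1_mx M3 N3 -> value1_mx M4 N4 ->
  value1_mx (block_mx M1 M2 M3 M4) (block_mx N1 N2 N3 N4).
Proof.
move=> E1 E2 E3 E4 i j; case: (split_ordP i) => i' ->; case: (split_ordP j) => j' ->.
- by rewrite !block_mxEul.
- by rewrite !block_mxEur.
- by rewrite !block_mxEdl.
- by rewrite !block_mxEdr.
Qed.

Section Fox.
Variables (G : groupType) (n m : nat) (x : 'I_m.+1 -> G) (rel : 'I_m -> word m.+1).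
Variables (alpha : G -> int) (phi : G -> 'M[A]_n).

Lemma value1_fox c i j : value1 (fox_mx x (alpha_tensor alpha phi) c i j)
  ((\sum_(p <- c) phi (word_eval x p.2) *~ p.1) i j).
Proof.
rewrite /fox_mx !summxE; apply: value1_sum => p.
rewrite -!scaler_int !mxE; apply: value1M.
  by have := value1_cst (p.1)%:~R; rewrite rmorph_int.
rewrite -[X in value1 _ X]mul1r; apply: value1M; first exact: value1_tvar.
exact: value1_cst.
Qed.

End Fox.
End ValueAtOne.

Lemma value1_bordered (A : fieldType) (G : groupType) (n m : nat)
    (x : 'I_m.+1 -> G) (rel : 'I_m -> word m.+1) (alpha : G -> int)
    (phi : G -> 'M[A]_n) l w :
  value1 (\det (fox_bordered x rel (alpha_tensor alpha phi) l w))
         (\det (fox_bordered x rel phi l w)).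
Proof.
by apply: value1_det; apply: value1_block => i j; rewrite ?mxE; exact: value1_fox.
Qed.

Lemma poly_parity (A : idomainType) (p : {poly A}) (b : bool) :
    (2 : A) != 0 -> p \Po (-1 *: 'X) = (-1) ^+ b *: p ->
  exists q : {poly A}, p = 'X^b * (q \Po 'X^2).
Proof.
move=> two; move=> E.
have coefE i : (-1) ^+ i * p`_i = (-1) ^+ b * p`_i.
  have := congr1 (fun r : {poly A} => r`_i) E; rewrite coefZ => <-.
  rewrite comp_polyE coef_sum.
  have [ip|ip] := ltnP i (size p).
    rewrite (bigD1 (Ordinal ip)) //= big1 ?addr0 => [|j ji].
      by rewrite exprZn !coefZ coefXn eqxx mulr1 mulrC.
    rewrite exprZn !coefZ coefXn (_ : (i == j) = false) ?mulr0 ?mulr0 //.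
    by apply/negbTE; apply: contraNneq ji => ij; apply/eqP/val_inj.
  rewrite nth_default // mulr0 big1 // => j _.
  rewrite exprZn !coefZ coefXn (_ : (i == j) = false) ?mulr0 //.
  by apply/negbTE; rewrite neq_ltn (leq_trans (ltn_ord j) ip) orbT.
have vanish i : odd i != b -> p`_i = 0.
  move=> ib; have := coefE i; rewrite -signr_odd => /eqP.
  rewrite -subr_eq0 -mulrBl mulf_eq0 => /orP[|/eqP //].
  move: ib; case: (odd i); case: b {E coefE} => //= _; rewrite expr0 expr1.
    by rewrite -opprD oppr_eq0 -[1 + 1]/(2%:R) (negbTE two).
  by rewrite opprK -[1 + 1]/(2%:R) (negbTE two).
case: b E coefE vanish => E coefE vanish.
  exists (odd_poly p); rewrite -[LHS]poly_even_odd (_ : even_poly p = 0).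
    by rewrite comp_poly0 add0r mulrC.
  by apply/polyP => i; rewrite coef_even_poly coef0 vanish // odd_double.
exists (even_poly p); rewrite -[LHS]poly_even_odd (_ : odd_poly p = 0).
  by rewrite comp_poly0 mul0r addr0 mul1r.
by apply/polyP => i; rewrite coef_odd_poly coef0 vanish //= odd_double.
Qed.

(** Write f = t^k p. Invariance under t -> -t gives p(-X) = (-1)^k p(X), so p vanishes at
    -1 as well as at 1; the quotient of p by X^2 - 1 has the same parity as p, and the
    factor X that an odd k leaves makes the power of t even. *)
Lemma even_laurent_quotient (A : fieldType) (f : {fraction {poly A}}) :
    (2 : A) != 0 -> value1 f 0 -> dilate (-1) f = f ->
  even_laurent (f / (tvar ^+ 2 - 1)).
Proof.
move=> two [p [k [fE p1]]].
have n1 : (-1 : A) != 0 by rewrite oppr_eq0 oner_eq0.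
rewrite (dilateE n1) => fsym.
have psym : p \Po (-1 *: 'X) = (-1) ^+ odd (absz k) *: p.
  move: fsym; rewrite fE rmorphM dilation_tvarX /dilation /= frac_map_tofrac /=.
  rewrite -[cst_frac (-1)]/(tofrac (-1)%:P) !rmorphN1 expN1z mulrAC mulrC.
  move/(mulfI (expfz_neq0 k (tvar_neq0 A))) => E.
  have {}E : p \Po (-1 *: 'X) = (-1) ^+ odd (absz k) * p.
    apply/eqP; rewrite -tofrac_eq rmorphM rmorph_sign /= -E mulrA -signr_addb addbb.
    by rewrite mul1r.
  by rewrite E -mul_polyC rmorph_sign.
have pm1 : p.[-1] = 0.
  have := congr1 (fun r => r.[1]) psym.
  by rewrite horner_comp !hornerE p1 mulr0.
have /factor_theorem[q qE] : root p 1 by apply/eqP.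
have /factor_theorem[r rE] : root q (-1).
  apply/eqP; move: pm1; rewrite qE hornerM !hornerE => /eqP; rewrite mulf_eq0 orbC.
  rewrite -opprD oppr_eq0 (negbTE two) /= => /eqP //.
have pE : p = r * ('X^2 - 1).
  by rewrite qE rE -mulrA -polyC1 polyCN opprK; congr (r * _); rewrite polyC1; ring.
have X2 : ('X^2 - 1 : {poly A}) != 0.
  by rewrite -[1]/(1%:P) -size_poly_eq0 size_XnsubC.
have rsym : r \Po (-1 *: 'X) = (-1) ^+ odd (absz k) *: r.
  apply: (mulIf X2); rewrite -scalerAl -pE -psym pE comp_polyM; congr (_ * _).
  by rewrite rmorphB rmorphXn rmorph1 /= comp_polyX exprZn sqrrN expr1n scale1r.
have [s sE] := poly_parity two rsym.
exists s, ((k + odd (absz k)) %/ 2)%Z.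
have -> : ((k + odd (absz k)) %/ 2)%Z *+ 2 = k + odd (absz k) by lia.
have t2 : (tvar ^+ 2 - 1 : {fraction {poly A}}) != 0.
  by rewrite -tofrac1 -rmorphXn -rmorphB tofrac_eq0.
apply: (mulIf t2); rewrite (mulfVK t2) fE pE sE tvarD !rmorphM rmorphB rmorphXn rmorph1.
by rewrite rmorphXn -!mulrA.
Qed.

(** * Exactness for the sign character *)

Lemma fox_chi_map (K K' : comNzRingType) (f : {rmorphism K -> K'}) (G : groupType) m
    (x : 'I_m.+1 -> G) (chi : G -> K) c :
  f (fox_chi x chi c) = fox_chi x (fun g => f (chi g)) c.
Proof. by rewrite rmorph_sum; apply: eq_bigr => p _; rewrite /= rmorphMz. Qed.

Lemma fox_bordered_map (K K' : comNzRingType) (f : {rmorphism K -> K'})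
    (G : groupType) m (x : 'I_m.+1 -> G) rel (chi : G -> K) w :
  f (\det (fox_chi_bordered x rel chi w)) =
  \det (fox_chi_bordered x rel (fun g => f (chi g)) w).
Proof.
rewrite -det_map_mx; congr (\det _); apply/matrixP => i j.
by rewrite !mxE fox_chi_map.
Qed.

Lemma fox_chi_ext (K : comNzRingType) (G : groupType) m (x : 'I_m.+1 -> G) rel
    (chi chi' : G -> K) w : (forall g, chi g = chi' g) ->
  fox_chi_bordered x rel chi w = fox_chi_bordered x rel chi' w.
Proof.
move=> E; apply/matrixP => i j; rewrite !mxE.
by apply: eq_bigr => p _; rewrite E.
Qed.

Lemma fox_chi_exact (K : fieldType) (G : groupType) m (x : 'I_m.+1 -> G) rel
    (chi : G -> K) w :
    (forall g h, chi (g * h)%g = chi g * chi h) -> chi 1%g = 1 ->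
    (forall i, word_eval x (rel i) = 1%g) -> chi (word_eval x w) - 1 != 0 ->
    \det (fox_chi_bordered x rel chi w) != 0 ->
  fox_exact x (fun v g => v * chi g) rel.
Proof.
move=> chiM chi1 relP w1 dS y y0; set S := fox_chi_bordered x rel chi w in dS.
have SU : S \in unitmx by rewrite unitmxE unitfE.
pose u := (\row_j y j) *m invmx S.
have yE j : y j = \sum_(i < m) u 0 (lift ord_max i) * fox_chi x chi (fox j (rel i)) +
    u 0 ord_max * fox_chi x chi (fox j w).
  have : (u *m S) 0 j = y j by rewrite mulmxKV // mxE.
  rewrite mxE (bigD1_ord ord_max) //= addrC => <-; congr (_ + _).
    by apply: eq_bigr => i _; rewrite [S _ _]mxE /bordered_word liftK.
  by rewrite [S _ _]mxE /bordered_word unlift_none.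
have actE v c : fox_act x (fun v g => v * chi g) v c = v * fox_chi x chi c.
  by rewrite /fox_chi mulr_sumr; apply: eq_bigr => p _; rewrite mulrzAr.
have u0 : u 0 ord_max * (chi (word_eval x w) - 1) = 0.
  rewrite -[RHS]y0 -(fox_chi_fundamental x chiM chi1) mulr_sumr.
  have -> : \sum_j (y j * chi (x j) - y j) = \sum_j y j * (chi (x j) - 1).
    by apply: eq_bigr => j _; rewrite mulrBr mulr1.
  under [RHS]eq_bigr => j _ do rewrite yE mulrDl mulr_suml.
  rewrite big_split /= exchange_big [X in X + _]big1 ?add0r => [|i _].
    by apply: eq_bigr => j _; rewrite mulrA.
  under eq_bigr do rewrite -mulrA.
  by rewrite -mulr_sumr fox_chi_fundamental // relP chi1 subrr mulr0.
move/eqP: u0; rewrite mulf_eq0 (negbTE w1) orbF => /eqP u0.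
exists (fun i => u 0 (lift ord_max i)) => j.
by rewrite yE u0 mul0r addr0; apply: eq_bigr => i _; rewrite actE.
Qed.

Lemma fox_chi1_word_sum (K : comNzRingType) (G : groupType) m (x : 'I_m.+1 -> G)
    (h : 'I_m.+1 -> K) w :
  \sum_j fox_chi x (fun=> 1) (fox j w) * h j = word_sum h w.
Proof.
elim: w => [|[i b] w IH].
  by rewrite /word_sum big_nil big1 // => j _; rewrite /fox_chi big_nil mul0r.
rewrite /word_sum big_cons -/(word_sum h w) -IH (bigD1 i) //= eqxx.
rewrite [X in _ + X](eq_bigr (fun j => fox_chi x (fun=> 1) (fox j w) * h j)) => [|j ji].
  rewrite [in RHS](bigD1 i) //= addrA; congr (_ + _).
  rewrite /fox_chi big_cons big_map mulrDl; congr (_ + _).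
  by case: b; rewrite /= ?mulrN1z ?mulr1z ?mulN1r ?mul1r.
by rewrite eq_sym (negbTE ji) /= /fox_chi big_map.
Qed.

Section Parity.
Variables (G : groupType) (m : nat) (P : deficiency_one_presentation G m).
Variables (alpha : G -> int) (w : word m.+1).
Hypothesis ab : abelianization alpha.
Hypothesis w1 : alpha (word_eval (gen P) w) = 1.
Local Notation par g := (odd (absz (alpha g))).

(** A vector of the kernel of the bordered matrix is a homomorphism to the field with
    two elements that kills an element of degree one; such a homomorphism is zero. *)
Lemma fox_F2_bordered_neq0 :
  \det (fox_chi_bordered (gen P) (relator P) (fun=> 1 : 'F_2) w) != 0.
Proof.
set S := fox_chi_bordered _ _ _ _.
apply/negP => /eqP dS; have : \det S^T == 0 by rewrite det_tr dS.
case/det0P => v /negP v0 vS; apply: v0; apply/eqP/rowP => j; rewrite mxE.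
pose h j := v 0 j.
have Sh i : word_sum h (bordered_word (relator P) w i) = 0.
  rewrite -(fox_chi1_word_sum (gen P)).
  have := congr1 (fun M : 'rV__ => M 0 i) vS; rewrite !mxE => E; rewrite -[RHS]E.
  by apply: eq_bigr => k _; rewrite !mxE mulrC.
have hrel i : word_sum h (relator P i) = 0.
  by have := Sh (lift ord_max i); rewrite /bordered_word liftK.
have hw : word_sum h w = 0 by have := Sh ord_max; rewrite /bordered_word unlift_none.
have [f [fM fE]] := presents_additive (presentationP P) hrel.
have := abelianization_factor ab w1 fM (gen P j).
rewrite fE hw mul0rz => f0.
by have := fE [:: (j, false)]; rewrite /= mulg1 f0 /word_sum big_seq1 => /esym.
Qed.

(** The determinant is an integer, and its reduction modulo 2 is the determinant of
    [fox_F2_bordered_neq0] because -1 = 1 there. *)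
Lemma fox_sign_bordered_neq0 (C : numFieldType) :
  \det (fox_chi_bordered (gen P) (relator P) (fun g => (-1) ^+ par g : C) w) != 0.
Proof.
have E : \det (fox_chi_bordered (gen P) (relator P) (fun g => (-1) ^+ par g : C) w) =
    (\det (fox_chi_bordered (gen P) (relator P) (fun g => (-1) ^+ par g : int) w))%:~R.
  rewrite -[RHS]/((intr : {rmorphism int -> C}) _) fox_bordered_map; congr (\det _).
  by apply: fox_chi_ext => g; rewrite /= rmorph_sign.
rewrite E intr_eq0; apply/eqP => d0.
have := fox_F2_bordered_neq0; rewrite (_ : \det _ = (0 : int)%:~R) ?eqxx //.
rewrite -d0 -[RHS]/((intr : {rmorphism int -> 'F_2}) _) fox_bordered_map; congr (\det _).
apply: fox_chi_ext => g; rewrite /= rmorph_sign.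
by case: (par g); rewrite // expr1; apply: val_inj.
Qed.

Lemma fox_sign_exact (C : numFieldType) :
  fox_exact (gen P) (fun (v : C) g => v * (-1) ^+ par g) (relator P).
Proof.
apply: (fox_chi_exact (w := w)) => [g h||i||].
- by rewrite abelianizationM // odd_absD signr_addb.
- by rewrite abelianization1.
- exact: word_eval_rel (presentationP P).
- by rewrite w1 /= expr1 -opprD oppr_eq0 -[1 + 1]/(2%:R) pnatr_eq0.
- exact: fox_sign_bordered_neq0.
Qed.

End Parity.

(** The Fox complex of a direct sum is the direct sum of the Fox complexes. *)
Lemma fox_exact_prod (G : groupType) k n (x : 'I_n -> G) (rel : 'I_k -> word n)
    (V V1 V2 : zmodType) (act : V -> G -> V) (act1 : V1 -> G -> V1) (act2 : V2 -> G -> V2)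
    (t1 : {additive V -> V1}) (t2 : {additive V -> V2}) (s : V1 -> V2 -> V) :
    (forall v g, t1 (act v g) = act1 (t1 v) g) ->
    (forall v g, t2 (act v g) = act2 (t2 v) g) ->
    (forall a b, t1 (s a b) = a) -> (forall a b, t2 (s a b) = b) ->
    (forall v v', t1 v = t1 v' -> t2 v = t2 v' -> v = v') ->
  fox_exact x act1 rel -> fox_exact x act2 rel -> fox_exact x act rel.
Proof.
move=> e1 e2 s1 s2 tinj ex1 ex2 w w0.
have [|u1 u1E] := ex1 (fun j => t1 (w j)).
  rewrite -[RHS](raddf0 t1) -w0 raddf_sum; apply: eq_bigr => j _.
  by rewrite raddfB e1.
have [|u2 u2E] := ex2 (fun j => t2 (w j)).
  rewrite -[RHS](raddf0 t2) -w0 raddf_sum; apply: eq_bigr => j _.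
  by rewrite raddfB e2.
exists (fun i => s (u1 i) (u2 i)) => j; apply: tinj.
  rewrite u1E raddf_sum; apply: eq_bigr => i _.
  by rewrite /fox_act raddf_sum; apply: eq_bigr => p _; rewrite raddfMz e1 s1.
rewrite u2E raddf_sum; apply: eq_bigr => i _.
by rewrite /fox_act raddf_sum; apply: eq_bigr => p _; rewrite raddfMz e2 s2.
Qed.

(** * The Fox complex of sl_2 *)

(** The invariant form of sl_2 pairs E with F. So in the coordinates F, E the action of
    Ad o rho^-1 on columns becomes the action of psi_2 on rows, the one that Fox
    matrices use. *)
Section Sl2Coordinates.
Variables (R : realType) (U : 'M[R[i]]_3).
Local Notation C := R[i].

Definition sl2_H_part (v : 'cV[C]_3) : C := (U *m v) (lift ord0 ord0) 0.
Definition sl2_FE_part (v : 'cV[C]_3) : 'rV[C]_2 :=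
  \row_k (U *m v) (if k == 0 then ord_max else ord0) 0.

Lemma sl2_H_part_zmod : zmod_morphism sl2_H_part.
Proof. by move=> u v; rewrite /sl2_H_part mulmxBr mxE [in X in _ + X]mxE. Qed.

Lemma sl2_FE_part_zmod : zmod_morphism sl2_FE_part.
Proof.
move=> u v; apply/rowP => k; rewrite [LHS]mxE [RHS]mxE [in RHS]mxE [X in _ = _ + X]mxE.
by rewrite mulmxBr mxE [in X in _ + X = _]mxE [X in _ = _ + - X]mxE.
Qed.

HB.instance Definition _ := GRing.isZmodMorphism.Build _ _ _ sl2_H_part_zmod.
HB.instance Definition _ := GRing.isZmodMorphism.Build _ _ _ sl2_FE_part_zmod.

Definition sl2_of_parts (a : C) (b : 'rV[C]_2) : 'cV[C]_3 :=
  invmx U *m \col_k [:: b 0 1; a; b 0 0]`_k.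

Hypothesis UU : U \in unitmx.

Lemma sl2_H_partK a b : sl2_H_part (sl2_of_parts a b) = a.
Proof. by rewrite /sl2_H_part mulKVmx // mxE. Qed.

Lemma sl2_FE_partK a b : sl2_FE_part (sl2_of_parts a b) = b.
Proof.
apply/rowP => k; rewrite mxE mulKVmx // mxE.
by case: k => -[|[|]] //= k; congr (b _ _); exact: val_inj.
Qed.

Lemma sl2_parts_inj u v : sl2_H_part u = sl2_H_part v ->
  sl2_FE_part u = sl2_FE_part v -> u = v.
Proof.
move=> H /rowP FE; rewrite -[u](mulKmx UU) -[v](mulKmx UU); congr (_ *m _).
apply/colP => k; have E := FE 1; have F := FE 0; rewrite !mxE /= in E F.
case: k => -[|[|[|]]] //= k.
- by rewrite (_ : Ordinal k = ord0) ?mxE //; exact: val_inj.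
- by rewrite (_ : Ordinal k = lift ord0 ord0) //; exact: val_inj.
- by rewrite (_ : Ordinal k = ord_max) ?mxE //; exact: val_inj.
Qed.

End Sl2Coordinates.

Lemma Ad_mx_unit (R : realType) (A : 'M[R[i]]_2) : A \in unitmx -> Ad_mx A \in unitmx.
Proof.
move=> AU; have AV : invmx A \in unitmx by rewrite unitmx_inv.
have E : Ad_mx A *m Ad_mx (invmx A) = 1%:M.
  by rewrite -(Ad_mx_mul AU AV) (mulmxV AU) Ad_mx1.
exact: (mulmx1_unit E).1.
Qed.

Section Conjugation.
Variables (R : realType) (G : groupType) (alpha : G -> int) (n : nat).
Local Notation C := R[i].
Variables (y : 'I_n.+1 -> G) (rho rho0 : G -> 'M[C]_2) (z : 'I_n -> C) (Q : 'M[C]_2).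
Hypothesis ab : abelianization alpha.
Hypothesis ygen : forall g, exists w, word_eval y w = g.
Hypothesis mu1 : alpha (y ord_max) = 1.
Hypothesis alpha0 : forall j, alpha (y (lift ord_max j)) = 0.
Hypothesis hrho : SL2_representation rho.
Hypothesis QU : Q \in unitmx.
Hypothesis hrho0 : forall g, rho0 g = Q *m rho g *m invmx Q.
Hypothesis rho0y : forall j, rho0 (y (lift ord_max j)) = mx22 (z j) 0 0 (z j)^-1.
Hypothesis rho0mu : rho0 (y ord_max) = mx22 0 1 (-1) 0.
Local Notation par g := (odd (absz (alpha g))).

Lemma conj_SL2 : SL2_representation rho0.
Proof.
have [rM rD] := hrho; split=> [g h|g]; rewrite !hrho0.
  by rewrite rM !mulmxA mulmxKV.
by rewrite !det_mulmx rD mulr1 -det_mulmx mulmxV // det1.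
Qed.

Let h0 := conj_SL2.

Lemma Ad_conj g : Ad_mx (rho g) = invmx (Ad_mx Q) *m Ad_mx (rho0 g) *m Ad_mx Q.
Proof.
have rU := SL2_unit g hrho; have SU := Ad_mx_unit QU.
have E : rho0 g *m Q = Q *m rho g by rewrite hrho0 mulmxKV.
by rewrite -mulmxA -Ad_mx_mul ?(SL2_unit g h0) // E Ad_mx_mul // mulKmx.
Qed.

(** If all z_j were square roots of 1, then the rho0 x_j would be scalars and (1, i), an
    eigenvector of rho0 mu, would span an invariant line. *)
Lemma irreducible_lin : irreducible2 rho -> exists j, z j ^+ 2 != 1.
Proof.
move=> irr; apply: contrapT => nz; apply: irr.
have z2 j : z j ^+ 2 = 1.
  by apply/eqP; apply/negPn/negP => zj; apply: nz; exists j.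
have z1 j : (z j)^-1 = z j.
  have zj := lin_z_neq0 h0 rho0y j.
  by rewrite -[LHS]mulr1 -(z2 j) expr2 mulKf.
pose v0 : 'cV[C]_2 := \col_k [:: 1; 'i%C]`_k.
have v00 : v0 != 0.
  by apply/eqP => /colP/(_ 0)/eqP; rewrite !mxE /= oner_eq0.
have base k : exists c, rho0 (y k) *m v0 = c *: v0.
  have [j ->|->] := unliftP ord_max k.
    exists (z j); rewrite rho0y z1; apply/colP => l; rewrite !mxE !big_ord_recl big_ord0 !mxE /=.
    by case: l => -[|[|]] //= l; rewrite ?mul0r ?addr0 ?add0r.
  exists 'i%C; rewrite rho0mu; apply/colP => l; rewrite !mxE !big_ord_recl big_ord0 !mxE /=.
  case: l => -[|[|]] //= l; rewrite ?mul0r ?addr0 ?add0r ?mul1r ?mulr1 //.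
  by rewrite -expr2 sqr_i.
have [rM _] := h0.
have eig g : exists c, rho0 g *m v0 = c *: v0.
  have [w <-] := ygen g; elim: w => [|[k b] w [c cE]] /=.
    by exists 1; rewrite (SL2_one h0) mul1mx scale1r.
  have [d dE] : exists d, rho0 (if b then (y k)^-1 else y k)%g *m v0 = d *: v0.
    case: b; last exact: base.
    have [d dE] := base k; exists d^-1; rewrite (rep_inv _ rM (SL2_one h0)).
    have U := SL2_unit (y k) h0.
    have d0 : d != 0.
      apply: contraNneq v00 => d0; rewrite -(mulKmx U v0) dE d0 scale0r mulmx0 //.
    by rewrite -{1}[v0](scalerK d0) -dE -scalemxAr mulKmx.
  by exists (c * d); rewrite rM -mulmxA cE -scalemxAr dE scalerA.
exists (invmx Q *m v0); split.
  by apply: contraNneq v00 => E; rewrite -(mulKVmx QU v0) E mulmx0.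
move=> g; have [c cE] := eig g; exists c.
have -> : rho g = invmx Q *m rho0 g *m Q.
  by rewrite hrho0 !mulmxA mulVmx // mul1mx mulmxKV.
by rewrite -!mulmxA mulKVmx // cE -scalemxAr.
Qed.

Lemma sl2_exact m (P : deficiency_one_presentation G m) :
  fox_exact (gen P) (@row_act _ _ _ (psi2 rho0) 1) (relator P) ->
  fox_exact (gen P) (fun (v : 'cV[C]_3) g => Ad_mx (rho g^-1%g) *m v) (relator P).
Proof.
move=> ex2; have SU := Ad_mx_unit QU.
have [w wE] := (presentationP P).1 (y ord_max).
have w1 : alpha (word_eval (gen P) w) = 1 by rewrite wE.
have act g (v : 'cV[C]_3) : Ad_mx Q *m (Ad_mx (rho g^-1%g) *m v) = Ad_mx (rho0 g^-1%g) *m (Ad_mx Q *m v).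
  by rewrite Ad_conj -[_ *m Ad_mx Q *m v]mulmxA -mulmxA (mulKVmx SU).
have [rM _] := h0.
apply: (fox_exact_prod (t1 := sl2_H_part (Ad_mx Q)) (t2 := sl2_FE_part (Ad_mx Q))
  (s := sl2_of_parts (Ad_mx Q)) _ _ _ _ _ (@fox_sign_exact _ _ P alpha w ab w1 C) ex2).
- move=> v g; rewrite /= /sl2_H_part (act g v); set u := _ *m v.
  have [a a0 E] := lin_dihedral ab ygen mu1 alpha0 h0 rho0y rho0mu g^-1%g.
  have pV : par g^-1%g = par g.
    have := par_mul ab g^-1%g g; rewrite mulVg (abelianization1 ab).
    by case: (par g^-1%g); case: (par g).
  rewrite mxE !big_ord_recl big_ord0 E Ad_dihedral // !mxE pV /= addr0.
  by case: (par g); rewrite /= ?mul0r ?add0r ?addr0 mulrC.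
- move=> v g; rewrite /= /row_act; apply/rowP => k.
  have [a a0 E] := lin_dihedral ab ygen mu1 alpha0 h0 rho0y rho0mu g.
  have EV : rho0 g^-1%g = dihedral_mx (par g) (if par g then - a else a^-1).
    by rewrite (rep_inv _ rM (SL2_one h0)) E; apply: invmx_eq; exact: dihedral_inv.
  have b0 : (if par g then - a else a^-1) != 0.
    by case: ifP; rewrite ?oppr_eq0 ?invr_eq0.
  have FE v' l : sl2_FE_part (Ad_mx Q) v' 0 l =
      (Ad_mx Q *m v') (if l == 0 then ord_max else ord0) 0 by rewrite mxE.
  rewrite FE (act g v) EV [RHS]mxE !big_ord_recl big_ord0 !FE /psi2 !AdEF_mxE E.
  rewrite (Ad_dihedral _ a0) (Ad_dihedral _ b0); move: (Ad_mx Q *m v) => u.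
  have e3 : lift ord0 (lift ord0 ord0) = ord_max :> 'I_3 by exact: val_inj.
  rewrite !mxE !big_ord_recl big_ord0 !mxE e3 /to_EHF.
  by case: k => -[|[|]] // k; case: (par g); rewrite /=; field; rewrite ?a0.
- exact: sl2_H_partK.
- exact: sl2_FE_partK.
- exact: sl2_parts_inj.
Qed.

End Conjugation.

(** * The twisted polynomials of the summands *)

Lemma scalerC (K : comNzRingType) (V : lmodType K) (a b : K) (v : V) :
  a *: (b *: v) = b *: (a *: v).
Proof. by rewrite !scalerA mulrC. Qed.

Lemma dilation_alpha_tensor (A : idomainType) (a : A) (a0 : a != 0) (G : groupType) n
    (alpha : G -> int) (phi : G -> 'M[A]_n) g :
  map_mx (dilation a0) (alpha_tensor alpha phi g) =
  cst_frac a ^ alpha g *: alpha_tensor alpha phi g.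
Proof.
apply/matrixP => i j; rewrite !mxE rmorphM /= dilation_tvarX dilation_cst.
by rewrite mulrA.
Qed.

Section TwistedPolynomials.
Variables (R : realType) (G : groupType) (alpha : G -> int) (n : nat).
Local Notation C := R[i].
Variables (y : 'I_n.+1 -> G) (rho rho0 : G -> 'M[C]_2) (z : 'I_n -> C) (Q : 'M[C]_2).
Hypothesis ab : abelianization alpha.
Hypothesis ygen : forall g, exists w, word_eval y w = g.
Hypothesis mu1 : alpha (y ord_max) = 1.
Hypothesis alpha0 : forall j, alpha (y (lift ord_max j)) = 0.
Hypothesis hrho : SL2_representation rho.
Hypothesis QU : Q \in unitmx.
Hypothesis hrho0 : forall g, rho0 g = Q *m rho g *m invmx Q.
Hypothesis rho0y : forall j, rho0 (y (lift ord_max j)) = mx22 (z j) 0 0 (z j)^-1.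
Hypothesis rho0mu : rho0 (y ord_max) = mx22 0 1 (-1) 0.
Variables (m : nat) (P : deficiency_one_presentation G m) (l : 'I_m.+1).
Local Notation par g := (odd (absz (alpha g))).
Local Notation tw phi := (twist (gen P) (relator P) (alpha_tensor alpha phi) l).

Let h0 := conj_SL2 hrho QU hrho0.
Let psi2M' := psi2M ab ygen mu1 alpha0 h0 rho0y rho0mu.
Let psi21' := psi21 ab ygen mu1 alpha0 h0 rho0y rho0mu.
Let relP i : word_eval (gen P) (relator P i) = 1%g.
Proof. exact: word_eval_rel (presentationP P). Qed.

Lemma twist_psi2_associated (arho : G -> 'M[C]_2) :
    SL2_representation arho ->
    (forall j, arho (y (lift ord_max j)) = mx22 (z j ^+ 2) 0 0 (z j ^+ 2)^-1) ->
    arho (y ord_max) = mx22 0 1 (-1) 0 ->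
  tw (psi2 rho0) = dilate 'i%C (tw arho).
Proof.
move=> harho arhoy arhomu.
have i0 : 'i%C != 0 :> C by rewrite -sqrf_eq0 sqr_i oppr_eq0 oner_eq0.
rewrite (dilateE i0) twist_map.
pose D : 'M[C]_2 := mx22 1 0 0 (- 'i)%C; pose D' : 'M[C]_2 := mx22 1 0 0 'i%C.
have DD' : D *m D' = 1%:M.
  by rewrite mx22_mul !mulr0 !mul0r !addr0 !add0r mulr1 mulNr -expr2 sqr_i opprK mx22_1.
have cDD' : map_mx (@cst_frac C) D *m map_mx (@cst_frac C) D' = 1%:M.
  by rewrite -map_mxM DD' map_mx1.
apply: (twist_conj _ _ _ cDD') => g.
rewrite dilation_alpha_tensor /alpha_tensor (psi2_associated ab ygen mu1 alpha0 h0 rho0y rho0mu harho arhoy arhomu).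
rewrite !map_mxM -/D -/D' map_mxZ fmorphXz.
exact: scale_conj.
Qed.

(** Replacing t by -t multiplies psi_2 by (-1)^alpha. As psi_2 is diagonal in even and
    antidiagonal in odd degrees, this amounts to conjugation by diag(1, -1). *)
Lemma twist_psi2_even : dilate (-1) (tw (psi2 rho0)) = tw (psi2 rho0).
Proof.
have n1 : (-1 : C) != 0 by rewrite oppr_eq0 oner_eq0.
rewrite (dilateE n1) twist_map.
pose J : 'M[C]_2 := mx22 1 0 0 (-1).
have JJ : J *m J = 1%:M.
  by rewrite mx22_mul !mulr0 !mul0r !addr0 !add0r mulr1 mulrNN mulr1 mx22_1.
have cJJ : map_mx (@cst_frac C) J *m map_mx (@cst_frac C) J = 1%:M.
  by rewrite -map_mxM JJ map_mx1.
apply: (twist_conj _ _ _ cJJ) => g; rewrite dilation_alpha_tensor /alpha_tensor.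
have E : J *m psi2 rho0 g *m J = (-1) ^ alpha g *: psi2 rho0 g.
  have [a a0 ->] := psi2_dihedral ab ygen mu1 alpha0 h0 rho0y rho0mu g.
  rewrite expN1z; case: (par g); rewrite !mx22_mul; apply/matrixP => i j; rewrite !mxE;
  by case: (i == 0); case: (j == 0); rewrite /= ?expr0 ?expr1; ring.
rewrite -scalemxAr -scalemxAl -!map_mxM E map_mxZ fmorphXz.
exact: scalerC.
Qed.

(** Degree zero makes det (psi_2 w - 1) a constant, so Wada's quotient is a constant
    multiple of the bordered determinant. *)
Lemma twist_psi2_value1 w :
    alpha (word_eval (gen P) w) = 0 ->
    \det (psi2 rho0 (word_eval (gen P) w) - 1%:M) != 0 ->
  exists c, value1 (tw (psi2 rho0)) (\det (fox_bordered (gen P) (relator P) (psi2 rho0) l w) * c).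
Proof.
move=> w0 d0; set d := \det _ in d0; pose Phi := alpha_tensor alpha (psi2 rho0).
pose T := \det (fox_bordered (gen P) (relator P) Phi l w).
pose M := \det (fox_minor (gen P) (relator P) Phi l).
pose B := \det (Phi (gen P l) - 1%:M).
have dE : \det (Phi (word_eval (gen P) w) - 1%:M) = cst_frac d.
  rewrite /Phi /alpha_tensor w0 expr0z scale1r -(map_mx1 (@cst_frac C)) -map_mxB.
  exact: det_map_mx.
have E : T * B = M * cst_frac d.
  apply: etrans (congr1 ( *%R M) dE).
  exact: (fox_bordered_det (alpha_tensorM ab psi2M') (alpha_tensor1 ab psi21') relP l w).
have V : value1 T (\det (fox_bordered (gen P) (relator P) (psi2 rho0) l w)).
  exact: value1_bordered.
rewrite /twist -/Phi -/M -/B.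
(* If the denominator vanishes, the quotient is zero by convention. *)
have [-> | B0] := eqVneq B 0.
  by exists 0; rewrite invr0 !mulr0; have := value1_cst (0 : C); rewrite rmorph0.
exists d^-1; have -> : M / B = T * cst_frac d^-1.
  apply: (mulIf B0); rewrite mulfVK // mulrAC E -mulrA -rmorphM /= divff // rmorph1 mulr1 //.
exact: value1M V (value1_cst _).
Qed.

Lemma twist_Ad_split : tw (fun g => Ad_mx (rho g)) =
  tw (psi1 R alpha) * tw (psi2 rho0).
Proof.
rewrite -twist_block.
pose U : 'M[C]_3 := invmx (Ad_mx Q) *m swapEH R; pose V : 'M[C]_3 := swapEH R *m Ad_mx Q.
have cUV : map_mx (@cst_frac C) U *m map_mx (@cst_frac C) V = 1%:M.
  rewrite -map_mxM /U /V -mulmxA (mulmxA (swapEH R) (swapEH R)) swapEH_mul mul1mx.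
  by rewrite (mulVmx (Ad_mx_unit QU)) map_mx1.
apply: (twist_conj _ _ _ cUV) => g; rewrite /alpha_tensor (Ad_conj hrho QU hrho0).
rewrite (Ad_rho0_block ab ygen mu1 alpha0 h0 rho0y rho0mu).
have -> : block_mx (tvar ^ alpha g *: map_mx (@cst_frac C) (psi1 R alpha g)) 0 0
    (tvar ^ alpha g *: map_mx (@cst_frac C) (psi2 rho0 g)) =
    tvar ^ alpha g *: map_mx (@cst_frac C) (block_mx (psi1 R alpha g) 0 0 (psi2 rho0 g)).
  by rewrite map_block_mx scale_block_mx !map_mx0 !scaler0.
by rewrite -scalemxAr -scalemxAl -!map_mxM /U /V !mulmxA.
Qed.

End TwistedPolynomials.

(** * The theorem *)

Lemma mul_div_opp (F : fieldType) (a b c d : F) : a != 0 ->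
  a * c * (d / - (a * b)) = - (c / b * d).
Proof.
move=> a0; rewrite invrN invfM !mulrN; congr (- _).
by rewrite -[RHS]mul1r -(divff a0); ring.
Qed.

(** Exactness would make every singular 1-cycle a boundary, whereas longitude-regularity
    provides a cycle that is not one. *)
Lemma longitude_regular_singular (R : realType) (K : set 'rV[R]_4) (N : tubular_nbhd K)
    (rho : knot_group N -> 'M[R[i]]_2) m (P : deficiency_one_presentation (knot_group N) m) :
    SL2_representation rho -> longitude_regular rho ->
  ~ fox_exact (gen P) (fun (v : 'cV[R[i]]_3) g => Ad_mx (rho g^-1%g) *m v) (relator P).
Proof.
move=> hrho [_ [c [cyc nc _]] _ _] ex; apply: nc.
pose actg (v : 'cV[R[i]]_3) (g : knot_group N) := Ad_mx (rho g^-1%g) *m v.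
have actD g : {morph actg^~ g : u v / u + v} by move=> u v; exact: mulmxDr.
have actM v g h : actg v (g * h)%g = actg (actg v g) h.
  have [rM _] := hrho; rewrite /actg mulmxA invgM rM.
  by rewrite (Ad_mx_mul (SL2_unit _ hrho) (SL2_unit _ hrho)).
have act1 v : actg v 1%g = v.
  by rewrite /actg invg1 (SL2_one hrho) Ad_mx1 mul1mx.
apply: (@cycle_null R _ _ (exterior N) actg actD actM) => // Q L LD LM s.
exact: (crossed_vanish actD actM act1 LD LM (presentationP P) ex).
Qed.

Theorem theorem4p4 (R : realType)
    (K : set 'rV[R]_4) (N : tubular_nbhd K) (hN : preferred_framing N)
    (alpha : knot_group N -> int) (halpha : abelianization alpha)
    (hmu : alpha (mu N) = 1)
    (g : nat) (L : lin_presentation N g)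
    (m : nat) (P : deficiency_one_presentation (knot_group N) m)
    (l : 'I_m.+1) (hl : alpha (gen P l) <> 0)
    (Delta_K : {poly int}) (hDelta : alexander_polynomial P alpha Delta_K)
    (rho : knot_group N -> 'M[R[i]]_2)
    (hrho : SL2_representation rho)
    (hirr : irreducible2 rho) (hmet : metabelian rho)
    (Q : 'M[R[i]]_2) (hQ : Q \in unitmx)
    (rho0 : knot_group N -> 'M[R[i]]_2)
    (hrho0 : forall x, rho0 x = Q *m rho x *m invmx Q)
    (z : 'I_(2 * g) -> R[i]) (hform : lin_form L rho0 z)
    (arho : knot_group N -> 'M[R[i]]_2)
    (harho : SL2_representation arho)
    (hassoc : lin_form L arho (fun i => z i ^+ 2)) :
  let tw_psi2 := twisted_alexander P alpha (fun x => AdEF_mx (rho0 x)) l in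
  let tw_arho := twisted_alexander P alpha arho l in
  let tw_Ad := twisted_alexander P alpha (fun x => Ad_mx (rho x)) l in
  doteq tw_psi2 (dilate 'i%C tw_arho) /\
  (longitude_regular rho ->
   let quotient := dilate 'i%C tw_arho / (tvar ^+ 2 - 1) in
   even_laurent quotient /\
   doteq tw_Ad
     ((tvar - 1) * dilate (-1) (tofrac (map_poly intr Delta_K)) * quotient)).
Proof.
move=> tw_psi2 tw_arho tw_Ad.
pose y := lin_generator N (lin_x L).
have pres : presents y (lin_relator (lin_ap L) (lin_am L)) := lin_presents L.
have ygen := pres.1.
have ymu : y ord_max = mu N by rewrite /y /lin_generator unlift_none.
have yx j : y (lift ord_max j) = pi1_class (exterior N) (lin_x L j).
  by rewrite /y /lin_generator liftK.
have mu1 : alpha (y ord_max) = 1 by rewrite ymu.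
have alpha0 := lin_generator_alpha halpha pres mu1.
have [hx hm] := hform.
have rho0y j : rho0 (y (lift ord_max j)) = mx22 (z j) 0 0 (z j)^-1 by rewrite yx.
have rho0mu : rho0 (y ord_max) = mx22 0 1 (-1) 0 by rewrite ymu.
have [ax amu] := hassoc.
have arhoy j : arho (y (lift ord_max j)) = mx22 (z j ^+ 2) 0 0 (z j ^+ 2)^-1.
  by rewrite yx ax.
have arhomu : arho (y ord_max) = mx22 0 1 (-1) 0 by rewrite ymu.
have h0 := conj_SL2 hrho hQ hrho0.
have psi2E : tw_psi2 = twist (gen P) (relator P) (alpha_tensor alpha (psi2 rho0)) l.
  by apply: twisted_alexanderE => //; exact: psi21 halpha ygen mu1 alpha0 h0 rho0y rho0mu.
have arhoE : tw_arho = twist (gen P) (relator P) (alpha_tensor alpha arho) l.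
  by apply: twisted_alexanderE => //; exact: SL2_one harho.
have AdE : tw_Ad = twist (gen P) (relator P) (alpha_tensor alpha (fun x => Ad_mx (rho x))) l.
  by apply: twisted_alexanderE => //=; rewrite (SL2_one hrho) Ad_mx1.
clearbody tw_psi2 tw_arho tw_Ad.
have E : tw_psi2 = dilate 'i%C tw_arho.
  rewrite psi2E arhoE.
  exact: (twist_psi2_associated halpha ygen mu1 alpha0 hrho hQ hrho0 rho0y rho0mu
    P l harho arhoy arhomu).
split; first by rewrite E; exact: doteq_refl.
move=> regular quotient; have two : (2 : R[i]) != 0 by rewrite pnatr_eq0.
have n1 : (-1 : R[i]) != 0 by rewrite oppr_eq0 oner_eq0.
split.
  rewrite /quotient -E; apply: (even_laurent_quotient two); last first.
    rewrite psi2E.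
    exact: (twist_psi2_even halpha ygen mu1 alpha0 hrho hQ hrho0 rho0y rho0mu).
  have [j zj] := irreducible_lin ygen hrho hQ hrho0 rho0y rho0mu hirr.
  have [w wE] := (presentationP P).1 (y (lift ord_max j)).
  have w0 : alpha (word_eval (gen P) w) = 0 by rewrite wE alpha0.
  have zj0 := lin_z_neq0 h0 rho0y j.
  have wU : psi2 rho0 (word_eval (gen P) w) - 1%:M \in unitmx.
    have -> : psi2 rho0 (word_eval (gen P) w) - 1%:M =
        mx22 (z j ^+ 2 - 1) 0 0 (z j ^- 2 - 1).
      apply/matrixP => k k'; rewrite mxE [X in X + _]AdEF_mxE wE rho0y.
      rewrite -/(dihedral_mx false (z j)) (Ad_dihedral _ zj0) !mxE.
      by case: k => -[|[|]] //= k; case: k' => -[|[|]] //= k'; rewrite ?subr0.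
    have zi : z j ^- 2 - 1 != 0.
      by rewrite subr_eq0 invr_eq1.
    have /mulmx1_unit[] // : mx22 (z j ^+ 2 - 1) 0 0 (z j ^- 2 - 1) *m
        mx22 (z j ^+ 2 - 1)^-1 0 0 (z j ^- 2 - 1)^-1 = 1%:M.
    rewrite mx22_mul !mulr0 !mul0r !addr0 !add0r mulfV ?subr_eq0 //.
    by rewrite mulfV // mx22_1.
  have wd : \det (psi2 rho0 (word_eval (gen P) w) - 1%:M) != 0.
    by rewrite -unitfE -unitmxE.
  have [c] := twist_psi2_value1 halpha ygen mu1 alpha0 hrho hQ hrho0 rho0y rho0mu l w0 wd.
  rewrite -psi2E; set b := \det _.
  have [->|b0] := eqVneq b 0; first by rewrite mul0r.
  case: (longitude_regular_singular hrho regular (P := P)).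
  apply: (sl2_exact halpha ygen mu1 alpha0 hrho hQ hrho0 rho0y rho0mu).
  apply: (fox_bordered_exact _ _ _ wU b0).
  - exact: psi2M halpha ygen mu1 alpha0 h0 rho0y rho0mu.
  - exact: psi21 halpha ygen mu1 alpha0 h0 rho0y rho0mu.
  - move=> i; exact: word_eval_rel (presentationP P).
rewrite AdE (twist_Ad_split halpha ygen mu1 alpha0 hrho hQ hrho0 rho0y rho0mu).
rewrite /quotient -E psi2E; set t2 := twist _ _ (alpha_tensor alpha (psi2 rho0)) _.
set D := dilate _ _.
have t1 := tvar_sub1_neq0 R[i].
have -> : (tvar - 1) * D * (t2 / (tvar ^+ 2 - 1)) = - (D / (- tvar - 1) * t2).
  have -> : tvar ^+ 2 - 1 = - ((tvar - 1) * (- tvar - 1)) :> {fraction {poly R[i]}} by ring.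
  exact: (mul_div_opp _ _ _ t1).
apply: (doteq_trans (doteqMr _ (twist_sign R[i] halpha hDelta hl))).
by rewrite -/D; exists true, 0; rewrite expr1 expr0z mulr1 mulN1r opprK.
Qed.
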